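(* Consider algorithm ALFCG-MVR1 (defined in the context) applied to $\min_{x\in\mathcal X}F(x)=f(x)+h(x)$, $f(x)=\mathbb E_\xi[f(x;\xi)]$, under unbiasedness, bounded variance $\sigma^2$, bounded (sub)gradients, and average smoothness ($f$ is $L$-smooth). If $\beta=\nu\sigma^2$ with $\nu=\mathcal O(1)$, then $$\mathbb E\Big[\frac1{T+1}\sum_{t=0}^T\mathcal G(x_t)\Big]\le\tilde{\mathcal O}\Big(\nu^{1/2}(1+\sigma^{1/2})\sigma^{1/2}T^{-1/4}+T^{-1/2}\Big).$$ Consequently, for any $\epsilon>0$, ALFCG-MVR1 finds an $\epsilon$-approximate solution in expectation, i.e. $\mathbb E[\min_{0\le t\le T}\mathcal G(x_t)]\le\epsilon$, within at most $\tilde{\mathcal O}\Big(\frac{\sigma^2(1+\sigma^{1/2})^4}{\epsilon^4}+\frac1{\epsilon^2}\Big)$ iterations.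
   Context: Problem: $\mathcal X\subset\mathbb R^n$ is compact and convex with finite diameter $D=\sup_{x,y\in\mathcal X}\|x-y\|$ (Euclidean norm); $h:\mathbb R^n\to(-\infty,+\infty]$ is proper, closed and convex; $f(x)=\mathbb E_\xi[f(x;\xi)]$ is differentiable; $F=f+h$; $\mathrm{dom}(F)\cap\mathcal X\ne\emptyset$, and $F_*=\inf_{x\in\mathcal X}F(x)$ is finite and attained at $x_*\in\mathcal X$. Assumptions: $\mathbb E_\xi[\nabla f(x;\xi)]=\nabla f(x)$ and $\mathbb E_\xi\|\nabla f(x;\xi)-\nabla f(x)\|^2\le\sigma^2<\infty$; there is $G>0$ with $\|\nabla f(x)\|\le G$ and $\|\zeta\|\le G$ for all $x\in\mathcal X$, $\zeta\in\partial h(x)$; average smoothness: $\|\nabla f(x)-\nabla f(y)\|\le L\|x-y\|$ on $\mathcal X$. Frank-Wolfe gap: $\mathcal G(x)=\max_{v\in\mathcal X}\{\langle\nabla f(x),x-v\rangle+h(x)-h(v)\}$. Algorithm ALFCG-MVR1: parameters $\rho>0$, $\beta\ge0$; $x_{-1}=x_0\in\mathcal X$, $g_{-1}=0$. For $t=0,1,2,\dots$: draw a fresh sample (mini-batch) $\xi_t$ independent of the past, $\nabla f(\cdot;\xi_t)$ being the (mini-batch averaged) stochastic gradient; set $\alpha_t=\big(1+\sum_{i=0}^{t-1}(\beta+L_i^2\|x_{i+1}-x_i\|^2)\big)^{-1/2}$, $L_t=\rho\big(1+\sum_{i=0}^{t-1}L_i^2\|x_{i+1}-x_i\|^2\big)^{1/2}\alpha_t^{-1/2}$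 (so $\alpha_0=1$, $L_0=\rho$), $g_t=(1-\alpha_t)g_{t-1}+\alpha_t\nabla f(x_t;\xi_t)$; $v_t\in\arg\min_{v\in\mathcal X}\langle v,g_t\rangle+h(v)$; $x_{t+1}=x_t+\bar\eta_t(v_t-x_t)$ with $\bar\eta_t=\min\Big(\frac{h(x_t)-h(v_t)-\langle g_t,v_t-x_t\rangle}{L_t\|v_t-x_t\|^2},1\Big)$ (if $v_t=x_t$, then $x_{t+1}=x_t$). Convention: $\tilde{\mathcal O}(\cdot)$ suppresses polylogarithmic factors (in $T$, resp. $1/\epsilon$) and constants, where $L,D,G,\rho$, $\overline F=F(x_* )+2GD$, $\overline s=3(\sigma+G)$, $\overline\delta=4LD+26G+8\sigma+3\rho D$ and $\kappa=1+\overline\delta$ are regarded as $\mathcal O(1)$.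
   Formalization: ν is taken positive and the hidden constants may depend on 1/ν (and 1/ρ), since the bound with factor ν^{1/2} fails uniformly as ν→0; bounded subgradients is read as including that ∂h(x) is nonempty at every x in X, without which the gap can be +∞. *)

(* Defs.v *)
From mathcomp Require Export all_boot all_order all_algebra.
From mathcomp Require Export all_classical all_reals all_analysis.

Set Implicit Arguments.
Unset Strict Implicit.
Unset Printing Implicit Defensive.

Export Order.TTheory GRing.Theory Num.Theory.
Export numFieldNormedType.Exports.

Local Open Scope classical_set_scope.
Local Open Scope ring_scope.

Section Euclidean.
Context {R : realType} {n : nat}.
Implicit Types x y : 'rV[R]_n.

Definition dotp x y : R := \sum_(i < n) x 0 i * y 0 i.

(* The norm that the library puts on 'rV[R]_n is the sup norm; its topology
   (compactness, differentiability) is the Euclidean one, but every norm in the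
   mathematics below is this one. *)
Definition enorm x : R := Num.sqrt (dotp x x).

Definition diam (X : set 'rV[R]_n) : R :=
  sup [set enorm (xy.1 - xy.2) | xy in X `*` X].

Definition grad (f : 'rV[R]_n -> R) x : 'rV[R]_n :=
  \row_i 'D_(delta_mx 0 i) f x.

End Euclidean.

Section ExtendedConvex.
Context {R : realType} {n : nat}.
Implicit Types (h : 'rV[R]_n -> \bar R) (x y : 'rV[R]_n).
Local Open Scope ereal_scope.

Definition dom h : set 'rV[R]_n := [set x | h x < +oo].

Definition proper h : Prop := (forall x, -oo < h x) /\ dom h !=set0.

Definition epigraph h : set ('rV[R]_n * R) := [set p | h p.1 <= p.2%:E].

Definition closed_fun h : Prop := closed (epigraph h).

(* 0 * +oo = 0 in \bar R, so the endpoints a = 0 and a = 1 are harmless. *)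
Definition convex_efun h : Prop := forall x y (a : R), (0 <= a <= 1)%R ->
  h (a *: x + (1 - a) *: y)%R <= a%:E * h x + (1 - a)%:E * h y.

(* Empty outside dom h when h is proper. *)
Definition subdiff h x : set 'rV[R]_n :=
  [set zeta | forall y, h x + (dotp zeta (y - x))%:E <= h y].

Definition argmin_on (X : set 'rV[R]_n) (phi : 'rV[R]_n -> \bar R) :
  set 'rV[R]_n := [set v | X v /\ forall u, X u -> phi v <= phi u].

(* The supremum is a maximum as soon as X is a nonempty compact set and h is
   closed and finite on X. *)
Definition FW_gap (X : set 'rV[R]_n) (f : 'rV[R]_n -> R) h x : \bar R :=
  ereal_sup [set (dotp (grad f x) (x - v))%:E + h x - h v | v in X].

End ExtendedConvex.

Section Problem.
Context {R : realType} {n : nat}.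
Local Open Scope ereal_scope.

Definition objective (f : 'rV[R]_n -> R) (h : 'rV[R]_n -> \bar R) x : \bar R :=
  (f x)%:E + h x.

Record composite_problem (X : set 'rV[R]_n) (f : 'rV[R]_n -> R)
    (h : 'rV[R]_n -> \bar R) (xstar : 'rV[R]_n) : Prop := {
  feasible_compact : compact X;
  feasible_convex : convex_set X;
  h_proper : proper h;
  h_closed : closed_fun h;
  h_convex : convex_efun h;
  f_differentiable : forall x, differentiable f x;
  dom_meets_feasible : dom (objective f h) `&` X !=set0;
  minimum_finite : objective f h xstar \is a fin_num;
  minimum_attained : argmin_on X (objective f h) xstar
}.

(* The bound on the subgradients is a Lipschitz-type condition on h over X; it
   says nothing at a point with empty subdifferential, hence the nonemptiness
   clause (which forces X to lie in dom h). *)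
Definition bounded_gradients (X : set 'rV[R]_n) (f : 'rV[R]_n -> R)
    (h : 'rV[R]_n -> \bar R) (G : R) : Prop :=
  (0 < G)%R /\ forall x, X x ->
    [/\ (enorm (grad f x) <= G)%R, subdiff h x !=set0 &
        forall zeta, subdiff h x zeta -> (enorm zeta <= G)%R].

Definition smooth_on (X : set 'rV[R]_n) (f : 'rV[R]_n -> R) (L : R) : Prop :=
  (0 <= L)%R /\ forall x y, X x -> X y ->
    (enorm (grad f x - grad f y) <= L * enorm (x - y))%R.

(* fs x z is f(x; z).  The sample space Xi and the law mu are arbitrary, so
   that z may be a whole mini-batch and fs _ z its average. *)
Record stochastic_oracle d (Xi : measurableType d) (mu : probability Xi R)
    (X : set 'rV[R]_n) (fs : 'rV[R]_n -> Xi -> R) (f : 'rV[R]_n -> R)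
    (sigma : R) : Prop := {
  fs_differentiable : forall z x, differentiable (fs ^~ z) x;
  fs_integrable : forall x, mu.-integrable setT (EFin \o fs x);
  fs_mean : forall x, (f x)%:E = 'E_mu[fs x];
  oracle_integrable : forall x i, X x ->
    mu.-integrable setT (fun z => (grad (fs ^~ z) x 0 i)%:E);
  oracle_unbiased : forall x i, X x ->
    'E_mu[fun z => grad (fs ^~ z) x 0%R i] = (grad f x 0%R i)%:E;
  sigma_ge0 : (0 <= sigma)%R;
  oracle_variance : forall x, X x ->
    'E_mu[fun z => (enorm (grad (fs ^~ z) x - grad f x) ^+ 2)%R]
      <= (sigma ^+ 2)%:E
}.

End Problem.

Section Algorithm.
Context {R : realType} {n : nat}.

(* One trajectory of ALFCG-MVR1, s t being the stochastic gradient sampled at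
   step t.  The step size is computed in \bar R because h is extended-valued;
   for v t = x t its value is irrelevant and x t.+1 = x t. *)
Record alfcg_mvr1 (X : set 'rV[R]_n) (h : 'rV[R]_n -> \bar R) (rho beta : R)
    (x0 : 'rV[R]_n) (s x g v : nat -> 'rV[R]_n) (alpha Lt : nat -> R) :
    Prop := {
  x_init : x 0%N = x0;
  alpha_def : forall t, alpha t =
    (Num.sqrt (1 + \sum_(i < t)
       (beta + Lt i ^+ 2 * enorm (x i.+1 - x i) ^+ 2)))^-1;
  Lt_def : forall t, Lt t =
    rho * Num.sqrt (1 + \sum_(i < t) Lt i ^+ 2 * enorm (x i.+1 - x i) ^+ 2)
      * (Num.sqrt (alpha t))^-1;
  g_def : forall t, g t =
    (1 - alpha t) *: (if t is t'.+1 then g t' else 0) + alpha t *: s t;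
  v_def : forall t,
    argmin_on X (fun u => (dotp u (g t))%:E + h u)%E (v t);
  x_step : forall t, x t.+1 = x t +
    fine (mine ((h (x t) - h (v t) - (dotp (g t) (v t - x t))%:E)
                 * ((Lt t * enorm (v t - x t) ^+ 2)^-1)%:E) 1)%E
    *: (v t - x t)
}.

End Algorithm.

Section Randomness.
Context {R : realType} {n : nat} {d d' : measure_display}
  {Omega : measurableType d} {Xi : measurableType d'}.

(* The information available before the sample of step t is drawn: all earlier
   samples, together with all earlier v i, since the choice of a minimizer may
   involve extra randomness. The other iterates are determined by these. *)
Definition past (xi : nat -> Omega -> Xi) (v : nat -> Omega -> 'rV[R]_n)
    (t : nat) : set (set Omega) :=
  <<s \bigcup_(i in `I_t)
        (preimage_set_system setT (xi i) measurable `|`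
         \bigcup_(j in [set: 'I_n])
           preimage_set_system setT (fun w => v i w 0 j) measurable) >>.

Record fresh_samples (P : probability Omega R) (mu : probability Xi R)
    (xi : nat -> Omega -> Xi) (v : nat -> Omega -> 'rV[R]_n) : Prop := {
  xi_measurable : forall t, measurable_fun setT (xi t);
  v_measurable : forall t j, measurable_fun setT (fun w => v t w 0 j);
  xi_law : forall t B, measurable B -> P (xi t @^-1` B) = mu B;
  xi_independent : forall t A B, past xi v t A -> measurable B ->
    P (A `&` xi t @^-1` B) = (P A * P (xi t @^-1` B))%E
}.

End Randomness.

Section Constants.
Context {R : realType}.

Definition Fbar (Fstar G D : R) : R := Fstar + 2 * G * D.
Definition sbar (sigma G : R) : R := 3 * (sigma + G).
Definition deltabar (L D G sigma rho : R) : R :=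
  4 * L * D + 26 * G + 8 * sigma + 3 * rho * D.
Definition kappa (L D G sigma rho : R) : R := 1 + deltabar L D G sigma rho.

Definition bounded_by (K a : R) : Prop := `|a| <= K.

(* The quantities that the soft-O hides.  sigma is only bounded from above
   (through sbar), so that rates stay uniform as sigma tends to 0, whereas rho
   and nu are positive constants, also bounded away from 0: the rates are not
   uniform as rho or nu tends to 0. *)
Record order_one (K L D G rho Fstar sigma nu : R) : Prop := {
  L_O1 : bounded_by K L;
  D_O1 : bounded_by K D;
  G_O1 : bounded_by K G;
  rho_O1 : bounded_by K rho;
  rho_inv_O1 : bounded_by K rho^-1;
  Fbar_O1 : bounded_by K (Fbar Fstar G D);
  sbar_O1 : bounded_by K (sbar sigma G);
  deltabar_O1 : bounded_by K (deltabar L D G sigma rho);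
  kappa_O1 : bounded_by K (kappa L D G sigma rho);
  nu_O1 : bounded_by K nu;
  nu_inv_O1 : bounded_by K nu^-1
}.

End Constants.

(* Main.v *)
(** The gap at step [t] is at most the inner gap of the linearised problem plus
    [D |e_t|], where [e_t = g_t - grad f (x_t)].  With
    [q_t = L_t^2 |x_(t+1) - x_t|^2] and [S_t = 1 + sum_(i < t) q_i], the step-size rule
    and the descent inequality bound the sum of the inner gaps by [sqrt (T S_T)] and
    sums of [|e_t|], and bound [S_T] itself in terms of the [e_t].

    The noise is only square integrable, so [q_t] may exceed [S_t] by an arbitrary factor.
    Call [t] a jump when [q_t > 3 S_t].  Jumps multiply [S] by 4, so there are at most
    logarithmically many before [S] passes a polynomial threshold [Theta].  The potential
    [V_t |e_t|^2], with [V_t = 2 - ln S_t / ln Theta] until the threshold is passed and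
    [V_t = 0] afterwards, decreases in conditional expectation up to
    [alpha_t^2 sigma^2] and the relative increments [q_t / S_(t+1)], whose sum is at most
    [ln S_T].  At a jump the drop of [V] pays for the change of gradient.  This makes
    [sum_t (alpha_(t+1) + [t jump] / ln Theta) |e_t|^2] polylogarithmic in expectation.
    Beyond the threshold the gap is bounded by [2 G D] and Markov's inequality suffices. *)
Require Import Defs.
From mathcomp Require Import measurable_realfun ring lra.

Set Implicit Arguments.
Unset Strict Implicit.
Unset Printing Implicit Defensive.

Local Open Scope classical_set_scope.
Local Open Scope ring_scope.

(** * Euclidean geometry and the composite problem *)

Section EuclideanTheory.
Context {R : realType} {n : nat}.
Implicit Types x y z : 'rV[R]_n.

(** The order of dependence shapes the estimates. [S_(t+1)] and [alpha_(t+1)] are fixed before the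
    sample of step [t+1] is drawn, so in the recursion for [e_(t+1)] the weight [V_(t+1)] factors
    out of the conditional expectation and the cross term with the noise vanishes. But [q_t] already
    contains the noise of step [t]. Without a jump [S] grows at most fourfold, so
    [|x_(t+1) - x_t|^2 / alpha_(t+1)] is of the order of [q_t / S_(t+1)]; at a jump only the
    diameter bounds the movement.

    The bound on [S_T] is self-referential, because [alpha_T] contains [S_T]. Only [S_T^(1/4)]
    enters the estimate of [S_T^(1/2)], so Young's inequality absorbs it. Its parameters are tuned
    to make the bound on the gap sum affine in the damped error sum, so that a first moment of that
    sum is enough. The term [(beta T)^(1/4)] left by [alpha_T] is the source of
    [sigma^(1/2) T^(-1/4)]. The threshold [Theta] is of order [T^4] because the a priori bound on
    the mean of [S_T] is of order [T^2] and the gap sum contributes one more factor [T]. *)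

Lemma dotpC x y : dotp x y = dotp y x.
Proof. by apply: eq_bigr => i _; rewrite mulrC. Qed.

Lemma dotpDl x y z : dotp (x + y) z = dotp x z + dotp y z.
Proof. by rewrite /dotp -big_split; apply: eq_bigr => i _; rewrite !mxE mulrDl. Qed.

Lemma dotpZl a x y : dotp (a *: x) y = a * dotp x y.
Proof. by rewrite /dotp mulr_sumr; apply: eq_bigr => i _; rewrite !mxE mulrA. Qed.

Lemma dotpNl x y : dotp (- x) y = - dotp x y.
Proof. by rewrite -scaleN1r dotpZl mulN1r. Qed.

Lemma dotpBl x y z : dotp (x - y) z = dotp x z - dotp y z.
Proof. by rewrite dotpDl dotpNl. Qed.

Lemma dotpDr x y z : dotp z (x + y) = dotp z x + dotp z y.
Proof. by rewrite dotpC dotpDl !(dotpC z). Qed.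

Lemma dotpZr a x y : dotp x (a *: y) = a * dotp x y.
Proof. by rewrite dotpC dotpZl dotpC. Qed.

Lemma dotpNr x y : dotp x (- y) = - dotp x y.
Proof. by rewrite dotpC dotpNl dotpC. Qed.

Lemma dotpBr x y z : dotp z (x - y) = dotp z x - dotp z y.
Proof. by rewrite dotpDr dotpNr. Qed.

Lemma dotp_ge0 x : 0 <= dotp x x.
Proof. by apply: sumr_ge0 => i _; rewrite -expr2 sqr_ge0. Qed.

Lemma enorm_ge0 x : 0 <= enorm x. Proof. exact: sqrtr_ge0. Qed.

Lemma enorm_sqr x : enorm x ^+ 2 = dotp x x.
Proof. by rewrite sqr_sqrtr// dotp_ge0. Qed.

Lemma enorm0 : enorm (0 : 'rV[R]_n) = 0.
Proof.
by apply/eqP; rewrite sqrtr_eq0 /dotp big1// => i _; rewrite mxE mul0r.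
Qed.

Lemma enormZ a x : enorm (a *: x) = `|a| * enorm x.
Proof. by rewrite /enorm dotpZl dotpZr mulrA -expr2 sqrtrM ?sqr_ge0// sqrtr_sqr. Qed.

Lemma enormN x : enorm (- x) = enorm x.
Proof. by rewrite -scaleN1r enormZ normrN1 mul1r. Qed.

Lemma enormC x y : enorm (x - y) = enorm (y - x).
Proof. by rewrite -enormN opprB. Qed.

Lemma cauchy_schwarz x y : dotp x y <= enorm x * enorm y.
Proof.
have [x0|x0] := eqVneq (enorm x) 0.
  suff -> : dotp x y = 0 by rewrite x0 mul0r.
  have : enorm x ^+ 2 = 0 by rewrite x0 expr0n.
  rewrite enorm_sqr /dotp => /eqP; rewrite psumr_eq0; last by move=> i _; rewrite -expr2 sqr_ge0.
  move=> /allP h; apply: big1 => i _; have := h i (mem_index_enum _).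
  by rewrite /= mulf_eq0 orbb => /eqP ->; rewrite mul0r.
have [y0|y0] := eqVneq (enorm y) 0.
  suff -> : dotp x y = 0 by rewrite y0 mulr0.
  have : enorm y ^+ 2 = 0 by rewrite y0 expr0n.
  rewrite enorm_sqr /dotp => /eqP; rewrite psumr_eq0; last by move=> i _; rewrite -expr2 sqr_ge0.
  move=> /allP h; apply: big1 => i _; have := h i (mem_index_enum _).
  by rewrite /= mulf_eq0 orbb => /eqP ->; rewrite mulr0.
have xp : 0 < enorm x by rewrite lt_neqAle eq_sym x0 enorm_ge0.
have yp : 0 < enorm y by rewrite lt_neqAle eq_sym y0 enorm_ge0.
have := dotp_ge0 (enorm y *: x - enorm x *: y).
rewrite !(dotpBl, dotpBr) !dotpZl !dotpZr (dotpC y x) -!enorm_sqr.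
set a := enorm x; set b := enorm y; set p := dotp x y => h.
have : 0 <= 2 * (a * b) * (a * b - p) by apply: le_trans h _; rewrite le_eqVlt; apply/orP; left; apply/eqP; ring.
by rewrite pmulr_rge0 ?subr_ge0// !mulr_gt0.
Qed.

Lemma enormD x y : enorm (x + y) <= enorm x + enorm y.
Proof.
rewrite -(@ler_pXn2r _ 2)// ?nnegrE ?addr_ge0 ?enorm_ge0//.
rewrite sqrrD !enorm_sqr dotpDl !dotpDr (dotpC y x) -!enorm_sqr.
have := cauchy_schwarz x y; lra.
Qed.

Lemma enormB x y : enorm (x - y) <= enorm x + enorm y.
Proof. by rewrite -(enormN y) enormD. Qed.

Lemma enorm_sqrD x y : enorm (x + y) ^+ 2 = enorm x ^+ 2 + 2 * dotp x y + enorm y ^+ 2.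
Proof. by rewrite !enorm_sqr dotpDl !dotpDr (dotpC y x); ring. Qed.

(** Compactness gives a bound in the sup norm of the library. This converts it, so that the supremum
    defining [diam] is taken over a bounded set. *)
Lemma enorm_le_sup x (M : R) : `|x| <= M -> enorm x <= Num.sqrt (n%:R * M ^+ 2).
Proof.
move=> xM; apply: ler_wsqrtr; rewrite /dotp.
have -> : n%:R * M ^+ 2 = \sum_(i < n) M ^+ 2.
  by rewrite sumr_const card_ord mulr_natl.
apply: ler_sum => i _; rewrite -expr2 -real_normK ?num_real// lerXn2r ?nnegrE//.
  exact: le_trans xM.
apply: le_trans xM; rewrite [leRHS]mx_normrE.
by apply: (le_bigmax _ (fun ij => `|x ij.1 ij.2|) (0, i)).
Qed.

Lemma continuous_coord i : continuous (fun x => x 0 i).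
Proof. exact: coord_continuous. Qed.

Lemma continuous_enorm : continuous (@enorm R n).
Proof.
move=> x; apply: (@continuous_comp _ _ _ (fun x => dotp x x) Num.sqrt); last exact: sqrt_continuous.
pose F s (y : 'rV[R]_n) : R := \sum_(i <- s) y 0 i * y 0 i.
suff : continuous (F (index_enum 'I_n)) by exact.
elim: (index_enum _) => [|i s ih].
  rewrite (_ : F [::] = cst 0); first exact: cst_continuous.
  by apply/funext => y; rewrite /F big_nil.
rewrite (_ : F _ = fun y : 'rV[R]_n => y 0 i * y 0 i + F s y); last first.
  by apply/funext => y; rewrite /F big_cons.
by move=> y; exact: (cvgD (cvgM (@continuous_coord i y) (@continuous_coord i y)) (ih y)).
Qed.

Lemma grad_dotp (f : 'rV[R]_n -> R) x y :
  differentiable f x -> 'D_y f x = dotp (grad f x) y.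
Proof.
move=> df; rewrite deriveE// [in LHS](row_sum_delta y) linear_sum.
apply: eq_bigr => i _; rewrite linearZ/= mxE deriveE// [RHS]mulrC; congr (_ * _).
Qed.

Lemma mean_value_grad (f : 'rV[R]_n -> R) x y :
  (forall z, differentiable f z) ->
  exists2 c, 0 <= c <= 1 & f y - f x = dotp (grad f (x + c *: (y - x))) (y - x).
Proof.
move=> df; pose g (t : R) := f (x + t *: (y - x)).
have dg (t : R) : is_derive t 1 g (dotp (grad f (x + t *: (y - x))) (y - x)).
  have h1 : is_diff t (cst x + ( *:%R ^~ (y - x)) : R -> 'rV[R]_n) (0 + ( *:%R ^~ (y - x))).
    by apply: is_diffD.
  have h2 := differentiableP (df (x + t *: (y - x))).
  have h : is_diff t g ('d f (x + t *: (y - x)) \o (0 + ( *:%R ^~ (y - x)))).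
    exact: (is_diff_comp h1 h2).
  have dgt : differentiable g t by case: h.
  apply: DeriveDef; first exact: diff_derivable.
  by rewrite deriveE// (@diff_val _ _ _ _ _ _ _ h)/= fctE/= add0r scale1r -grad_dotp// deriveE.
have cg : {within `[0, 1], continuous g}.
  apply: continuous_subspaceT => t.
  apply/differentiable_continuous/derivable1_diffP.
  by case: (dg t).
have [c] := @MVT_segment R g _ 0 1 ler01 (fun t _ => dg t) cg.
rewrite in_itv/= subr0 mulr1 => c01 h; exists c => //.
by move: h; rewrite /g scale0r addr0 scale1r [x + (y - x)]addrC subrK.
Qed.

End EuclideanTheory.

Section ProblemFacts.
Context {R : realType} {n : nat}.
Variables (X : set 'rV[R]_n) (f : 'rV[R]_n -> R) (h : 'rV[R]_n -> \bar R)
  (xstar : 'rV[R]_n) (G L : R).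
Hypotheses (pb : composite_problem X f h xstar) (bg : bounded_gradients X f h G)
  (sm : smooth_on X f L).
Local Notation D := (diam X).
Local Notation hr := (fun u => fine (h u)).
Implicit Types x y u v : 'rV[R]_n.

Lemma enorm_diam x y : X x -> X y -> enorm (x - y) <= D.
Proof.
move=> Xx Xy; apply: ub_le_sup; last by exists (x, y).
have [M [_ HM]] := compact_bounded (feasible_compact pb).
have {}HM z : X z -> `|z| <= M + 1 by apply: HM; rewrite ltrDl.
exists (Num.sqrt (n%:R * (M + 1) ^+ 2) + Num.sqrt (n%:R * (M + 1) ^+ 2)).
move=> _ [[a b] [/= Xa Xb] <-] /=. apply: (le_trans (enormB a b)).
by apply: lerD; apply: enorm_le_sup; exact: HM.
Qed.

Lemma diam_ge0 x : X x -> 0 <= D.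
Proof. by move=> Xx; have := enorm_diam Xx Xx; have := enorm_ge0 (x - x); apply: le_trans. Qed.

Lemma feasible_segment x y (a : R) : X x -> X y -> 0 <= a <= 1 -> X (x + a *: (y - x)).
Proof.
move=> Xx Xy /andP[a0 a1].
have := @feasible_convex _ _ _ _ _ _ pb y x (Itv01 a0 a1) (mem_set Xy) (mem_set Xx).
rewrite inE; set p := conv _ _ _; suff -> : p = x + a *: (y - x) by [].
rewrite /p /conv/= /unstable.onem scalerBr scalerBl scale1r; by rewrite addrCA addrA.
Qed.

(** A subgradient at [x], tested at a point [y] of the domain, gives
    [h x + <z, y - x> <= h y < +oo]. *)
Lemma h_fineK x : X x -> (hr x)%:E = h x.
Proof.
move=> Xx; have [hp [y hy]] := h_proper pb; have [_ /(_ x Xx) [_ [z hz] _]] := bg.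
rewrite fineK// fin_numElt hp/=; have := hz y.
move/le_lt_trans => /(_ _ hy).
by case: (h x) => [r||]//=; rewrite ?addye ?ltry.
Qed.

Lemma h_lipschitz x y : X x -> X y -> hr x - hr y <= G * enorm (x - y).
Proof.
move=> Xx Xy; have [_ /(_ x Xx) [_ [z hz] /(_ z hz) zG]] := bg.
have := hz y; rewrite -(h_fineK Xx) -(h_fineK Xy) -EFinD lee_fin => hxy.
have := cauchy_schwarz z (x - y).
have : enorm z * enorm (x - y) <= G * enorm (x - y) by rewrite ler_wpM2r ?enorm_ge0.
move: hxy; rewrite -(opprB x y) dotpNr; lra.
Qed.

Lemma G_ge0 : 0 <= G. Proof. by have [/ltW] := bg. Qed.

Lemma L_ge0 : 0 <= L. Proof. by have [] := sm. Qed.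

Lemma grad_bound x : X x -> enorm (grad f x) <= G.
Proof. by have [_ H] := bg => /H[]. Qed.

Lemma f_lipschitz x y : X x -> X y -> f x - f y <= G * enorm (x - y).
Proof.
move=> Xx Xy; have [c c01 ->] := mean_value_grad y x (f_differentiable pb).
apply: le_trans (cauchy_schwarz _ _) _; rewrite ler_wpM2r ?enorm_ge0//.
by apply: grad_bound; exact: feasible_segment.
Qed.

(** The mean value theorem at a single point of the segment replaces the integral of the gradient;
    the constant is therefore [L] instead of [L / 2], which does not affect the rates. *)
Lemma descent_step x y : X x -> X y ->
  f y - f x <= dotp (grad f x) (y - x) + L * enorm (y - x) ^+ 2.
Proof.
move=> Xx Xy; have [c c01 ->] := mean_value_grad x y (f_differentiable pb).
set z := x + _; have Xz : X z by exact: feasible_segment.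
rewrite -lerBlDl -dotpBl; apply: le_trans (cauchy_schwarz _ _) _.
rewrite expr2 mulrA ler_wpM2r ?enorm_ge0//.
have [_ H] := sm; apply: le_trans (H _ _ Xz Xx) _.
rewrite ler_wpM2l ?L_ge0// /z addrC addKr enormZ.
by case/andP: c01 => c0 c1; rewrite ger0_norm// ler_piMl// enorm_ge0.
Qed.

Lemma objective_lipschitz x y : X x -> X y ->
  (f x + hr x) - (f y + hr y) <= 2 * G * D.
Proof.
move=> Xx Xy; have := f_lipschitz Xx Xy; have := h_lipschitz Xx Xy.
have : G * enorm (x - y) <= G * D by rewrite ler_wpM2l ?G_ge0 ?enorm_diam.
lra.
Qed.

Lemma FW_gap_le x (B : R) : X x ->
  (forall v, X v -> dotp (grad f x) (x - v) + hr x - hr v <= B) ->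
  (FW_gap X f h x <= B%:E)%E.
Proof.
move=> Xx H; apply: ge_ereal_sup => _ [v Xv <-].
by rewrite -(h_fineK Xx) -(h_fineK Xv) -EFinD lee_fin; exact: H.
Qed.

Lemma FW_gap_ge0 x : X x -> (0 <= FW_gap X f h x)%E.
Proof.
move=> Xx; apply: ereal_sup_ubound; exists x => //.
rewrite subrr -{1}(scale0r (0 : 'rV[R]_n)) dotpZr mul0r add0e subee//.
by rewrite -h_fineK.
Qed.

Lemma FW_gap_diam x : X x -> (FW_gap X f h x <= (2 * G * D)%:E)%E.
Proof.
move=> Xx; apply: FW_gap_le => // v Xv.
have := h_lipschitz Xx Xv; have := cauchy_schwarz (grad f x) (x - v).
have : enorm (grad f x) * enorm (x - v) <= G * D.
  by rewrite ler_pM ?enorm_ge0 ?grad_bound ?enorm_diam.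
have : G * enorm (x - v) <= G * D by rewrite ler_wpM2l ?G_ge0 ?enorm_diam.
lra.
Qed.

(* McShane's inf-convolution extension: measurability of the step size only involves
   [h] on [X], where it may be replaced by a continuous function. *)
Lemma h_extension x0 : X x0 -> exists H : 'rV[R]_n -> R,
  continuous H /\ forall x, X x -> H x = hr x.
Proof.
move=> Xx0; pose S x := [set hr u + G * enorm (x - u) | u in X].
have S0 x : S x !=set0 by exists (hr x0 + G * enorm (x - x0)); exists x0.
have Slb x : has_lbound (S x).
  exists (hr x0 - G * enorm (x0 - x)) => _ [u Xu <-].
  have := h_lipschitz Xx0 Xu.
  have := enormD (x0 - x) (x - u); rewrite addrA subrK => h1.
  have : G * enorm (x0 - u) <= G * (enorm (x0 - x) + enorm (x - u)).
    by rewrite ler_wpM2l ?G_ge0.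
  rewrite mulrDr; lra.
have HL x y : inf (S x) <= inf (S y) + G * enorm (x - y).
  rewrite -lerBlDr; apply: lb_le_inf => // _ [u Xu <-]; rewrite lerBlDr.
  apply: le_trans (_ : hr u + G * enorm (x - u) <= _).
    by apply: ge_inf => //; exists u.
  have := enormD (x - y) (y - u); rewrite addrA subrK => h1.
  have : G * enorm (x - u) <= G * (enorm (x - y) + enorm (y - u)).
    by rewrite ler_wpM2l ?G_ge0.
  rewrite mulrDr; lra.
exists (fun x => inf (S x)); split => [x|x Xx].
  apply: (@cvgrPdist_le _ _ _ _ (nbhs_filter x) _ _).2 => e e0.
  have cG : {for x, continuous (fun y => G * enorm (x - y))}.
    have c1 : {for x, continuous (fun y : 'rV[R]_n => x - y)}.
      exact: (cvgB (cvg_cst _) (@cvg_id _ _)).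
    have c2 : {for x, continuous (fun y : 'rV[R]_n => enorm (x - y))}.
      exact: (@continuous_comp _ _ _ _ (@enorm R n) x c1 (@continuous_enorm _ _ _)).
    exact: (@cvgM _ _ _ (nbhs_filter x) _ _ _ _ (cvg_cst _) c2).
  have : \forall y \near x, G * enorm (x - y) <= e.
    by apply: (cvgr_le _ cG); rewrite subrr enorm0 mulr0.
  apply: filterS => y h1; rewrite ler_norml.
  have := HL x y; have := HL y x; rewrite (enormC y x) => h2 h3.
  apply/andP; split; lra.
apply/eqP; rewrite eq_le; apply/andP; split.
  by apply: ge_inf => //; exists x => //; rewrite subrr enorm0 mulr0 addr0.
apply: lb_le_inf => // _ [u Xu <-].
have := h_lipschitz Xx Xu; lra.
Qed.

End ProblemFacts.

(** * Measurability and freezing *)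

Import HBNNSimple.
Section LowerIntegral.
Context d (T : measurableType d) (R : realType) (mu : {measure set T -> \bar R}).
Local Open Scope ereal_scope.

(** Monotonicity without measurability: the integral of a nonnegative function is a supremum over
    the simple functions below it. It allows the gaps, whose measurability is not established, to be
    compared with measurable majorants. *)
Lemma le_lower_integral (f g : T -> \bar R) :
  (forall x, 0 <= f x) -> (forall x, f x <= g x) ->
  \int[mu]_x f x <= \int[mu]_x g x.
Proof.
move=> f0 fg; rewrite !ge0_integralTE//; last by move=> x; exact: le_trans (fg x).
apply: ereal_sup_le => _ [k /= kf <-]; exists k => //= x.
exact: le_trans (kf x) (fg x).
Qed.

End LowerIntegral.

Section Coordinates.
Context {R : realType} {n : nat}.
Implicit Types x y : 'rV[R]_n.

Definition round_grid (k : nat) (m : 'rV[int]_n) : 'rV[R]_n :=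
  \row_i ((m 0 i)%:~R / k.+1%:R).

Definition floor_grid (k : nat) x : 'rV[int]_n :=
  \row_i Num.floor (k.+1%:R * x 0 i).

Lemma round_floor_grid_cvg x : (fun k => round_grid k (floor_grid k x)) @ \oo --> x.
Proof.
apply/cvgrPdist_le => e e0; near=> k.
have k0 : 0 < k.+1%:R :> R by [].
rewrite [leLHS]mx_normrE; apply: bigmax_le; first exact: ltW.
move=> [i j] _ /=; rewrite ord1 !mxE.
have /andP[h1 h2] := @Num.Theory.floor_itv R (k.+1%:R * x 0 j).
have -> : x 0 j - (Num.floor (k.+1%:R * x 0 j))%:~R / k.+1%:R =
  (k.+1%:R * x 0 j - (Num.floor (k.+1%:R * x 0 j))%:~R) / k.+1%:R.
  by rewrite mulrBl [_ * x 0 j]mulrC mulfK.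
rewrite normrM ger0_norm; last by rewrite subr_ge0.
rewrite gtr0_norm ?invr_gt0//.
have he : k.+1%:R^-1 <= e.
  near: k; apply: filterS (near_infty_natSinv_lt (PosNum e0)) => k; exact: ltW.
apply: le_trans he; rewrite ler_piMl ?invr_ge0//.
rewrite lerBlDl; apply: ltW; move: h2; rewrite intrD; lra.
Unshelve. all: by end_near. Qed.

End Coordinates.

(** * Measurability of functions of a random point and a random sample *)

Section Caratheodory.
Context {R : realType} {n : nat} {d d' : measure_display}
  {T : measurableType d} {Z : measurableType d'}.
Variables (x : T -> 'rV[R]_n) (z : T -> Z).
Hypotheses (mx : forall i, measurable_fun setT (fun w => x w 0 i))
  (mz : measurable_fun setT z).

(* Round [x w] to a grid of mesh [1/(k+1)]: the composite is then a countable gluing of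
   the measurable functions [w |-> u y (z w)], and continuity lets [k] go to infinity. *)
Lemma measurable_caratheodory (u : 'rV[R]_n -> Z -> R) :
  (forall t, continuous (u ^~ t)) -> (forall y, measurable_fun setT (u y)) ->
  measurable_fun setT (fun w => u (x w) (z w)).
Proof.
move=> cu mu.
apply: (@measurable_realfun.measurable_fun_cvg _ _ _ setT
  (fun k w => u (round_grid k (floor_grid k (x w))) (z w))); last first.
  by move=> w _; exact: (cvg_comp _ _ (@round_floor_grid_cvg R n (x w)) (cu (z w) (x w))).
move=> k _ Y mY; rewrite setTI.
have -> : (fun w => u (round_grid k (floor_grid k (x w))) (z w)) @^-1` Y =
  \bigcup_(m : 'rV[int]_n) ((fun w => floor_grid k (x w)) @^-1` [set m] `&`
     (fun w => u (round_grid k m) (z w)) @^-1` Y).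
  apply/seteqP; split => [w /= Yw|w [m _ [/= <-]]//].
  by exists (floor_grid k (x w)).
apply: countable_bigcupT_measurable; first exact: countableP.
move=> m; apply: measurableI; last first.
  by rewrite -[X in measurable X]setTI; apply: measurableT_comp.
have -> : (fun w => floor_grid k (x w)) @^-1` [set m] =
  \bigcap_(i in [set` enum 'I_n]) ((fun w => k.+1%:R * x w 0 i) @^-1` `[(m 0 i)%:~R, (m 0 i + 1)%:~R[).
  apply/seteqP; split => [w /= <- i _ /=|w /= H].
    rewrite in_itv/= mxE; exact: Num.Theory.floor_itv.
  apply/rowP => i; rewrite mxE; apply: Num.Theory.floor_def.
  by have := H i; rewrite /= mem_enum in_itv/=; exact.
apply: fin_bigcap_measurable => // i _.
rewrite -[X in measurable X]setTI.
have mf : measurable_fun setT (fun w => k.+1%:R * x w 0 i).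
  by apply: measurable_funM => //; exact: measurable_cst.
by apply: mf => //; exact: measurable_itv.
Qed.

(** A partial derivative is the limit of difference quotients with increments [1/(k+1)], and each
    quotient is continuous in the point and measurable in the sample. *)
Lemma measurable_grad (u : 'rV[R]_n -> Z -> R) i :
  (forall t y, differentiable (u ^~ t) y) -> (forall y, measurable_fun setT (u y)) ->
  measurable_fun setT (fun w => grad (u ^~ (z w)) (x w) 0 i).
Proof.
move=> du mu.
pose D y t (k : nat) : R := k.+1%:R * (u (k.+1%:R^-1 *: delta_mx 0 i + y) t - u y t).
apply: (@measurable_realfun.measurable_fun_cvg _ _ _ setT
  (fun k w => D (x w) (z w) k)) => [k|w _].
  have cu t : continuous (u ^~ t).
    by move=> y; apply: differentiable_continuous; exact: du.
  apply: (@measurable_caratheodory (fun y t => D y t k)) => [t y|y].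
    have h1 : {for y, continuous (fun y : 'rV[R]_n => u (k.+1%:R^-1 *: delta_mx 0 i + y) t)}.
      apply: (@continuous_comp _ _ _ (fun y : 'rV[R]_n => k.+1%:R^-1 *: delta_mx 0 i + y) (u ^~ t)); last exact: cu.
      exact: (cvgD (cvg_cst _) (@cvg_id _ _)).
    exact: (cvgM (cvg_cst _) (cvgB h1 (cu t y))).
  by apply: measurable_funM; [exact: measurable_cst|apply: measurable_funB].
rewrite mxE.
have /cvgr_dnbhsP := @diff_derivable _ _ _ _ _ (delta_mx 0 i) (du (z w) (x w)).
move=> /(_ (fun k => k.+1%:R^-1)) H.
have {}H := H (conj (fun k => invr_neq0 (lt0r_neq0 (ltr0Sn R k))) (@cvg_harmonic R)).
rewrite (_ : D _ _ = (fun k => k.+1%:R^-1^-1 *: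
  ((u^~ (z w) \o shift (x w)) (k.+1%:R^-1 *: 'e_i) - u (x w) (z w)))) //.
by apply/funext => k; rewrite invrK.
Qed.

End Caratheodory.

(** * Integrating out a sample that is independent of the past *)

Section Freezing.
Context {R : realType} {d d' : measure_display}
  {Omega : measurableType d} {Xi : measurableType d'}.
Variables (P : probability Omega R) (mu : probability Xi R)
  (G : set (set Omega)) (z : Omega -> Xi).
Hypotheses (Gm : <<s G >> `<=` measurable) (mz : measurable_fun setT z)
  (zlaw : forall B, measurable B -> P (z @^-1` B) = mu B)
  (zind : forall A B, <<s G >> A -> measurable B ->
     P (A `&` z @^-1` B) = (P A * P (z @^-1` B))%E).
Local Open Scope ereal_scope.

(** The identity, read as a map onto the same set with the coarser sigma-algebra generated by [G].
    Its law is [P] restricted to that sigma-algebra. *)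
Let past_id (w : Omega) : g_sigma_algebraType G := w.

Let mpast_id : measurable_fun setT past_id.
Proof. by move=> _ A mA; rewrite setTI; exact: Gm. Qed.

Lemma measurable_coarser d3 (Y : measurableType d3) (f : Omega -> Y) :
  measurable_fun (T := g_sigma_algebraType G) setT f -> measurable_fun setT f.
Proof. by move=> mf; exact: (measurableT_comp mf mpast_id). Qed.

Let pastP := distribution P (mfun_Sub (mem_set mpast_id)).

Let pair_z (w : Omega) : g_sigma_algebraType G * Xi := (past_id w, z w).

Let mpair_z : measurable_fun setT pair_z.
Proof. exact/measurable_fun_pair. Qed.

(** Independence says that the joint law of the past and [z] agrees with the product measure on
    rectangles, hence everywhere by uniqueness of product measures; Tonelli's theorem then
    integrates [z] first. *)
Lemma freezing (psi : g_sigma_algebraType G * Xi -> \bar R) :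
  measurable_fun setT psi -> (forall p, 0 <= psi p) ->
  \int[P]_w psi (w, z w) = \int[P]_w \int[mu]_y psi (w, y).
Proof.
move=> mpsi psi0.
have -> : \int[P]_w psi (w, z w) = \int[pushforward P pair_z]_p psi p.
  by rewrite (ge0_integral_pushforward mpair_z).
have -> : \int[pushforward P pair_z]_p psi p = \int[(pastP \x mu)%E]_p psi p.
  apply: eq_measure_integral => A mA _; symmetry.
  apply: product_measure_unique => // C B mC mB.
  transitivity (P (C `&` z @^-1` B)); first by [].
  by rewrite zind// zlaw.
rewrite fubini_tonelli1//.
rewrite (ge0_integral_pushforward mpast_id) ?preimage_setT//.
  exact: measurable_fun_fubini_tonelli_F.
by move=> w _; apply: integral_ge0.
Qed.

End Freezing.

(** * Pathwise inequalities *)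

Section RealInequalities.
Context {R : realType}.
Implicit Types x y : R.

(** This is [ln (1 + u) <= u] at [1 + u = x / y]. It turns sums of relative increments into
    telescoping logarithms, both for [S] and for the noise. *)
Lemma ln_sub_ge x y : 0 < x -> 0 < y -> (y - x) / y <= ln y - ln x.
Proof.
move=> x0 y0; rewrite -lerN2 opprB -ln_div ?posrE//.
have -> : x / y = 1 + - ((y - x) / y) by rewrite mulrBl mulfV ?gt_eqF//; ring.
have [h|h] := ltP (-1) (- ((y - x) / y)); first exact: le_ln1Dx.
have : 0 < x / y by rewrite divr_gt0.
have : x / y = 1 + - ((y - x) / y) by rewrite mulrBl mulfV ?gt_eqF//; ring.
by lra.
Qed.

Lemma young (lam x y : R) : 0 < lam -> x * y <= 2^-1 * (lam * x ^+ 2 + lam^-1 * y ^+ 2).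
Proof.
move=> l0; have l1 : lam * lam^-1 = 1 by rewrite mulfV ?gt_eqF.
have : 0 <= lam^-1 * (lam * x - y) ^+ 2 by rewrite mulr_ge0 ?sqr_ge0// invr_ge0 ltW.
have -> : lam^-1 * (lam * x - y) ^+ 2 = (lam * lam^-1) * lam * x ^+ 2 - 2 * (lam * lam^-1) * (x * y) + lam^-1 * y ^+ 2.
  by ring.
by rewrite l1; lra.
Qed.

Lemma sum_affine (T : nat) (A B C : R) (z p j F : nat -> R) :
  \sum_(t < T) (A * z t + B * p t + C * j t + (F t - F t.+1)) =
  A * (\sum_(t < T) z t) + B * (\sum_(t < T) p t) + C * (\sum_(t < T) j t) + (F 0%N - F T).
Proof.
elim: T => [|T ih]; first by rewrite !big_ord0; ring.
by rewrite !big_ord_recr /= ih; ring.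
Qed.

Lemma ler_sqrX2 x y : 0 <= y -> x ^+ 2 <= y ^+ 2 -> x <= y.
Proof.
move=> y0 h; have [x0|/ltW x0] := leP 0 x; last exact: le_trans y0.
by rewrite -(@ler_pXn2r _ 2) ?nnegrE.
Qed.

(** The arithmetic that closes the gap estimate, stated for abstract reals. Here [y2] stands for
    [sqrt (S T)], [m] for [(beta T)^(1/4)], [sT] for [sqrt T], [sj] for the number of jumps, and
    [gl], [ge], [gb] for the contributions of the scaled steps, of the errors and of the objective
    decrease. Every term is dominated by [V = sT * ell^2 * r^2 * (1 + m)]. *)
Lemma gap_budget (K cb cq ell r y2 m sT sj gl ge gb : R) :
  1 <= K -> 0 <= cb -> 1 <= ell -> 1 <= r -> 0 <= m -> 1 <= sT ->
  sj <= 2 * ell -> gb <= cb * ell * r -> y2 <= cq * ell ^+ 2 * r ^+ 2 * (1 + m) ->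
  gl <= K * (sT * y2) -> ge <= K * (sT * (2^-1 * y2 + 2^-1 * r ^+ 2 + r * m)) ->
  2 * K ^+ 2 * sj + gl + ge + gb <=
    (4 * K ^+ 2 + cb + 3 / 2 * K * (cq + 1)) * ell ^+ 2 * r ^+ 2 * sT * (1 + m).
Proof.
move=> K1 cb0 l1 r1 m0 sT1 hj hB hy i3 i4.
have K0 : 0 <= K by exact: le_trans ler01 K1.
have l0 : 0 <= ell by exact: le_trans ler01 l1.
have r0 : 0 <= r by exact: le_trans ler01 r1.
have sT0 : 0 <= sT by exact: le_trans ler01 sT1.
have [W WE] : exists W, W = ell ^+ 2 * r ^+ 2 by exists (ell ^+ 2 * r ^+ 2).
have W1 : 1 <= W by rewrite WE -[1]mulr1 ler_pM// exprn_ege1.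
have W0 : 0 <= W by exact: le_trans ler01 W1.
have r1W : r ^+ 2 <= W by rewrite WE ler_peMl ?sqr_ge0// exprn_ege1.
have rW : r <= W by apply: le_trans r1W; rewrite expr2 ler_peMl.
have lW : ell <= W.
  rewrite WE -[leLHS]mulr1; apply: ler_pM => //; first by rewrite expr2 ler_peMl.
  by rewrite exprn_ege1.
have lrW : ell * r <= W by rewrite WE; apply: ler_pM => //; rewrite expr2 ler_peMl.
have [V VE] : exists V, V = sT * (W * (1 + m)) by exists (sT * (W * (1 + m))).
have WM : W <= W * (1 + m) by apply: ler_peMr => //; rewrite lerDl.
have WV : W <= V by rewrite VE; apply: (le_trans WM); apply: ler_peMl => //; exact: le_trans WM.
have V0 : 0 <= V by exact: le_trans WV.
have f1 : 2 * K ^+ 2 * sj <= 4 * K ^+ 2 * V.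
  have -> : 4 * K ^+ 2 * V = 2 * K ^+ 2 * (2 * V) by ring.
  apply: ler_wpM2l; first by rewrite mulr_ge0 ?sqr_ge0.
  apply: le_trans hj _; rewrite ler_wpM2l//; exact: le_trans WV.
have f2 : gb <= cb * V.
  apply: le_trans hB _; rewrite -mulrA ler_wpM2l//; exact: le_trans WV.
have f3 : sT * y2 <= cq * V.
  apply: le_trans (_ : sT * (cq * ell ^+ 2 * r ^+ 2 * (1 + m)) <= _); first by rewrite ler_wpM2l.
  by rewrite VE WE le_eqVlt; apply/orP; left; apply/eqP; ring.
have f4 : sT * (2^-1 * y2 + 2^-1 * r ^+ 2 + r * m) <= 2^-1 * (cq * V) + V.
  have g1 : r * m <= W * m by rewrite ler_wpM2r.
  have : sT * (2^-1 * r ^+ 2 + r * m) <= V by rewrite VE; apply: ler_wpM2l => //; lra.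
  by lra.
have f5 : K * (sT * y2) <= K * (cq * V) by rewrite ler_wpM2l.
have f6 : K * (sT * (2^-1 * y2 + 2^-1 * r ^+ 2 + r * m)) <= K * (2^-1 * (cq * V) + V).
  by rewrite ler_wpM2l.
have KV : 0 <= K * V by rewrite mulr_ge0.
have -> : (4 * K ^+ 2 + cb + 3 / 2 * K * (cq + 1)) * ell ^+ 2 * r ^+ 2 * sT * (1 + m) =
  (4 * K ^+ 2 + cb + 3 / 2 * K * (cq + 1)) * V by rewrite VE WE; ring.
lra.
Qed.

End RealInequalities.

Section Pathwise.
Context {R : realType}.
Variables (K beta rho D G L : R).
Hypotheses (K1 : 1 <= K) (D0 : 0 <= D) (DK : D <= K) (G0 : 0 <= G) (GK : G <= K)
  (L0 : 0 <= L) (LK : L <= K) (rho0 : 0 < rho) (rhoK : rho <= K) (irhoK : rho^-1 <= K)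
  (beta0 : 0 <= beta) (betaK : beta <= K ^+ 3).

(* [a t] is [1 / alpha t], [S t] is [1 + \sum_(i < t) q i] and [q t] is the squared scaled step. *)
Variables (S q d a l E : nat -> R).
Hypotheses (S_0 : S 0%N = 1) (S_S : forall t, S t.+1 = S t + q t)
  (qE : forall t, q t = (l t * d t) ^+ 2)
  (a_ge0 : forall t, 0 <= a t) (a_sqr : forall t, a t ^+ 2 = S t + beta * t%:R)
  (lE : forall t, l t = rho * Num.sqrt (S t) * Num.sqrt (a t))
  (d_ge0 : forall t, 0 <= d t) (d_le : forall t, d t <= D)
  (E_ge0 : forall t, 0 <= E t).

(** A jump more than quadruples [S]. The factor 3 yields [relinc t >= 3/4] and, since
    [a t.+1 ^+ 2 >= S t.+1 > 4], the bound [alpha <= 1/2] after the jump. *)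
Definition jump t := 3 * S t < q t.
(** Dividing by the new value keeps the relative increment below 1 even at a jump. *)
Definition relinc t := q t / S t.+1.
Definition cY : R := 4 * K ^+ 2 * (2 + K ^+ 3).

Lemma K_gt0 : 0 < K. Proof. exact: lt_le_trans ltr01 K1. Qed.
Lemma K_ge0 : 0 <= K. Proof. exact: ltW K_gt0. Qed.

Lemma cY_ge0 : 0 <= cY.
Proof.
have K0 := K_ge0; rewrite /cY mulr_ge0// ?mulr_ge0 ?sqr_ge0//.
by rewrite addr_ge0// exprn_ge0.
Qed.

Lemma q_ge0 t : 0 <= q t. Proof. by rewrite qE sqr_ge0. Qed.

Lemma S_ge1 t : 1 <= S t.
Proof. by elim: t => [|t ih]; rewrite ?S_0// S_S; have := q_ge0 t; lra. Qed.

Lemma S_gt0 t : 0 < S t. Proof. exact: lt_le_trans ltr01 (S_ge1 t). Qed.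

Lemma S_le s t : (s <= t)%N -> S s <= S t.
Proof.
move=> /subnK <-; elim: (t - s)%N => [|k ih]; first by rewrite add0n.
by rewrite addSn S_S; have := q_ge0 (k + s); lra.
Qed.

Lemma a_ge1 t : 1 <= a t.
Proof.
apply: ler_sqrX2 => //; rewrite expr1n a_sqr.
have := S_ge1 t; have : 0 <= beta * t%:R by rewrite mulr_ge0.
lra.
Qed.

Lemma a_gt0 t : 0 < a t. Proof. exact: lt_le_trans ltr01 (a_ge1 t). Qed.

Lemma a_le s t : (s <= t)%N -> a s <= a t.
Proof.
move=> st; apply: ler_sqrX2 => //; rewrite !a_sqr lerD ?S_le//.
by rewrite ler_wpM2l// ler_nat.
Qed.

Lemma l_ge0 t : 0 <= l t.
Proof. by rewrite lE !mulr_ge0 ?sqrtr_ge0// ltW. Qed.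

Lemma relinc_ge0 t : 0 <= relinc t.
Proof. by rewrite /relinc divr_ge0 ?q_ge0// ltW// S_gt0. Qed.

Lemma relinc_le1 t : relinc t <= 1.
Proof. by rewrite /relinc ler_pdivrMr ?S_gt0// mul1r S_S; have := S_gt0 t; lra. Qed.

Lemma relinc_ln t : relinc t <= ln (S t.+1) - ln (S t).
Proof.
apply: le_trans (ln_sub_ge (S_gt0 t) (S_gt0 t.+1)).
by rewrite /relinc S_S -addrA addrCA subrr addr0.
Qed.

Lemma jump_relinc t : jump t -> 3 / 4 <= relinc t.
Proof. by rewrite /jump /relinc ler_pdivlMr ?S_gt0// S_S; lra. Qed.

Lemma nojump_relinc t : ~~ jump t -> q t <= 4 * S t * relinc t.
Proof.
rewrite -leNgt /relinc => h; rewrite mulrA ler_pdivlMr ?S_gt0// S_S.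
by have := q_ge0 t; nra.
Qed.

(** By the formula for [l], [q t = rho^2 * S t * a t * d t^2], so [d t^2 * a t] is at most
    [4 * relinc t / rho^2]. Moreover [a t.+1 <= (2 + K^3) * a t], because [S] at most quadruples and
    [beta <= K^3]. Both bounds rest on [q t <= 3 * S t], and [cY] is the product of their
    constants. *)
Lemma nojump_step t : ~~ jump t -> d t ^+ 2 * a t.+1 <= cY * relinc t.
Proof.
move=> nj.
have ha : a t.+1 <= a t * (2 + K ^+ 3).
  apply: ler_sqrX2; first by rewrite mulr_ge0// addr_ge0// exprn_ge0// K_ge0.
  have K3 : 0 <= K ^+ 3 by rewrite exprn_ge0 ?K_ge0.
  have : a t.+1 ^+ 2 <= a t ^+ 2 * (4 + K ^+ 3).
    have -> : a t.+1 ^+ 2 = a t ^+ 2 + q t + beta.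
      by rewrite !a_sqr S_S -natr1; ring.
    have : q t <= 3 * a t ^+ 2.
      move: nj; rewrite -leNgt a_sqr; have : 0 <= beta * t%:R by rewrite mulr_ge0.
      lra.
    have : K ^+ 3 <= a t ^+ 2 * K ^+ 3 by rewrite ler_peMl// exprn_ege1// a_ge1.
    move=> h1 h2; have h3 := betaK; lra.
  move/le_trans; apply; rewrite exprMn ler_wpM2l ?sqr_ge0//; nra.
have hd : rho ^+ 2 * (d t ^+ 2 * a t) <= 4 * relinc t.
  rewrite -(ler_pM2l (S_gt0 t)).
  have -> : S t * (rho ^+ 2 * (d t ^+ 2 * a t)) = q t.
    rewrite qE lE !exprMn sqr_sqrtr ?(ltW (S_gt0 t))// sqr_sqrtr//; ring.
  by have := nojump_relinc nj; lra.
have hd2 : d t ^+ 2 * a t <= K ^+ 2 * (4 * relinc t).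
  have -> : d t ^+ 2 * a t = rho^-1 ^+ 2 * (rho ^+ 2 * (d t ^+ 2 * a t)).
    by field; rewrite gt_eqF.
  apply: ler_pM => //; [exact: sqr_ge0|exact: mulr_ge0 (sqr_ge0 _) (mulr_ge0 (sqr_ge0 _) (a_ge0 _))|].
  by apply: lerXn2r; rewrite ?nnegrE ?K_ge0// invr_ge0 ltW.
apply: le_trans (_ : d t ^+ 2 * (a t * (2 + K ^+ 3)) <= _).
  by rewrite ler_wpM2l ?sqr_ge0.
rewrite mulrA; apply: le_trans (_ : K ^+ 2 * (4 * relinc t) * (2 + K ^+ 3) <= _).
  by rewrite ler_wpM2r// addr_ge0// exprn_ge0// K_ge0.
by rewrite /cY le_eqVlt; apply/orP; left; apply/eqP; ring.
Qed.

(** * The weighted potential and its one-step decrease *)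

Section Potential.
Variables (Theta ell : R).
Hypotheses (Theta0 : 0 < Theta) (ellE : ell = ln Theta) (ell1 : 1 <= ell).

Definition live t : bool := S t <= Theta.
Definition weight t : R := if live t then 2 - ln (S t) / ell else 0.
(** The factor 8 has this origin: a jump lowers the weight by at least [1/(2 ell)], the cross term
    of error and movement uses half of it, and the factor [1 - alpha >= 1/2] leaves half of the
    remaining [1/(4 ell)]. *)
Definition damping t : R := (a t.+1)^-1 + (jump t)%:R / (8 * ell).
(** The first summand serves the steps without a jump, the second one the jumps. *)
Definition cR : R := 2 * K ^+ 2 * cY + 36 * K ^+ 4.

Lemma ell_gt0 : 0 < ell. Proof. exact: lt_le_trans ltr01 ell1. Qed.

Lemma damping_ge0 t : 0 <= damping t.
Proof.
have ell0 := ell_gt0.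
by rewrite /damping addr_ge0 ?invr_ge0// divr_ge0 ?ler0n//; lra.
Qed.

Lemma liveS t : live t.+1 -> live t.
Proof. by rewrite /live; apply: le_trans; rewrite S_S lerDl q_ge0. Qed.

Lemma lnS_ge0 t : 0 <= ln (S t). Proof. by rewrite ln_ge0 ?S_ge1. Qed.

Lemma live_ln t : live t -> ln (S t) / ell <= 1.
Proof.
move=> lt; rewrite ler_pdivrMr ?ell_gt0// mul1r ellE.
by rewrite ler_ln ?posrE ?S_gt0.
Qed.

Lemma weight_ge t : (live t)%:R <= weight t.
Proof. by rewrite /weight; case: ifP => //= /live_ln; rewrite -[1%:R]/(1 : R); lra. Qed.

Lemma weight_le t : weight t <= 2 * (live t)%:R.
Proof.
rewrite /weight; case: ifP => _; last by rewrite mulr_ge0 ?ler0n.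
have : 0 <= ln (S t) / ell by rewrite divr_ge0 ?lnS_ge0 ?ltW ?ell_gt0.
by rewrite -[true%:R]/(1 : R); lra.
Qed.

Lemma weight_ge0 t : 0 <= weight t.
Proof. exact: le_trans (ler0n _ _) (weight_ge t). Qed.

(** Below the threshold the logarithm grows by at least [relinc t]. When the threshold is crossed
    the weight falls from at least 1 to 0, which covers [relinc t / ell <= 1]. *)
Lemma weight_drop t : weight t.+1 + (live t)%:R * relinc t / ell <= weight t.
Proof.
have h0 := relinc_ge0 t; have h1 := relinc_le1 t; have h2 := relinc_ln t.
have ell0 := ell_gt0; have li := invr_gt0 ell; rewrite ell0 in li.
rewrite /weight; case: ifP => [/[dup] l1 /liveS ->|_].
  rewrite mul1r; have : relinc t / ell <= (ln (S t.+1) - ln (S t)) / ell.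
    by rewrite ler_wpM2r// ltW.
  by rewrite mulrBl; lra.
case: ifP => [/live_ln h|_]; last by rewrite !mul0r addr0.
rewrite mul1r add0r.
have : relinc t / ell <= 1 by rewrite ler_pdivrMr// mul1r; exact: le_trans ell1.
by lra.
Qed.

(* On a jump the weight drops by [~ 1/ell], which absorbs the cross term [E d];
   elsewhere Young's inequality with parameter [alpha] does. *)
Lemma potential_step t :
  weight t.+1 * ((1 - (a t.+1)^-1) * (E t + L * d t)) ^+ 2
    + (live t)%:R * damping t * E t ^+ 2
  <= weight t * E t ^+ 2 + cR * ell * ((live t)%:R * relinc t).
Proof.
have w0 := weight_ge0 t.+1; have wd := weight_drop t; have wl := weight_le t.
have wg := weight_ge t.
have h0 := relinc_ge0 t; have a1 := a_ge1 t.+1; have ell0 := ell_gt0.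
have cY0 := cY_ge0; have K0 := K_ge0; have ell1' := ell1.
set al := (a t.+1)^-1; have al0 : 0 < al by rewrite invr_gt0 a_gt0.
have al1 : al <= 1 by rewrite invf_le1 ?a_gt0.
have ala : al * a t.+1 = 1 by rewrite mulVf// gt_eqF// a_gt0.
have [lt|nlt] := boolP (live t); last first.
  have -> : weight t.+1 = 0.
    by rewrite /weight ifF//; apply: contraNF nlt; exact: liveS.
  by rewrite !mul0r mulr0 addr0 addr0 mulr_ge0 ?sqr_ge0// weight_ge0.
rewrite lt !mul1r /= in wd wl wg *.
set e := E t; have e0 : 0 <= e by exact: E_ge0.
set u := L * d t; have u0 : 0 <= u by rewrite mulr_ge0.
have ww : weight t.+1 <= weight t.
  by apply: le_trans wd; rewrite lerDl mulr_ge0// invr_ge0 ltW.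
rewrite /damping -/al; have [jt|nj] := boolP (jump t); last first.
  rewrite mul0r addr0.
  (* Young's inequality gives the factors [1 + al] and [1 + 1/al]; then
     [(1 - al)^2 (1 + al) <= 1 - al] and [(1 - al)(1 + 1/al) <= 1/al = a t.+1]. *)
  have key : ((1 - al) * (e + u)) ^+ 2 <= (1 - al) * e ^+ 2 + a t.+1 * u ^+ 2.
    have y := @young _ al e u al0.
    have h1 : (e + u) ^+ 2 <= (1 + al) * e ^+ 2 + (1 + a t.+1) * u ^+ 2.
      by rewrite -[a t.+1]invrK -/al sqrrD; lra.
    have h2 : ((1 - al) * (e + u)) ^+ 2 <= (1 - al) ^+ 2 * ((1 + al) * e ^+ 2 + (1 + a t.+1) * u ^+ 2).
      by rewrite exprMn ler_wpM2l// sqr_ge0.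
    apply: le_trans h2 _; rewrite mulrDr; apply: lerD; rewrite mulrA ler_wpM2r ?sqr_ge0//.
      by nra.
    have : (1 - al) ^+ 2 <= 1 - al by rewrite expr2 ler_piMl; lra.
    move=> h3; apply: le_trans (_ : (1 - al) * (1 + a t.+1) <= _).
      by rewrite ler_wpM2r; lra.
    by rewrite mulrDr mulr1 mulrBl mul1r ala; lra.
  have s1 : weight t.+1 * ((1 - al) * (e + u)) ^+ 2 <= weight t * ((1 - al) * e ^+ 2 + a t.+1 * u ^+ 2).
    by apply: ler_pM => //; exact: sqr_ge0.
  have s2 : a t.+1 * u ^+ 2 <= K ^+ 2 * (cY * relinc t).
    rewrite /u exprMn mulrCA; apply: ler_pM; rewrite ?sqr_ge0 ?mulr_ge0 ?sqr_ge0//.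
      by rewrite lerXn2r ?nnegrE.
    by rewrite mulrC nojump_step.
  have s3 : weight t * (a t.+1 * u ^+ 2) <= 2 * (K ^+ 2 * (cY * relinc t)).
    by apply: ler_pM => //; [exact: weight_ge0|rewrite mulr_ge0 ?sqr_ge0|lra].
  have s4 : al * e ^+ 2 <= weight t * (al * e ^+ 2).
    by rewrite ler_peMl// mulr_ge0 ?sqr_ge0// ltW.
  have s5 : 2 * (K ^+ 2 * (cY * relinc t)) <= cR * ell * relinc t.
    have -> : 2 * (K ^+ 2 * (cY * relinc t)) = (2 * K ^+ 2 * cY) * 1 * relinc t by ring.
    rewrite ler_wpM2r// ler_pM//.
      by rewrite mulr_ge0// mulr_ge0// sqr_ge0.
    by rewrite /cR lerDl mulr_ge0// exprn_ge0.
  move: s1 s3 s4; rewrite !mulrDr !mulrBl !mulrBr !mul1r; lra.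
have rj := jump_relinc jt; rewrite mul1r.
have al2 : al <= 2^-1.
  rewrite /al lef_pV2 ?posrE ?a_gt0//; apply: ler_sqrX2 => //.
  rewrite a_sqr S_S; move: jt; rewrite /jump; have := S_ge1 t.
  have : 0 <= beta * t.+1%:R by rewrite mulr_ge0.
  lra.
set il := ell^-1 in wd *; have il0 : 0 < il by rewrite invr_gt0.
have ill : il * ell = 1 by rewrite mulVf// gt_eqF.
have wd2 : weight t.+1 <= weight t - 2^-1 * il.
  have : 3 / 4 * il <= relinc t * il by rewrite ler_wpM2r// ltW.
  by lra.
(* At a jump the change of gradient is bounded by the diameter alone; the resulting constant is
   charged to [relinc t], which is bounded below there. *)
have u1 : u <= K ^+ 2 by rewrite expr2 ler_pM// (le_trans (d_le _)).
have i8 : (8 * ell)^-1 = 8^-1 * il by rewrite invfM.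
rewrite i8.
have y := @young _ (8^-1 * il) e u (mulr_gt0 _ il0).
have {}y : 2 * (e * u) <= 8^-1 * il * e ^+ 2 + 8 * ell * u ^+ 2.
  have -> : 8 * ell = (8^-1 * il)^-1 by rewrite invfM !invrK.
  by have := y ltac:(lra); lra.
have w2 : weight t.+1 <= 2 by lra.
have t1 : weight t.+1 * ((1 - al) * (e + u)) ^+ 2 <=
   (1 - al) * (weight t.+1 * e ^+ 2 + 2 * (2 * (e * u) + u ^+ 2)).
  have -> : ((1 - al) * (e + u)) ^+ 2 = (1 - al) * ((1 - al) * (e + u) ^+ 2) by ring.
  rewrite mulrCA; apply: ler_wpM2l; first lra.
  apply: le_trans (_ : weight t.+1 * (e + u) ^+ 2 <= _).
    apply: ler_wpM2l => //; apply: ler_piMl; [exact: sqr_ge0|lra].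
  rewrite sqrrD -mulr_natl -addrA mulrDr lerD2l; apply: ler_wpM2r => //.
  by rewrite addr_ge0 ?sqr_ge0// !mulr_ge0.
have t2 : weight t.+1 * e ^+ 2 <= weight t * e ^+ 2 - 2^-1 * il * e ^+ 2.
  by rewrite -mulrBl ler_wpM2r// sqr_ge0.
have u2 : u ^+ 2 <= K ^+ 4 by rewrite (exprM K 2 2) lerXn2r ?nnegrE// exprn_ge0.
have t3 : weight t.+1 * e ^+ 2 + 2 * (2 * (e * u) + u ^+ 2) <=
   weight t * e ^+ 2 - 4^-1 * il * e ^+ 2 + (16 * ell + 2) * u ^+ 2 by lra.
have t4 : (1 - al) * (weight t * e ^+ 2 - 4^-1 * il * e ^+ 2 + (16 * ell + 2) * u ^+ 2)
   <= weight t * e ^+ 2 - al * e ^+ 2 - 8^-1 * il * e ^+ 2 + 18 * ell * u ^+ 2.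
  have e2 : 0 <= e ^+ 2 by rewrite sqr_ge0.
  have x1 : al * e ^+ 2 <= weight t * (al * e ^+ 2) by rewrite ler_peMl// mulr_ge0// ltW.
  have x2 : 8^-1 * il * e ^+ 2 <= (1 - al) * (4^-1 * il * e ^+ 2).
    have -> : 8^-1 * il * e ^+ 2 = 2^-1 * (4^-1 * il * e ^+ 2) by field.
    apply: ler_wpM2r; first by rewrite !mulr_ge0// ltW.
    lra.
  have x3 : (1 - al) * ((16 * ell + 2) * u ^+ 2) <= 18 * ell * u ^+ 2.
    rewrite mulrA ler_wpM2r ?sqr_ge0//.
    apply: le_trans (_ : 1 * (16 * ell + 2) <= _); last by lra.
    by apply: ler_wpM2r; lra.
  by rewrite !mulrDr mulrBl mul1r mulrN; lra.
have t5 : 18 * ell * u ^+ 2 <= cR * ell * relinc t.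
  apply: le_trans (_ : 36 * K ^+ 4 * ell * relinc t <= _).
    have : 18 * ell * u ^+ 2 <= 18 * ell * K ^+ 4 by rewrite ler_wpM2l// mulr_ge0// ltW.
    have : 18 * ell * K ^+ 4 * 1 <= 18 * ell * K ^+ 4 * (2 * relinc t).
      by rewrite ler_wpM2l ?mulr_ge0 ?exprn_ge0// ?ltW//; lra.
    by lra.
  apply: ler_wpM2r => //; apply: ler_wpM2r; first exact: ltW.
  by rewrite /cR lerDr mulr_ge0// mulr_ge0// sqr_ge0.
have t6 : (1 - al) * (weight t.+1 * e ^+ 2 + 2 * (2 * (e * u) + u ^+ 2)) <=
  (1 - al) * (weight t * e ^+ 2 - 4^-1 * il * e ^+ 2 + (16 * ell + 2) * u ^+ 2).
  by apply: ler_wpM2l => //; lra.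
by rewrite mulrDl; lra.
Qed.

(** The logarithm telescopes up to [ell] while the threshold holds, and the single step that crosses
    it adds at most 1. *)
Lemma sum_live_relinc T : \sum_(t < T) (live t)%:R * relinc t <= ell + 1.
Proof.
suff : \sum_(t < T) (live t)%:R * relinc t <= (if live T then ln (S T) else ell + 1).
  move/le_trans; apply; case: ifP => // /live_ln.
  by rewrite ler_pdivrMr ?ell_gt0//; lra.
elim: T => [|T ih].
  by rewrite big_ord0; case: ifP => _; [exact: lnS_ge0|have := ell_gt0; lra].
rewrite big_ord_recr /=; have h0 := relinc_ln T; have h1 := relinc_le1 T.
case: ifP => [/liveS lT|_].
  by rewrite lT in ih *; rewrite mul1r; lra.
case: ifP ih => [/live_ln lT|_] ih; last by rewrite mul0r addr0.
by move: lT; rewrite ler_pdivrMr ?ell_gt0// mul1r => lT; rewrite mul1r; lra.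
Qed.

(** * The sum of the gaps along a trajectory that stays below the threshold *)

Section GapSum.
Variables (Fv gap : nat -> R) (T : nat).
Hypotheses (T0 : (0 < T)%N) (STheta : S T <= Theta)
  (step_E : forall t, l t * d t <= 2 * G + E t)
  (descent : forall t, l t * d t ^+ 2 <= (Fv t - Fv t.+1) + (E t * d t + L * d t ^+ 2))
  (Fv_le : forall s t, Fv s - Fv t <= 2 * G * D)
  (gap_le : forall t, gap t <= D * (l t * d t) + D * E t
     + ((Fv t - Fv t.+1) + (E t * d t + L * d t ^+ 2)))
  (gap_diam : forall t, gap t <= 2 * G * D).

Let z t := damping t * E t ^+ 2.
Let j t : R := (jump t)%:R.
Let Z := \sum_(t < T) z t.
(** The scale of the Young parameters below. With it the sums of products of error and movement come
    out proportional to [r], and the final bound to [r^2 = 1 + Z], which is affine in [Z]. *)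
Let r := Num.sqrt (1 + Z).
Let m := Num.sqrt (Num.sqrt (beta * T%:R)).
Let y := Num.sqrt (Num.sqrt (S T)).
Let u := Num.sqrt (a T).
Let sT := Num.sqrt (T%:R : R).

(** [cB], [cQ] and [cgap] are the constants of the objective decrease off the jumps, of [sqrt (S T)]
    and of the gap sum. *)
Definition cB : R := 6 * K ^+ 2 + 1 + 2 * K * cY.
Definition cQ : R := 28 * K + K ^+ 2 * cB ^+ 2 + 2 * K * cB.
Definition cgap : R := 4 * K ^+ 2 + cB + 3 / 2 * K * (cQ + 1).

Let z_ge0 t : 0 <= z t.
Proof. by rewrite mulr_ge0 ?sqr_ge0// damping_ge0. Qed.

Let Z_ge0 : 0 <= Z. Proof. exact: sumr_ge0. Qed.

Let r_sqr : r ^+ 2 = 1 + Z.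
Proof. by rewrite sqr_sqrtr// addr_ge0. Qed.

Let r_ge1 : 1 <= r.
Proof. by rewrite -sqrtr1 ler_wsqrtr// lerDl. Qed.

Let r_gt0 : 0 < r. Proof. exact: lt_le_trans ltr01 r_ge1. Qed.

Let Zr : r^-1 * Z <= r.
Proof. by rewrite mulrC ler_pdivrMr// -expr2 r_sqr lerDr. Qed.

Let sum_relinc : \sum_(t < T) relinc t <= ell.
Proof.
suff H : forall T', \sum_(t < T') relinc t <= ln (S T').
  by apply: le_trans (H T) _; rewrite ellE ler_ln ?posrE ?S_gt0.
elim=> [|T' ih]; first by rewrite big_ord0 lnS_ge0.
by rewrite big_ord_recr /=; have := relinc_ln T'; lra.
Qed.

Let j_relinc t : j t <= 2 * relinc t.
Proof.
rewrite /j; have [/jump_relinc|_] := boolP (jump t); last by rewrite mulr_ge0 ?relinc_ge0.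
by rewrite -[true%:R]/(1 : R); lra.
Qed.

Let sum_j : \sum_(t < T) j t <= 2 * ell.
Proof.
apply: le_trans (_ : \sum_(t < T) 2 * relinc t <= _).
  by apply: ler_sum => t _; exact: j_relinc.
by rewrite -mulr_sumr ler_wpM2l.
Qed.

Let al_le t : (a t.+1)^-1 * E t ^+ 2 <= z t.
Proof.
have ell0 := ell_gt0; rewrite /z /damping mulrDl lerDl mulr_ge0 ?sqr_ge0//.
by rewrite divr_ge0// mulr_ge0// ltW.
Qed.

(** Young's inequality with parameter [alpha / r]: the error half is covered by the damping, and the
    movement half, multiplied by [a t.+1], by the relative increment. *)
Let noj_cross t : ~~ jump t ->
  E t * d t + L * d t ^+ 2 <= 2^-1 * r^-1 * z t + (2^-1 * r * cY + K * cY) * relinc t.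
Proof.
move=> nj; have h := nojump_step nj; have h1 := al_le t.
have a1 := a_ge1 t.+1; have a0 := a_gt0 t.+1.
have ri0 : 0 < r^-1 by rewrite invr_gt0 r_gt0.
have ai0 : 0 < (a t.+1)^-1 by rewrite invr_gt0.
have y1 := @young _ (r^-1 * (a t.+1)^-1) (E t) (d t) (mulr_gt0 ri0 ai0).
rewrite invfM !invrK in y1.
have h2 : r^-1 * ((a t.+1)^-1 * E t ^+ 2) <= r^-1 * z t by rewrite ler_wpM2l// ltW.
have h3 : r * (d t ^+ 2 * a t.+1) <= r * (cY * relinc t) by rewrite ler_wpM2l// ltW// r_gt0.
have h4 : L * d t ^+ 2 <= K * (cY * relinc t).
  apply: ler_pM => //; first exact: sqr_ge0.
  by apply: le_trans h; rewrite ler_peMr// sqr_ge0.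
lra.
Qed.

Let GD_K : 2 * G * D <= 2 * K ^+ 2.
Proof.
have : G * D <= K * K by apply: ler_pM.
by rewrite expr2; lra.
Qed.

(** The differences of [Fv] telescope only if no step is left out. At a jump the missing difference
    is put back at the price [2 G D], hence the term [2 K^2 * j t]. *)
Let noj_decrease t :
  (~~ jump t)%:R * ((Fv t - Fv t.+1) + (E t * d t + L * d t ^+ 2)) <=
  2^-1 * r^-1 * z t + (2^-1 * r * cY + K * cY) * relinc t + 2 * K ^+ 2 * j t + (Fv t - Fv t.+1).
Proof.
have cY0 := cY_ge0; have K0 := K_ge0; have ri0 : 0 < r^-1 by rewrite invr_gt0 r_gt0.
rewrite /j; have [jt|nj] := boolP (jump t).
  rewrite mul0r mulr1.
  have := Fv_le t.+1 t; have := GD_K.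
  have : 0 <= 2^-1 * r^-1 * z t by rewrite mulr_ge0 ?z_ge0// mulr_ge0// ltW.
  have : 0 <= (2^-1 * r * cY + K * cY) * relinc t.
    have r0 := ltW r_gt0.
    by rewrite mulr_ge0 ?relinc_ge0// addr_ge0// mulr_ge0// mulr_ge0.
  lra.
by rewrite mul1r mulr0 addr0; have := noj_cross nj; lra.
Qed.

Let B := 2 * K ^+ 2 * (1 + 2 * ell) + 2^-1 * r + (2^-1 * r * cY + K * cY) * ell.

Let coef_ge0 : 0 <= 2^-1 * r * cY + K * cY.
Proof.
have r0 := ltW r_gt0; have cY0 := cY_ge0; have K0 := K_ge0.
by rewrite addr_ge0 // mulr_ge0// mulr_ge0.
Qed.

Let sum_decrease :
  \sum_(t < T) (~~ jump t)%:R * ((Fv t - Fv t.+1) + (E t * d t + L * d t ^+ 2)) <= B.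
Proof.
apply: le_trans (ler_sum _ (fun (t : 'I_T) _ => noj_decrease t)) _.
rewrite sum_affine.
have h1 := Fv_le 0 T; have h2 := GD_K; have h3 := Zr; have h4 := sum_relinc; have h5 := sum_j.
have K2 : 0 <= 2 * K ^+ 2 by rewrite mulr_ge0 ?sqr_ge0.
have h6 : 2 * K ^+ 2 * (\sum_(t < T) j t) <= 2 * K ^+ 2 * (2 * ell) by rewrite ler_wpM2l.
have h7 : (2^-1 * r * cY + K * cY) * (\sum_(t < T) relinc t) <= (2^-1 * r * cY + K * cY) * ell.
  by rewrite ler_wpM2l.
by rewrite -/Z /B; lra.
Qed.

Let B_le : B <= cB * ell * r.
Proof.
have r1 := r_ge1; have cY0 := cY_ge0; have K0 := K_ge0; have K1' := K1.
have l1 := ell1; have lr : 1 <= ell * r by rewrite -[1]mulr1; apply: ler_pM.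
have K2 : 0 <= K ^+ 2 by exact: sqr_ge0.
have lr' : ell <= ell * r by rewrite ler_peMr// ltW// ell_gt0.
have rl' : r <= ell * r by rewrite ler_peMl// ltW// r_gt0.
have h1 : 2 * K ^+ 2 * (1 + 2 * ell) <= 2 * K ^+ 2 * (3 * (ell * r)).
  by apply: ler_wpM2l; lra.
have h2 : K * cY * ell <= K * cY * (ell * r) by rewrite ler_wpM2l// mulr_ge0.
have h3 : cY * (ell * r) <= K * cY * (ell * r).
  by rewrite -mulrA ler_peMl// mulr_ge0//; lra.
have h4 : 0 <= cY * (ell * r) by rewrite mulr_ge0//; lra.
rewrite /B /cB; lra.
Qed.

Let B_ge0 : 0 <= B.
Proof.
have r0 := ltW r_gt0; have c0 := coef_ge0; have e0 := ltW ell_gt0.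
have : 0 <= 2 * K ^+ 2 * (1 + 2 * ell).
  by apply: mulr_ge0; [rewrite mulr_ge0 ?sqr_ge0|lra].
have : 0 <= (2^-1 * r * cY + K * cY) * ell by rewrite mulr_ge0.
rewrite /B; lra.
Qed.

(** At a jump, [sqrt (S + q) <= sqrt S + sqrt q] with [sqrt q = l t * d t]. Elsewhere the increase
    is at most [q t / sqrt (S t) = rho * sqrt (a t) * (l t * d t^2)], whose last factor is
    controlled by the descent inequality. *)
Let sqrtS_step t : (t < T)%N -> Num.sqrt (S t.+1) <= Num.sqrt (S t) +
  (j t * (2 * G + E t) + rho * u * ((~~ jump t)%:R * ((Fv t - Fv t.+1) + (E t * d t + L * d t ^+ 2)))).
Proof.
move=> tT; have S0 := S_ge1 t; have sS := sqrtr_ge0 (S t).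
have sS2 : Num.sqrt (S t) ^+ 2 = S t by rewrite sqr_sqrtr// ltW// S_gt0.
have ld0 : 0 <= l t * d t by rewrite mulr_ge0// l_ge0.
have u0 : 0 <= u by exact: sqrtr_ge0.
rewrite /j; have [jt|nj] := boolP (jump t).
  rewrite mul1r mul0r mulr0 addr0.
  apply: le_trans (_ : Num.sqrt (S t) + l t * d t <= _); last by rewrite lerD2l.
  apply: ler_sqrX2; first by rewrite addr_ge0.
  rewrite sqr_sqrtr ?(ltW (S_gt0 _))// S_S qE sqrrD sS2 -addrA lerD2l.
  by rewrite lerDr mulrn_wge0// mulr_ge0.
rewrite mul0r add0r mul1r.
have h : l t * d t ^+ 2 * u * rho <= rho * u * ((Fv t - Fv t.+1) + (E t * d t + L * d t ^+ 2)).
  by rewrite [leRHS]mulrC [rho * u]mulrC -mulrA ler_wpM2r// mulr_ge0// ltW.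
have h2 : q t <= Num.sqrt (S t) * (l t * d t ^+ 2 * u * rho).
  have -> : q t = l t * (l t * d t ^+ 2) by rewrite qE; ring.
  rewrite {1}lE.
  have -> : rho * Num.sqrt (S t) * Num.sqrt (a t) * (l t * d t ^+ 2) =
    Num.sqrt (S t) * (l t * d t ^+ 2 * Num.sqrt (a t) * rho) by ring.
  rewrite ler_wpM2l// ler_wpM2r ?(ltW rho0)// ler_wpM2l ?mulr_ge0 ?sqr_ge0 ?l_ge0//.
  by rewrite ler_wsqrtr// a_le// ltnW.
set w := l t * d t ^+ 2 * u * rho in h h2.
have w0 : 0 <= w by rewrite /w !mulr_ge0 ?sqr_ge0 ?l_ge0// ltW.
apply: le_trans (_ : Num.sqrt (S t) + w <= _); last by rewrite lerD2l.
apply: ler_sqrX2; first by rewrite addr_ge0.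
rewrite sqr_sqrtr ?(ltW (S_gt0 _))// S_S sqrrD sS2 -addrA lerD2l.
apply: le_trans h2 _; rewrite mulr2n.
have : 0 <= Num.sqrt (S t) * w by rewrite mulr_ge0.
have : 0 <= w ^+ 2 by rewrite sqr_ge0.
lra.
Qed.

(** The additional damping at jumps is spent here: Young's inequality with parameter [1/(8 ell r)]
    bounds the error at a jump, and half of its inverse gives [4 ell r]. *)
Let jE_le t : j t * (2 * G + E t) <= 2^-1 * r^-1 * z t + (4 * ell * r + 2 * K) * j t.
Proof.
have ell0 := ell_gt0; have r0 := r_gt0; have ri0 : 0 < r^-1 by rewrite invr_gt0.
have GK' := GK; rewrite /j /z /damping; case: (jump t); last first.
  rewrite !mul0r addr0 mulr0 addr0 mulr_ge0 ?mulr_ge0 ?sqr_ge0//.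
  - exact: ltW.
  - by rewrite invr_ge0.
rewrite mul1r mulr1 -[true%:R]/(1 : R) div1r.
have le0 : 0 < r^-1 * (8 * ell)^-1 by rewrite mulr_gt0// invr_gt0 mulr_gt0.
have li : (r^-1 * (8 * ell)^-1)^-1 = r * (8 * ell) by rewrite invfM !invrK.
have := @young _ _ (E t) 1 le0; rewrite mulr1 expr1n mulr1 li.
have : 0 <= r^-1 * ((a t.+1)^-1 * E t ^+ 2).
  by rewrite !mulr_ge0 ?sqr_ge0 ?invr_ge0// ltW.
by rewrite mulrDl; lra.
Qed.

Let y_ge0 : 0 <= y. Proof. exact: sqrtr_ge0. Qed.
Let m_ge0 : 0 <= m. Proof. exact: sqrtr_ge0. Qed.
Let u_ge0 : 0 <= u. Proof. exact: sqrtr_ge0. Qed.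

Let y_sqr : y ^+ 2 = Num.sqrt (S T).
Proof. by rewrite sqr_sqrtr// sqrtr_ge0. Qed.

Let u_le : u <= y + m.
Proof.
have yE := y_sqr.
have mE : m ^+ 2 = Num.sqrt (beta * T%:R) by rewrite sqr_sqrtr// sqrtr_ge0.
  apply: ler_sqrX2; first by rewrite addr_ge0.
apply: le_trans (_ : y ^+ 2 + m ^+ 2 <= _); last first.
  have : 0 <= y * m by rewrite mulr_ge0.
  by rewrite sqrrD mulr2n; lra.
rewrite /u sqr_sqrtr//; apply: ler_sqrX2; first by rewrite addr_ge0 ?sqr_ge0.
rewrite a_sqr yE mE sqrrD !sqr_sqrtr ?mulr_ge0 ?(ltW (S_gt0 _))//.
have := mulr_ge0 (sqrtr_ge0 (S T)) (sqrtr_ge0 (beta * T%:R)).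
by rewrite mulr2n; lra.
Qed.

(** Summing the increments gives [y^2 <= 1 + s1 + K (y + m) B], where [y] is the fourth root of
    [S T]. The right side is only linear in [y], so half of [y^2] absorbs [K y B] at the cost of
    [K^2 B^2 / 2]. *)
Let sqrtS_le : y ^+ 2 <= cQ * ell ^+ 2 * r ^+ 2 * (1 + m).
Proof.
have y0 : 0 <= y by exact: sqrtr_ge0.
have m0 : 0 <= m by exact: sqrtr_ge0.
have u0 : 0 <= u by exact: sqrtr_ge0.
have ym := u_le; have yE := y_sqr.
have K0 := K_ge0; have K1' := K1; have r1 := r_ge1; have l1 := ell1.
have r0 := ltW r_gt0; have ell0 := ltW ell_gt0; have B0 := B_ge0.
have tele : forall T', (T' <= T)%N -> Num.sqrt (S T') <= 1 + \sum_(t < T')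
    (j t * (2 * G + E t) + rho * u * ((~~ jump t)%:R * ((Fv t - Fv t.+1) + (E t * d t + L * d t ^+ 2)))).
  elim=> [_|T' ih hT]; first by rewrite big_ord0 S_0 sqrtr1 addr0.
  rewrite big_ord_recr /= addrA; apply: le_trans (sqrtS_step hT) _.
  by rewrite lerD2r ih// ltnW.
have := tele T (leqnn T); rewrite -yE big_split /= -mulr_sumr => {tele}.
set s1 := \sum_(t < T) _; set s2 := \sum_(t < T) _ => h.
have hs1 : s1 <= 2^-1 * r + (4 * ell * r + 2 * K) * (2 * ell).
  apply: le_trans (_ : \sum_(t < T) (2^-1 * r^-1 * z t + 0 * relinc t
    + (4 * ell * r + 2 * K) * j t + (0 - 0)) <= _).
    by apply: ler_sum => t _; have := jE_le t; rewrite mul0r subr0 !addr0.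
  rewrite (@sum_affine _ _ _ _ _ _ _ _ (fun=> 0)) mul0r subr0 !addr0.
  apply: lerD; first by rewrite -mulrA ler_wpM2l.
  by rewrite ler_wpM2l// addr_ge0 ?mulr_ge0.
have hs2 : rho * u * s2 <= K * (y + m) * B.
  apply: le_trans (_ : rho * u * B <= _).
    by rewrite ler_wpM2l ?sum_decrease// mulr_ge0// ltW.
  by rewrite ler_wpM2r// ler_pM// ltW.
have hU : 1 + s1 <= 14 * K * (ell ^+ 2 * r ^+ 2).
  have lr1 : 1 <= ell ^+ 2 * r ^+ 2 by rewrite -[1]mulr1 ler_pM// exprn_ege1.
  have lr2 : ell * 1 <= ell ^+ 2 * r ^+ 2.
    by apply: ler_pM => //; [rewrite expr2 ler_peMl|rewrite exprn_ege1].
  have lr3 : 1 * r <= ell ^+ 2 * r ^+ 2.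
    by apply: ler_pM => //; [rewrite exprn_ege1|rewrite expr2 ler_peMl].
  have lr4 : ell ^+ 2 * r <= ell ^+ 2 * r ^+ 2.
    by apply: ler_pM => //; [rewrite sqr_ge0|rewrite expr2 ler_peMl].
  have k1 : K * ell <= K * (ell ^+ 2 * r ^+ 2) by rewrite ler_wpM2l//; lra.
  have k2 : ell ^+ 2 * r ^+ 2 <= K * (ell ^+ 2 * r ^+ 2) by rewrite ler_peMl//; lra.
  by lra.
have hy : K * y * B <= 2^-1 * y ^+ 2 + 2^-1 * (K ^+ 2 * B ^+ 2).
  have : 0 <= (y - K * B) ^+ 2 by rewrite sqr_ge0.
  by rewrite sqrrB exprMn mulr2n; lra.
have hB := B_le.
have hB2 : B ^+ 2 <= cB ^+ 2 * (ell ^+ 2 * r ^+ 2).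
  by rewrite -!exprMn mulrA; apply: lerXn2r; rewrite ?nnegrE//; exact: le_trans hB.
have cB0 : 0 <= cB.
  have k2 : 0 <= K ^+ 2 by exact: sqr_ge0.
  have kc : 0 <= K * cY by rewrite mulr_ge0 ?cY_ge0.
  by rewrite /cB; lra.
have hBm : B * m <= cB * (ell ^+ 2 * r ^+ 2) * m.
  rewrite ler_wpM2r//; apply: le_trans hB _; rewrite -mulrA ler_wpM2l//.
  by apply: ler_pM => //; rewrite expr2 ler_peMl.
set lr := ell ^+ 2 * r ^+ 2 in hU hB2 hBm.
have lr0 : 0 <= lr by rewrite mulr_ge0 ?sqr_ge0.
have i1 : K ^+ 2 * B ^+ 2 <= K ^+ 2 * (cB ^+ 2 * lr) by rewrite ler_wpM2l ?sqr_ge0.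
have i2 : K * (B * m) <= K * (cB * lr * m) by rewrite ler_wpM2l.
have lrm : 0 <= lr * m by rewrite mulr_ge0.
have i3 : 0 <= K * (lr * m) by rewrite mulr_ge0.
have i4 : 0 <= K ^+ 2 * (cB ^+ 2 * (lr * m)) by rewrite !mulr_ge0 ?sqr_ge0.
have i5 : 0 <= K * (cB * lr) by rewrite !mulr_ge0.
rewrite -mulrA mulrACA [_ * (_ * _)]mulrC -!mulrA -/lr.
suff : y ^+ 2 <= cQ * lr + cQ * (lr * m) by rewrite /lr; lra.
rewrite /cQ; lra.
Qed.

(* Young's inequality with the parameter [lam] tuned so that both halves balance:
   a Cauchy-Schwarz inequality for the sums. *)
Lemma sum_gap_le : \sum_(t < T) gap t <= cgap * ell ^+ 2 * (1 + Z) * sT * (1 + m).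
Proof.
have K0 := K_ge0; have r0 := r_gt0; have y0 := y_ge0; have m0 := m_ge0; have u0 := u_ge0.
have l1 := ell1; have r1 := r_ge1; have Z0 := Z_ge0; have rs := r_sqr; have D0' := D0.
have ST1 := S_ge1 T; have aT1 := a_ge1 T.
have sT0 : 0 < sT by rewrite sqrtr_gt0 ltr0n.
have sT1 : 1 <= sT by rewrite -sqrtr1 ler_wsqrtr// ler1n.
have sT2 : sT ^+ 2 = T%:R by rewrite sqr_sqrtr// ler0n.
have y1 : 1 <= y by rewrite -sqrtr1 ler_wsqrtr// -sqrtr1 ler_wsqrtr.
have u1 : 1 <= u by rewrite -sqrtr1 ler_wsqrtr.
have y4 : y ^+ 2 * y ^+ 2 = S T by rewrite -expr2 y_sqr sqr_sqrtr// ltW// S_gt0.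
have uE : u ^+ 2 = a T by rewrite sqr_sqrtr.
have yp : 0 < y ^+ 2 by rewrite exprn_gt0// (lt_le_trans ltr01).
have up : 0 < u by exact: lt_le_trans ltr01 u1.
(* [lam] balances the sum of the [q t] against [T], with value [sqrt (T * S T)]; [c] balances the
   damped errors against [T * a T], with value [sT * u * r]. *)
pose lam := sT / y ^+ 2; pose c := sT * u / r.
have lam0 : 0 < lam by rewrite divr_gt0.
have c0 : 0 < c by rewrite divr_gt0// mulr_gt0.
have term t : (t < T)%N -> gap t <= 2 * K ^+ 2 * j t + D * (2^-1 * (lam * q t + lam^-1)) +
   D * (2^-1 * (c * z t + c^-1 * u ^+ 2)) +
   (~~ jump t)%:R * ((Fv t - Fv t.+1) + (E t * d t + L * d t ^+ 2)).
  move=> tT.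
  have g1 : D * (l t * d t) <= D * (2^-1 * (lam * q t + lam^-1)).
    by rewrite ler_wpM2l// qE; have := young (l t * d t) 1 lam0; rewrite mulr1 expr1n mulr1.
  have g2 : D * E t <= D * (2^-1 * (c * z t + c^-1 * u ^+ 2)).
    rewrite ler_wpM2l//; have a0 := a_gt0 t.+1.
    have ca0 : 0 < c * (a t.+1)^-1 by rewrite mulr_gt0// invr_gt0.
    have := young (E t) 1 ca0; rewrite mulr1 expr1n mulr1 invfM invrK.
    have : c * ((a t.+1)^-1 * E t ^+ 2) <= c * z t by rewrite ler_wpM2l ?al_le// ltW.
    have : c^-1 * a t.+1 <= c^-1 * u ^+ 2 by rewrite uE ler_wpM2l ?a_le// invr_ge0 ltW.
    by lra.
  have ld0 : 0 <= D * (l t * d t) by rewrite !mulr_ge0 ?l_ge0.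
  have E0 : 0 <= D * E t by rewrite mulr_ge0.
  have gd := GD_K; have := gap_diam t; have := gap_le t.
  (* At a jump the diameter bound on the gap replaces the decomposition; there are few jumps, so
     this costs a logarithm. *)
  rewrite /j; case: (jump t) => /=; rewrite ?mul0r ?mul1r ?mulr0 ?mulr1.
    by lra.
  by lra.
apply: le_trans (ler_sum _ (fun (t : 'I_T) _ => term t (ltn_ord t))) _.
rewrite !big_split /= -!mulr_sumr !big_split /= -!mulr_sumr -/Z !sumr_const card_ord.
have -> : \sum_(t < T) q t = S T - 1.
  have : forall T', \sum_(t < T') q t = S T' - 1.
    elim=> [|T' ih]; first by rewrite big_ord0 S_0 subrr.
    by rewrite big_ord_recr /= ih S_S addrAC.
  exact.
have hj := sum_j; have hd := sum_decrease; have hB := B_le.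
have i1 : 2^-1 * (lam * (S T - 1) + lam^-1 *+ T) <= sT * y ^+ 2.
  have -> : lam^-1 *+ T = sT * y ^+ 2.
    by rewrite -mulr_natr -sT2 /lam; field; rewrite !gt_eqF// (lt_le_trans ltr01).
  have : lam * (S T - 1) <= sT * y ^+ 2.
    apply: le_trans (_ : lam * (y ^+ 2 * y ^+ 2) <= _).
      by rewrite ler_wpM2l ?ltW// y4; lra.
    rewrite /lam le_eqVlt; apply/orP; left; apply/eqP; field.
    by rewrite gt_eqF// (lt_le_trans ltr01).
  by lra.
have i2 : 2^-1 * (c * Z + (c^-1 * u ^+ 2) *+ T) <= sT * (u * r).
  have -> : (c^-1 * u ^+ 2) *+ T = sT * (u * r).
    by rewrite -mulr_natr -sT2 /c; field; rewrite !gt_eqF.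
  have : c * Z <= sT * (u * r).
    have -> : c * Z = sT * u * (r^-1 * Z) by rewrite /c; ring.
    by rewrite [leRHS]mulrA ler_wpM2l ?Zr// ltW// mulr_gt0.
  by lra.
have i3 : D * (2^-1 * (lam * (S T - 1) + lam^-1 *+ T)) <= K * (sT * y ^+ 2).
  apply: le_trans (_ : D * (sT * y ^+ 2) <= _); first by rewrite ler_wpM2l.
  by rewrite ler_wpM2r// mulr_ge0// ltW.
have i4 : D * (2^-1 * (c * Z + (c^-1 * u ^+ 2) *+ T)) <= K * (sT * (u * r)).
  apply: le_trans (_ : D * (sT * (u * r)) <= _); first by rewrite ler_wpM2l.
  by rewrite ler_wpM2r// mulr_ge0// ?ltW// mulr_gt0.
have i5 : u * r <= 2^-1 * y ^+ 2 + 2^-1 * r ^+ 2 + r * m.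
  have : u * r <= (y + m) * r by rewrite ler_wpM2r ?u_le// ltW.
  have : 0 <= (y - r) ^+ 2 by exact: sqr_ge0.
  by rewrite sqrrB mulr2n; lra.
have i6 : K * (sT * (u * r)) <= K * (sT * (2^-1 * y ^+ 2 + 2^-1 * r ^+ 2 + r * m)).
  by rewrite ler_wpM2l// ler_wpM2l// ltW.
have cB0 : 0 <= cB.
  have k2 : 0 <= K ^+ 2 by exact: sqr_ge0.
  have kc : 0 <= K * cY by rewrite mulr_ge0 ?cY_ge0.
  by rewrite /cB addr_ge0//; [rewrite addr_ge0// mulr_ge0|rewrite -mulrA mulr_ge0].
rewrite -rs /cgap.
have := gap_budget K1 cB0 l1 r1 m0 sT1 hj (le_trans hd hB) sqrtS_le i3 (le_trans i4 i6).
lra.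
Qed.
End GapSum.

End Potential.
End Pathwise.

(** * Trajectories of the algorithm *)

Section Trajectory.
Context {R : realType} {n : nat}.
Variables (X : set 'rV[R]_n) (f : 'rV[R]_n -> R) (h : 'rV[R]_n -> \bar R)
  (xstar : 'rV[R]_n) (G L rho beta : R) (x0 : 'rV[R]_n)
  (s x g v : nat -> 'rV[R]_n) (alpha Lt : nat -> R).
Hypotheses (pb : composite_problem X f h xstar) (bg : bounded_gradients X f h G)
  (sm : smooth_on X f L) (rho0 : 0 < rho) (beta0 : 0 <= beta) (Xx0 : X x0)
  (tr : alfcg_mvr1 X h rho beta x0 s x g v alpha Lt).
Local Notation D := (diam X).
Local Notation hr := (fun u => fine (h u)).

Definition step t : R := enorm (x t.+1 - x t).
Definition qstep t : R := (Lt t * step t) ^+ 2.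
Definition qsum t : R := 1 + \sum_(i < t) qstep i.
Definition err t : 'rV[R]_n := g t - grad f (x t).
Definition inner_gap t : R := hr (x t) - hr (v t) - dotp (g t) (v t - x t).
(** The step size computed in the reals. If [v t = x t] the inverse of 0 makes it 0, which is
    harmless since the direction vanishes. *)
Definition eta t : R :=
  Num.min (inner_gap t / (Lt t * enorm (v t - x t) ^+ 2)) 1.

Lemma qsum0 : qsum 0 = 1. Proof. by rewrite /qsum big_ord0 addr0. Qed.

Lemma qsumS t : qsum t.+1 = qsum t + qstep t.
Proof. by rewrite /qsum big_ord_recr addrA. Qed.

Lemma qsum_ge1 t : 1 <= qsum t.
Proof. by rewrite /qsum lerDl sumr_ge0// => i _; rewrite sqr_ge0. Qed.

Lemma qsum_beta_ge1 t : 1 <= qsum t + beta * t%:R.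
Proof. by rewrite (le_trans (qsum_ge1 t))// lerDl mulr_ge0. Qed.

Lemma alphaE t : alpha t = (Num.sqrt (qsum t + beta * t%:R))^-1.
Proof.
rewrite (alpha_def tr) big_split /= sumr_const card_ord; congr (Num.sqrt _)^-1.
rewrite /qsum -addrA; congr (_ + _); rewrite addrC mulr_natr; congr (_ + _).
by apply: eq_bigr => i _; rewrite /qstep exprMn.
Qed.

Lemma alphaV_sqr t : (alpha t)^-1 ^+ 2 = qsum t + beta * t%:R.
Proof. by rewrite alphaE invrK sqr_sqrtr//; exact: le_trans ler01 (qsum_beta_ge1 t). Qed.

Lemma alphaV_ge1 t : 1 <= (alpha t)^-1.
Proof. by rewrite alphaE invrK -[leLHS]sqrtr1; apply: ler_wsqrtr; exact: qsum_beta_ge1. Qed.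

Lemma alpha_gt0 t : 0 < alpha t.
Proof. by rewrite -invr_gt0; exact: lt_le_trans ltr01 (alphaV_ge1 t). Qed.

Lemma alpha_le1 t : alpha t <= 1.
Proof. by rewrite -[alpha t]invrK invf_le1 ?alphaV_ge1// invr_gt0 alpha_gt0. Qed.

Lemma LtE t : Lt t = rho * Num.sqrt (qsum t) * Num.sqrt (alpha t)^-1.
Proof.
rewrite (Lt_def tr) sqrtrV ?ltW ?alpha_gt0//; congr (_ * Num.sqrt _ * _).
by rewrite /qsum; congr (_ + _); apply: eq_bigr => i _; rewrite /qstep exprMn.
Qed.

Lemma Lt_gt0 t : 0 < Lt t.
Proof.
rewrite LtE !mulr_gt0// sqrtr_gt0; last by rewrite invr_gt0 alpha_gt0.
exact: lt_le_trans ltr01 (qsum_ge1 t).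
Qed.

Lemma v_feasible t : X (v t). Proof. by have [] := v_def tr t. Qed.

Lemma v_argmin t u : X u -> dotp (v t) (g t) + hr (v t) <= dotp u (g t) + hr u.
Proof.
move=> Xu; have [_ /(_ u Xu)] := v_def tr t.
by rewrite -(h_fineK pb bg (v_feasible t)) -(h_fineK pb bg Xu) -!EFinD lee_fin.
Qed.

Lemma step_eta t : X (x t) -> x t.+1 = x t + eta t *: (v t - x t).
Proof.
move=> Xx; rewrite {1}(x_step tr); congr (_ + _ *: _).
rewrite -(h_fineK pb bg Xx) -(h_fineK pb bg (v_feasible t)).
by rewrite -!EFinD -EFinM -EFin_min.
Qed.

Lemma inner_gap_ge0 t : X (x t) -> 0 <= inner_gap t.
Proof.
move=> Xx; have := v_argmin t Xx; rewrite /inner_gap dotpBr !(dotpC (g t)); lra.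
Qed.

Lemma eta_itv t : X (x t) -> 0 <= eta t <= 1.
Proof.
move=> Xx; rewrite /eta ge_min lexx orbT andbT le_min ler01 andbT.
by rewrite divr_ge0 ?inner_gap_ge0// mulr_ge0 ?sqr_ge0// ltW// Lt_gt0.
Qed.

Lemma x_feasible t : X (x t).
Proof.
elim: t => [|t ih]; first by rewrite (x_init tr).
by rewrite step_eta//; apply: (feasible_segment pb) => //; [exact: v_feasible|exact: eta_itv].
Qed.

Let Xx := x_feasible.

Lemma step_ge0 t : 0 <= step t. Proof. exact: enorm_ge0. Qed.

Lemma step_diam t : step t <= D. Proof. exact: (enorm_diam pb). Qed.

Lemma stepE t : step t = eta t * enorm (v t - x t).
Proof.
rewrite /step step_eta// addrC addKr enormZ ger0_norm//.
by case/andP: (eta_itv (Xx t)).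
Qed.

Lemma inner_gap_le t : inner_gap t <= (G + enorm (g t)) * enorm (v t - x t).
Proof.
have := h_lipschitz pb bg (Xx t) (v_feasible t); rewrite enormC /inner_gap.
have := cauchy_schwarz (- g t) (v t - x t); rewrite dotpNl enormN; lra.
Qed.

(** The left side is [eta * (eta * Lt * |v - x|^2)], and the first argument of the minimum bounds
    the inner factor by the inner gap. *)
Lemma eta_inner_gap t : Lt t * step t ^+ 2 <= eta t * inner_gap t.
Proof.
have /andP[e0 e1] := eta_itv (Xx t); have L0 := Lt_gt0 t; have ig := inner_gap_ge0 (Xx t).
rewrite stepE exprMn.
have -> : Lt t * (eta t ^+ 2 * enorm (v t - x t) ^+ 2) =
   eta t * (eta t * (Lt t * enorm (v t - x t) ^+ 2)) by ring.
rewrite ler_wpM2l//.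
have [->|vx] := eqVneq (enorm (v t - x t)) 0; first by rewrite expr0n/= !mulr0.
have p0 : 0 < Lt t * enorm (v t - x t) ^+ 2.
  by rewrite mulr_gt0// exprn_gt0// lt_neqAle eq_sym vx enorm_ge0.
by rewrite -ler_pdivlMr// /eta ge_min lexx.
Qed.

Lemma scaled_step_le t : Lt t * step t <= G + enorm (g t).
Proof.
have G0 := G_ge0 bg; have g0 := enorm_ge0 (g t).
have [d0|d0] := eqVneq (step t) 0; first by rewrite d0 mulr0 addr_ge0.
have dp : 0 < step t by rewrite lt_neqAle eq_sym d0 step_ge0.
rewrite -(ler_pM2r dp) -mulrA -expr2; apply: le_trans (eta_inner_gap t) _.
have /andP[e0 e1] := eta_itv (Xx t).
apply: le_trans (ler_wpM2l e0 (inner_gap_le t)) _.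
by rewrite mulrCA -stepE.
Qed.

Lemma norm_g_le t : enorm (g t) <= G + enorm (err t).
Proof.
have -> : g t = grad f (x t) + err t by rewrite /err addrC subrK.
by apply: le_trans (enormD _ _) _; rewrite lerD2r (grad_bound bg).
Qed.

Lemma scaled_step_err t : Lt t * step t <= 2 * G + enorm (err t).
Proof. by have := scaled_step_le t; have := norm_g_le t; lra. Qed.

Definition Fval t : R := f (x t) + hr (x t).

(** Smoothness bounds the change of [f], convexity along the step that of [h]; exchanging the true
    gradient for [g t] costs the error times the step. *)
Lemma eta_decrease t : eta t * inner_gap t <=
  (Fval t - Fval t.+1) + (enorm (err t) * step t + L * step t ^+ 2).
Proof.
have /andP[e0 e1] := eta_itv (Xx t).
have h1 := descent_step pb sm (Xx t) (Xx t.+1).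
have h2 : hr (x t.+1) <= eta t * hr (v t) + (1 - eta t) * hr (x t).
  have := @h_convex _ _ _ _ _ _ pb (v t) (x t) (eta t) (eta_itv (Xx t)).
  have <- : x t.+1 = eta t *: v t + (1 - eta t) *: x t.
    by rewrite step_eta// scalerBr scalerBl scale1r addrCA.
  rewrite -(h_fineK pb bg (Xx t)) -(h_fineK pb bg (v_feasible t)) -(h_fineK pb bg (Xx t.+1)).
  by rewrite -!EFinM -EFinD lee_fin.
have h3 : dotp (grad f (x t)) (x t.+1 - x t) <= eta t * dotp (g t) (v t - x t) + enorm (err t) * step t.
  have -> : grad f (x t) = g t - err t by rewrite /err subKr.
  rewrite dotpBl; apply: lerD.
    by rewrite step_eta// addrC addKr dotpZr.
  by rewrite -dotpNl -(enormN (err t)); exact: cauchy_schwarz.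
rewrite /Fval /inner_gap; move: h1; rewrite -/(step t); lra.
Qed.

Lemma scaled_descent t : Lt t * step t ^+ 2 <=
  (Fval t - Fval t.+1) + (enorm (err t) * step t + L * step t ^+ 2).
Proof. exact: le_trans (eta_inner_gap t) (eta_decrease t). Qed.

(** The two arguments of the minimum give the two terms: for a full step the inner gap is bounded by
    the decrease, for a shorter one it equals [|v - x| * Lt * step]. *)
Lemma inner_gap_bound t : inner_gap t <= D * (Lt t * step t) +
  ((Fval t - Fval t.+1) + (enorm (err t) * step t + L * step t ^+ 2)).
Proof.
have D0 := diam_ge0 pb (Xx t); have L0 := Lt_gt0 t; have d0 := step_ge0 t.
have ld0 : 0 <= Lt t * step t by rewrite mulr_ge0// ltW.
have hd := eta_decrease t; have h0 := eta_inner_gap t.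
have hn : 0 <= Lt t * step t ^+ 2 by rewrite mulr_ge0 ?sqr_ge0// ltW.
have hD : 0 <= D * (Lt t * step t) by rewrite mulr_ge0.
have [vx|vx] := eqVneq (enorm (v t - x t)) 0.
  by have := inner_gap_le t; rewrite vx mulr0; lra.
have vp : 0 < enorm (v t - x t) by rewrite lt_neqAle eq_sym vx enorm_ge0.
have [e1|e1] := ltP (inner_gap t / (Lt t * enorm (v t - x t) ^+ 2)) 1; last first.
  have et : eta t = 1 by rewrite /eta min_r.
  by move: hd; rewrite et mul1r; lra.
have et : eta t = inner_gap t / (Lt t * enorm (v t - x t) ^+ 2) by rewrite /eta min_l// ltW.
have -> : inner_gap t = enorm (v t - x t) * (Lt t * step t).
  by rewrite stepE et; field; rewrite vx gt_eqF.
have : enorm (v t - x t) * (Lt t * step t) <= D * (Lt t * step t).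
  by rewrite ler_wpM2r// (enorm_diam pb)//; exact: v_feasible.
lra.
Qed.

Definition rgap t : R := fine (FW_gap X f h (x t)).

Lemma rgapE t : (rgap t)%:E = FW_gap X f h (x t).
Proof.
rewrite fineK// ge0_fin_numE ?(FW_gap_ge0 pb bg)//.
exact: le_lt_trans (FW_gap_diam pb bg (Xx t)) (ltry _).
Qed.

Lemma rgap_ge0 t : 0 <= rgap t.
Proof. by rewrite -lee_fin rgapE (FW_gap_ge0 pb bg). Qed.

Lemma rgap_diam t : rgap t <= 2 * G * D.
Proof. by rewrite -lee_fin rgapE (FW_gap_diam pb bg). Qed.

Lemma rgap_le t : rgap t <= D * (Lt t * step t) + D * enorm (err t) +
  ((Fval t - Fval t.+1) + (enorm (err t) * step t + L * step t ^+ 2)).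
Proof.
rewrite -lee_fin rgapE; apply: (FW_gap_le pb bg) => // u Xu.
have h1 := inner_gap_bound t; have h2 := v_argmin t Xu.
have h3 : dotp (- err t) (x t - u) <= D * enorm (err t).
  apply: le_trans (cauchy_schwarz _ _) _.
  by rewrite enormN mulrC ler_wpM2r ?enorm_ge0// (enorm_diam pb).
have h4 : grad f (x t) = g t + - err t by rewrite /err opprB addrC subrK.
rewrite h4 dotpDl; move: h1 h2; rewrite /inner_gap.
have -> : dotp (g t) (v t - x t) = dotp (v t) (g t) - dotp (x t) (g t) by rewrite dotpBr !(dotpC (g t)).
have -> : dotp (g t) (x t - u) = dotp (x t) (g t) - dotp u (g t) by rewrite dotpBr !(dotpC (g t)).
lra.
Qed.

Lemma Fval_le i j : Fval i - Fval j <= 2 * G * D.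
Proof. exact: (objective_lipschitz pb bg). Qed.

(** Each [g t] is a convex combination of its predecessor and a sample, and the squared norm is
    convex. The estimate is crude, but it only has to give polynomial growth of [qsum]. *)
Lemma norm_g_sum t : enorm (g t) ^+ 2 <= \sum_(i < t.+1) enorm (s i) ^+ 2.
Proof.
have conv (a : R) (p q : 'rV[R]_n) : 0 <= a -> a <= 1 ->
    enorm ((1 - a) *: p + a *: q) ^+ 2 <= enorm p ^+ 2 + enorm q ^+ 2.
  move=> a0 a1; apply: le_trans (_ : ((1 - a) * enorm p + a * enorm q) ^+ 2 <= _).
    apply: lerXn2r; rewrite ?nnegrE ?enorm_ge0 ?addr_ge0 ?mulr_ge0 ?enorm_ge0 ?subr_ge0//.
    apply: le_trans (enormD _ _) _; rewrite !enormZ !ger0_norm ?subr_ge0//.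
  have := enorm_ge0 p; have := enorm_ge0 q.
  set P := enorm p; set Q := enorm q => Q0 P0.
  have h1 : (1 - a) * P ^+ 2 <= P ^+ 2 by rewrite ler_piMl ?sqr_ge0//; lra.
  have h2 : a * Q ^+ 2 <= Q ^+ 2 by rewrite ler_piMl ?sqr_ge0.
  have h3 : 0 <= (1 - a) * a * (P - Q) ^+ 2.
    by rewrite mulr_ge0 ?sqr_ge0// mulr_ge0 ?subr_ge0.
  have -> : ((1 - a) * P + a * Q) ^+ 2 = (1 - a) * P ^+ 2 + a * Q ^+ 2 - (1 - a) * a * (P - Q) ^+ 2 by ring.
  lra.
elim: t => [|t ih].
  rewrite (g_def tr) big_ord_recr big_ord0 /=; apply: le_trans (conv _ _ _ (ltW (alpha_gt0 0)) (alpha_le1 0)) _.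
  by rewrite enorm0 expr0n.
rewrite (g_def tr) big_ord_recr /=; apply: le_trans (conv _ _ _ (ltW (alpha_gt0 _)) (alpha_le1 _)) _.
by rewrite lerD2r.
Qed.

Lemma qsum_le t : qsum t <= 1 + t%:R * (2 * G ^+ 2 + 2 * \sum_(i < t) enorm (s i) ^+ 2).
Proof.
rewrite /qsum lerD2l mulr_natl.
have -> (y : R) : y *+ t = \sum_(i < t) y by rewrite sumr_const card_ord.
apply: ler_sum => i _.
have h1 : qstep i <= (G + enorm (g i)) ^+ 2.
  apply: lerXn2r; rewrite ?nnegrE ?addr_ge0 ?enorm_ge0 ?(G_ge0 bg)//.
    by rewrite mulr_ge0 ?step_ge0// ltW// Lt_gt0.
  exact: scaled_step_le.
have h2 : enorm (g i) ^+ 2 <= \sum_(i < t) enorm (s i) ^+ 2.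
  apply: le_trans (norm_g_sum i) _.
  rewrite (big_ord_widen t (fun k => enorm (s k) ^+ 2) (ltn_ord i)).
  by rewrite [leRHS](bigID (fun k : 'I_t => (k < i.+1)%N)) /= lerDl sumr_ge0// => k _; rewrite sqr_ge0.
have : 0 <= (G - enorm (g i)) ^+ 2 by rewrite sqr_ge0.
move: h1; rewrite sqrrB sqrrD !mulr2n; lra.
Qed.

Definition noise t : 'rV[R]_n := s t - grad f (x t).
(** The predictable part of [err t.+1]: it is determined before the sample of step [t.+1] is drawn,
    and what remains is [alpha t.+1] times centred noise. *)
Definition carry t : 'rV[R]_n :=
  (1 - alpha t.+1) *: (err t + (grad f (x t) - grad f (x t.+1))).

Lemma err0 : err 0 = noise 0.
Proof.
have a1 : alpha 0 = 1 by rewrite alphaE qsum0 mulr0 addr0 sqrtr1 invr1.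
by rewrite /err /noise (g_def tr) a1 subrr scaler0 add0r scale1r.
Qed.

Lemma errS t : err t.+1 = carry t + alpha t.+1 *: noise t.+1.
Proof.
rewrite /err (g_def tr) /carry /noise /err addrA subrK.
rewrite !scalerBr scalerBl scalerBl !scale1r; apply/rowP => i; rewrite !mxE; ring.
Qed.

Lemma carry_le t : enorm (carry t) <= (1 - alpha t.+1) * (enorm (err t) + L * step t).
Proof.
have a1 := alpha_le1 t.+1.
rewrite /carry enormZ ger0_norm ?subr_ge0// ler_wpM2l ?subr_ge0//.
apply: le_trans (enormD _ _) _; rewrite lerD2l.
by have [_ H] := sm; rewrite /step enormC; apply: le_trans (H _ _ (Xx _) (Xx _)) _; rewrite enormC.
Qed.

End Trajectory.

(** * Random trajectories *)

Section MeasurableRows.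
Context {R : realType} {n : nat} {d : measure_display} {T : measurableType d}.
Implicit Types (f k : T -> R) (y z : T -> 'rV[R]_n).

Definition measurable_rows y := forall i, measurable_fun setT (fun w => y w 0 i).

Lemma measurable_sqrt f : measurable_fun setT f ->
  measurable_fun setT (fun w => Num.sqrt (f w)).
Proof.
move=> mf; apply: (measurableT_comp _ mf); apply: continuous_measurable_fun.
exact: sqrt_continuous.
Qed.

(** Through [1 / y = y * exp (- ln (y^2))], which also holds at 0, where both sides vanish. *)
Lemma measurable_inv f : measurable_fun setT f -> measurable_fun setT (fun w => (f w)^-1).
Proof.
move=> mf; rewrite (_ : (fun w => _) = fun w => f w * expR (- ln (f w ^+ 2))).
  apply: measurable_funM => //; apply: measurableT_comp => //.
  apply: measurableT_comp; first exact: oppr_measurable.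
  by apply: measurableT_comp => //; exact: measurable_funX.
apply/funext => w; have [->|f0] := eqVneq (f w) 0; first by rewrite invr0 mul0r.
by rewrite expRN lnK ?posrE ?exprn_even_gt0// expr2 invfM mulrA mulfV// mul1r.
Qed.

Lemma measurable_dotp y z : measurable_rows y -> measurable_rows z ->
  measurable_fun setT (fun w => dotp (y w) (z w)).
Proof. by move=> my mz; apply: measurable_sum => i; exact: measurable_funM. Qed.

Lemma measurable_enorm y : measurable_rows y -> measurable_fun setT (fun w => enorm (y w)).
Proof. by move=> my; apply: measurable_sqrt; exact: measurable_dotp. Qed.

Lemma measurable_rowsD y z : measurable_rows y -> measurable_rows z ->
  measurable_rows (fun w => y w + z w).
Proof. by move=> my mz i; under eq_fun do rewrite mxE; exact: measurable_funD. Qed.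

Lemma measurable_rowsZ f y : measurable_fun setT f -> measurable_rows y ->
  measurable_rows (fun w => f w *: y w).
Proof. by move=> mf my i; under eq_fun do rewrite mxE; exact: measurable_funM. Qed.

Lemma measurable_rowsB y z : measurable_rows y -> measurable_rows z ->
  measurable_rows (fun w => y w - z w).
Proof. by move=> my mz i; under eq_fun do rewrite !mxE; exact: measurable_funB. Qed.

Lemma measurable_continuous_rows (u : 'rV[R]_n -> R) y :
  continuous u -> measurable_rows y -> measurable_fun setT (fun w => u (y w)).
Proof.
move=> cu my.
have H := @measurable_caratheodory R n _ _ T T y id my (@measurable_id _ _ _) (fun b _ => u b).
by apply: H => [_|y0]; [exact: cu|exact: measurable_cst].
Qed.

End MeasurableRows.

Section StochasticTrajectory.
Context {R : realType} {n : nat} {d d' : measure_display}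
  {Omega : measurableType d} {Xi : measurableType d'}.
Variables (P : probability Omega R) (mu : probability Xi R)
  (X : set 'rV[R]_n) (fs : 'rV[R]_n -> Xi -> R) (f : 'rV[R]_n -> R)
  (h : 'rV[R]_n -> \bar R) (xstar : 'rV[R]_n)
  (L G sigma rho beta : R) (x0 : 'rV[R]_n) (xi : nat -> Omega -> Xi)
  (x g v : nat -> Omega -> 'rV[R]_n) (alpha Lt : nat -> Omega -> R).
Hypotheses (pb : composite_problem X f h xstar)
  (so : stochastic_oracle mu X fs f sigma)
  (bg : bounded_gradients X f h G) (sm : smooth_on X f L)
  (rho0 : 0 < rho) (beta0 : 0 <= beta) (Xx0 : X x0)
  (fr : fresh_samples P mu xi v)
  (tr : forall w : Omega,
     alfcg_mvr1 X h rho beta x0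
       (fun t => grad (fs ^~ (xi t w)) (x t w))
       (x ^~ w) (g ^~ w) (v ^~ w) (alpha ^~ w) (Lt ^~ w)).

Definition past_gen (t : nat) : set (set Omega) :=
  \bigcup_(i in `I_t)
        (preimage_set_system setT (xi i) measurable `|`
         \bigcup_(j in [set: 'I_n])
           preimage_set_system setT (fun w => v i w 0 j) measurable).

Definition past_type t : measurableType _ := g_sigma_algebraType (past_gen t).

Lemma past_measurable t : <<s past_gen t >> `<=` measurable.
Proof.
apply: smallest_sub; first exact: sigma_algebra_measurable.
move=> _ [i _ [[B mB <-]|[j _ [B mB <-]]]].
  exact: (xi_measurable fr i).
exact: (v_measurable fr i j).
Qed.

Lemma past_le t t' d3 (Y : measurableType d3) (k : Omega -> Y) : (t <= t')%N ->
  measurable_fun (T := past_type t) setT k -> measurable_fun (T := past_type t') setT k.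
Proof.
move=> tt mk _ B mB; have := mk measurableT B mB.
apply: smallest_sub; first exact: smallest_sigma_algebra.
move=> A [i /= it pA]; apply: sub_gen_smallest; exists i => //=.
exact: leq_trans it tt.
Qed.

Lemma past_xi i t : (i < t)%N -> measurable_fun (T := past_type t) setT (xi i).
Proof.
move=> it _ B mB; apply: sub_gen_smallest; exists i => //; left.
by exists B.
Qed.

Lemma past_v i t : (i < t)%N -> measurable_rows (T := past_type t) (v i).
Proof.
move=> it j _ B mB; apply: sub_gen_smallest; exists i => //; right.
by exists j => //; exists B.
Qed.

Lemma past_rows_le t t' (k : Omega -> 'rV[R]_n) : (t <= t')%N ->
  measurable_rows (T := past_type t) k -> measurable_rows (T := past_type t') k.
Proof. by move=> tt mk i; exact: past_le tt (mk i). Qed.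

Lemma fs_measurable y : measurable_fun setT (fs y).
Proof. exact/measurable_EFinP/measurable_int/(fs_integrable so y). Qed.

Lemma measurable_grad_f d3 (T : measurableType d3) (y : T -> 'rV[R]_n) :
  measurable_rows y -> measurable_rows (fun w => grad f (y w)).
Proof.
move=> my i.
have H := @measurable_grad R n _ _ T T y id my (@measurable_id _ _ _) (fun b _ => f b) i.
by apply: H => [_|b]; [exact: (f_differentiable pb)|exact: measurable_cst].
Qed.

Lemma measurable_grad_fs d3 (T : measurableType d3) (y : T -> 'rV[R]_n) (z : T -> Xi) :
  measurable_rows y -> measurable_fun setT z ->
  measurable_rows (fun w => grad (fs ^~ (z w)) (y w)).
Proof.
move=> my mz i; apply: measurable_grad => //; first exact: (fs_differentiable so).
exact: fs_measurable.
Qed.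

Definition sgrad t w := grad (fs ^~ (xi t w)) (x t w).

Lemma past_alpha_Lt t :
  (forall i, (i <= t)%N -> measurable_rows (T := past_type t) (x i)) ->
  (forall i, (i < t)%N -> measurable_fun (T := past_type t) setT (Lt i)) ->
  measurable_fun (T := past_type t) setT (alpha t) /\
  measurable_fun (T := past_type t) setT (Lt t).
Proof.
move=> mx mL.
have mq (i : 'I_t) : measurable_fun (T := past_type t) setT
    (fun w => Lt i w ^+ 2 * enorm (x i.+1 w - x i w) ^+ 2).
  apply: measurable_funM; apply: measurable_funX; first exact: mL.
  by apply: measurable_enorm; apply: measurable_rowsB; apply: mx => //; exact: ltnW.
have ma : measurable_fun (T := past_type t) setT (alpha t).
  rewrite (_ : alpha t = fun w => (Num.sqrt (1 + \sum_(i < t)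
       (beta + Lt i w ^+ 2 * enorm (x i.+1 w - x i w) ^+ 2)))^-1); last first.
    by apply/funext => w; exact: (alpha_def (tr w)).
  apply: measurable_inv; apply: measurable_sqrt; apply: measurable_funD => //.
  by apply: measurable_sum => i; apply: measurable_funD.
split => //.
rewrite (_ : Lt t = fun w => rho * Num.sqrt (1 + \sum_(i < t) Lt i w ^+ 2 * enorm (x i.+1 w - x i w) ^+ 2)
      * (Num.sqrt (alpha t w))^-1); last first.
  by apply/funext => w; exact: (Lt_def (tr w)).
apply: measurable_funM; last by apply: measurable_inv; exact: measurable_sqrt.
apply: measurable_funM => //; apply: measurable_sqrt; apply: measurable_funD => //.
exact: measurable_sum.
Qed.

(** The point [x t] is determined before the sample of step [t], the estimate [g t] only with it.
    The strict bound for [Lt] carries the induction; [past_alpha_Lt] then adds [alpha t] and [Lt t]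
    themselves. *)
Lemma past_state t :
  [/\ forall i, (i <= t)%N -> measurable_rows (T := past_type t) (x i),
      forall i, (i < t)%N -> measurable_rows (T := past_type t) (g i) &
      forall i, (i < t)%N -> measurable_fun (T := past_type t) setT (Lt i)].
Proof.
elim: t => [|t [mx mg mL]].
  split=> // i; rewrite leqn0 => /eqP -> j.
  rewrite (_ : (fun _ => _) = cst (x0 0 j)); first exact: measurable_cst.
  by apply/funext => w; rewrite (x_init (tr w)).
have [ma mLt] := past_alpha_Lt mx mL.
have mx' i : (i <= t)%N -> measurable_rows (T := past_type t.+1) (x i).
  by move=> it; apply: (past_rows_le (leqnSn t)); exact: mx.
have mL' i : (i < t.+1)%N -> measurable_fun (T := past_type t.+1) setT (Lt i).
  rewrite ltnS leq_eqVlt => /predU1P[->|it]; apply: (past_le (leqnSn t)) => //.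
  exact: mL.
have mg' i : (i < t.+1)%N -> measurable_rows (T := past_type t.+1) (g i).
  rewrite ltnS leq_eqVlt => /predU1P[->|it]; last first.
    by apply: (past_rows_le (leqnSn t)); exact: mg.
  rewrite (_ : g t = fun w => (1 - alpha t w) *: (if t is t'.+1 then g t' w else 0)
     + alpha t w *: sgrad t w); last by apply/funext => w; exact: (g_def (tr w)).
  have ma' := past_le (leqnSn t) ma.
  apply: measurable_rowsD; apply: measurable_rowsZ => //.
  - by apply: measurable_funB.
  - case: (t) mg => [_ j|t' mg].
      by under eq_fun do rewrite mxE; exact: measurable_cst.
    apply: (@past_rows_le t'.+1); first exact: leqnSn.
    exact: mg.
  - apply: measurable_grad_fs; first exact: mx'.
    exact: past_xi.
split => // i; rewrite leq_eqVlt => /predU1P[->|]; last by rewrite ltnS; exact: mx'.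
have [H [cH HX]] := h_extension pb bg Xx0.
have mxt := mx' t (leqnn t).
have mv := past_v (ltnSn t).
rewrite (_ : x t.+1 = fun w => x t w + Num.min
   ((H (x t w) - H (v t w) - dotp (g t w) (v t w - x t w)) / (Lt t w * enorm (v t w - x t w) ^+ 2)) 1
   *: (v t w - x t w)); last first.
  apply/funext => w; rewrite (step_eta pb bg (tr w)); last exact: (x_feasible pb bg rho0 beta0 Xx0 (tr w)).
  rewrite /eta /inner_gap !HX//; last exact: (x_feasible pb bg rho0 beta0 Xx0 (tr w)).
  exact: (v_feasible (tr w)).
have mvx : measurable_rows (T := past_type t.+1) (fun w => v t w - x t w).
  exact: measurable_rowsB.
apply: measurable_rowsD => //; apply: measurable_rowsZ => //.
apply: measurable_minr => //; apply: measurable_funM.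
  apply: measurable_funB; last by apply: measurable_dotp => //; exact: mg'.
  by apply: measurable_funB; apply: measurable_continuous_rows.
apply: measurable_inv; apply: measurable_funM; first exact: mL'.
by apply: measurable_funX; exact: measurable_enorm.
Qed.

Lemma past_x i t : (i <= t)%N -> measurable_rows (T := past_type t) (x i).
Proof. by have [H _ _] := past_state t; exact: H. Qed.

Lemma past_g i t : (i < t)%N -> measurable_rows (T := past_type t) (g i).
Proof. by have [_ H _] := past_state t; exact: H. Qed.

Lemma past_alpha i t : (i <= t)%N -> measurable_fun (T := past_type t) setT (alpha i).
Proof.
move=> it; apply: (past_le it).
by have [mx _ mL] := past_state i; have [] := past_alpha_Lt mx mL.
Qed.

Lemma past_Lt i t : (i <= t)%N -> measurable_fun (T := past_type t) setT (Lt i).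
Proof.
move=> it; apply: (past_le it).
by have [mx _ mL] := past_state i; have [] := past_alpha_Lt mx mL.
Qed.

Lemma measurable_grad_fs_at y : measurable_rows (fun z : Xi => grad (fs ^~ z) y).
Proof.
by apply: (@measurable_grad_fs _ Xi (cst y) id) => // i; exact: measurable_cst.
Qed.

(** Expand the square: the cross term integrates to 0 by unbiasedness of each coordinate, and the
    last term is the variance. *)
Lemma oracle_second_moment y (b : 'rV[R]_n) (a : R) : X y ->
  (\int[mu]_z (enorm (b + a *: (grad (fs ^~ z) y - grad f y)) ^+ 2)%:E <=
   (enorm b ^+ 2 + a ^+ 2 * sigma ^+ 2)%:E)%E.
Proof.
move=> Xy.
have cE (c : R) : (\int[mu]_z c%:E = c%:E)%E.
  by have := @expectation_cst _ _ _ mu c; rewrite unlock.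
pose eps z := grad (fs ^~ z) y - grad f y.
have meps : measurable_rows eps.
  apply: measurable_rowsB; first exact: measurable_grad_fs_at.
  by move=> i; exact: measurable_cst.
have ieps i : mu.-integrable setT (fun z => (eps z 0 i)%:E).
  rewrite (_ : (fun z => _) = (fun z => (grad (fs ^~ z) y 0 i)%:E) \- (cst (grad f y 0 i)%:E))%E.
    apply: integrableB => //; first exact: (oracle_integrable so).
    exact: finite_measure_integrable_cst.
  by apply/funext => z; rewrite /eps !mxE.
have Eeps i : (\int[mu]_z (eps z 0 i)%:E = 0)%E.
  have := oracle_unbiased so i Xy; rewrite unlock => h1.
  transitivity (\int[mu]_z ((grad (fs ^~ z) y 0 i)%:E - (grad f y 0 i)%:E))%E.
    by apply: eq_integral => z _; rewrite /eps !mxE.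
  rewrite integralB//; first last.
  - exact: finite_measure_integrable_cst.
  - exact: (oracle_integrable so).
  by rewrite h1 cE subee.
have dotE (c : 'rV[R]_n) z : (dotp c (eps z))%:E = (\sum_(i < n) (c 0 i)%:E * (eps z 0 i)%:E)%E.
  by rewrite sumEFin.
have idot c : mu.-integrable setT (fun z => (dotp c (eps z))%:E).
  under eq_fun do rewrite dotE.
  apply: integrable_sum => // i _; exact: integrableZl.
have Edot c : (\int[mu]_z (dotp c (eps z))%:E = 0)%E.
  under eq_integral do rewrite dotE.
  rewrite integral_sum//; last by move=> i; exact: integrableZl.
  by rewrite big1// => i _; rewrite integralZl// Eeps mule0.
have var := oracle_variance so Xy.
rewrite unlock in var.
have ivar : mu.-integrable setT (fun z => (enorm (eps z) ^+ 2)%:E).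
  apply/integrableP; split.
    by apply/measurable_EFinP; apply: measurable_funX; exact: measurable_enorm.
  apply: le_lt_trans (ltry (sigma ^+ 2)); apply: le_trans var.
  apply: le_lower_integral => z; first exact: abse_ge0.
  by rewrite /= ger0_norm ?sqr_ge0.
have -> : (\int[mu]_z (enorm (b + a *: eps z) ^+ 2)%:E =
   \int[mu]_z ((enorm b ^+ 2)%:E + ((2 * a)%:E * (dotp b (eps z))%:E + (a ^+ 2)%:E * (enorm (eps z) ^+ 2)%:E)))%E.
  apply: eq_integral => z _; rewrite enorm_sqrD dotpZr enormZ exprMn real_normK ?num_real//.
  by rewrite -!EFinM -!EFinD; congr EFin; ring.
rewrite integralD//; first last.
- by apply: integrableD => //; exact: integrableZl.
- exact: finite_measure_integrable_cst.
rewrite integralD//; [|exact: integrableZl|exact: integrableZl].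
rewrite cE integralZl// Edot mule0 add0e integralZl//.
rewrite EFinD; apply: leeD2l; rewrite [leRHS]EFinM; apply: lee_wpmul2l => //.
by rewrite lee_fin sqr_ge0.
Qed.

(* Given the past, the iterate is frozen and the fresh noise is centred with variance [sigma ^+ 2]. *)
Lemma conditional_second_moment t (W al : Omega -> R) (b : Omega -> 'rV[R]_n) :
  measurable_fun (T := past_type t) setT W -> measurable_fun (T := past_type t) setT al ->
  measurable_rows (T := past_type t) b -> (forall w, 0 <= W w) ->
  (\int[P]_w (W w * enorm (b w + al w *: (sgrad t w - grad f (x t w))) ^+ 2)%:E <=
   \int[P]_w (W w * (enorm (b w) ^+ 2 + al w ^+ 2 * sigma ^+ 2))%:E)%E.
Proof.
move=> mW mal mb W0.
pose psi (p : past_type t * Xi) : \bar R :=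
  (W p.1 * enorm (b p.1 + al p.1 *: (grad (fs ^~ p.2) (x t p.1) - grad f (x t p.1))) ^+ 2)%:E.
have mpsi : measurable_fun setT psi.
  have m1 : measurable_fun setT (fst : past_type t * Xi -> past_type t) by exact: measurable_fst.
  have mx1 : measurable_rows (fun p : past_type t * Xi => x t p.1).
    by move=> i; exact: (measurableT_comp (past_x (leqnn t) i) m1).
  apply/measurable_EFinP; apply: measurable_funM; first exact: measurableT_comp mW m1.
  apply: measurable_funX; apply: measurable_enorm; apply: measurable_rowsD.
    by move=> i; exact: (measurableT_comp (mb i) m1).
  apply: measurable_rowsZ; first exact: measurableT_comp mal m1.
  apply: measurable_rowsB; last exact: measurable_grad_f.
  by apply: measurable_grad_fs => //; exact: measurable_snd.
have psi0 p : (0 <= psi p)%E by rewrite lee_fin mulr_ge0 ?sqr_ge0.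
have fz := @freezing R _ _ Omega Xi P mu (past_gen t) (xi t) (@past_measurable t)
  (xi_measurable fr t) (fun B mB => xi_law fr t mB) (fun A B pA mB => xi_independent fr pA mB) psi mpsi psi0.
have -> : (\int[P]_w (W w * enorm (b w + al w *: (sgrad t w - grad f (x t w))) ^+ 2)%:E =
  \int[P]_w psi (w, xi t w))%E by [].
rewrite fz; apply: le_lower_integral => w; first by apply: integral_ge0 => z _; exact: psi0.
rewrite /psi /=.
under eq_integral do rewrite EFinM.
rewrite ge0_integralZl_EFin//; first last.
- apply/measurable_EFinP; apply: measurable_funX; apply: measurable_enorm.
  apply: measurable_rowsD; first by move=> i; exact: measurable_cst.
  apply: measurable_rowsZ; first exact: measurable_cst.
  apply: measurable_rowsB; first exact: measurable_grad_fs_at.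
  by move=> i; exact: measurable_cst.
- by move=> z _; rewrite lee_fin sqr_ge0.
rewrite EFinM lee_wpmul2l ?lee_fin//; apply: oracle_second_moment.
exact: (x_feasible pb bg rho0 beta0 Xx0 (tr w)).
Qed.

End StochasticTrajectory.

(** Each term is [1/nu] times a relative increment of [1 + beta t], so the sum is logarithmic. The
    choice [beta = nu * sigma^2] makes the factor in front free of [sigma]. *)
Lemma sum_noise_le (R : realType) (K nu sigma : R) (T : nat) :
  0 < nu -> nu^-1 <= K -> 
  \sum_(t < T) sigma ^+ 2 / (1 + nu * sigma ^+ 2 * t.+1%:R)
    <= K * ln (1 + nu * sigma ^+ 2 * T%:R).
Proof.
move=> nu0 nuK; set b := nu * sigma ^+ 2.
have b0 : 0 <= b by rewrite mulr_ge0 ?sqr_ge0// ltW.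
have p1 k : 1 <= 1 + b * k%:R by rewrite lerDl mulr_ge0.
have p0 k : 0 < 1 + b * k%:R by exact: lt_le_trans ltr01 (p1 k).
elim: T => [|T ih]; first by rewrite big_ord0 mulr0 addr0 ln1 mulr0.
rewrite big_ord_recr /=.
have h : sigma ^+ 2 / (1 + b * T.+1%:R) <= nu^-1 * (ln (1 + b * T.+1%:R) - ln (1 + b * T%:R)).
  have -> : sigma ^+ 2 / (1 + b * T.+1%:R) = nu^-1 * ((1 + b * T.+1%:R - (1 + b * T%:R)) / (1 + b * T.+1%:R)).
    have -> : 1 + b * T.+1%:R - (1 + b * T%:R) = nu * sigma ^+ 2 by rewrite -natr1 -/b; ring.
    by rewrite !mulrA mulVf ?gt_eqF// mul1r.
  by rewrite ler_wpM2l ?invr_ge0 ?(ltW nu0)//; exact: ln_sub_ge.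
have : nu^-1 * (ln (1 + b * T.+1%:R) - ln (1 + b * T%:R)) <= K * (ln (1 + b * T.+1%:R) - ln (1 + b * T%:R)).
  rewrite ler_wpM2r// subr_ge0 ler_ln ?posrE// lerD2l ler_wpM2l// ler_nat//.
by lra.
Qed.

(** * The potential and the gap sum in expectation *)

Section ExpectedPotential.
Context {R : realType} {n : nat} {d d' : measure_display}
  {Omega : measurableType d} {Xi : measurableType d'}.
Variables (P : probability Omega R) (mu : probability Xi R)
  (X : set 'rV[R]_n) (fs : 'rV[R]_n -> Xi -> R) (f : 'rV[R]_n -> R)
  (h : 'rV[R]_n -> \bar R) (xstar : 'rV[R]_n)
  (L G sigma rho beta : R) (x0 : 'rV[R]_n) (xi : nat -> Omega -> Xi)
  (x g v : nat -> Omega -> 'rV[R]_n) (alpha Lt : nat -> Omega -> R).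
Hypotheses (pb : composite_problem X f h xstar)
  (so : stochastic_oracle mu X fs f sigma)
  (bg : bounded_gradients X f h G) (sm : smooth_on X f L)
  (rho0 : 0 < rho) (beta0 : 0 <= beta) (Xx0 : X x0)
  (fr : fresh_samples P mu xi v)
  (tr : forall w : Omega,
     alfcg_mvr1 X h rho beta x0
       (fun t => grad (fs ^~ (xi t w)) (x t w))
       (x ^~ w) (g ^~ w) (v ^~ w) (alpha ^~ w) (Lt ^~ w)).
Variables (K Theta ell nu : R).
Hypotheses (K1 : 1 <= K) (DK : diam X <= K) (GK : G <= K) (LK : L <= K)
  (rhoK : rho <= K) (irhoK : rho^-1 <= K) (betaK : beta <= K ^+ 3) (sigmaK : sigma <= K)
  (Theta0 : 0 < Theta) (ellE : ell = ln Theta) (ell1 : 1 <= ell)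
  (nu0 : 0 < nu) (nuK : nu^-1 <= K) (betaE : beta = nu * sigma ^+ 2).
Local Notation D := (diam X).

Let S (w : Omega) := qsum (x ^~ w) (Lt ^~ w).
Let q (w : Omega) := qstep (x ^~ w) (Lt ^~ w).
Let st (w : Omega) := step (x ^~ w).
Let a (w : Omega) t : R := (alpha t w)^-1.
Let E (w : Omega) t : R := enorm (err f (x ^~ w) (g ^~ w) t).
Let wt t (w : Omega) : R := weight (S w) Theta ell t.
Let lv t (w : Omega) : R := (live (S w) Theta t)%:R.
Let Zt t (w : Omega) : R := lv t w * damping (S w) (q w) (a w) ell t * E w t ^+ 2.
Let Rt t (w : Omega) : R := lv t w * relinc (S w) (q w) t.

Let S_0 w : S w 0 = 1. Proof. exact: qsum0. Qed.
Let S_S w t : S w t.+1 = S w t + q w t. Proof. exact: qsumS. Qed.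
Let qE w t : q w t = (Lt t w * st w t) ^+ 2. Proof. by []. Qed.
Let a_ge0 w t : 0 <= a w t.
Proof. exact: le_trans ler01 (alphaV_ge1 beta0 (tr w) t). Qed.
Let a_sqr w t : a w t ^+ 2 = S w t + beta * t%:R.
Proof. exact: (alphaV_sqr beta0 (tr w)). Qed.
Let lE w t : Lt t w = rho * Num.sqrt (S w t) * Num.sqrt (a w t).
Proof. exact: (LtE beta0 (tr w)). Qed.
Let st_ge0 w t : 0 <= st w t. Proof. exact: step_ge0. Qed.
Let st_le w t : st w t <= D. Proof. exact: (step_diam pb bg rho0 beta0 Xx0 (tr w)). Qed.
Let E_ge0 w t : 0 <= E w t. Proof. exact: enorm_ge0. Qed.

Let ell0 : 0 < ell. Proof. exact: lt_le_trans ltr01 ell1. Qed.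
Let K0 : 0 <= K. Proof. exact: le_trans ler01 K1. Qed.
Let cR0 : 0 <= cR K.
Proof. by rewrite /cR addr_ge0// mulr_ge0 ?cY_ge0 ?exprn_ge0// mulr_ge0// exprn_ge0. Qed.

Let wt_ge0 t w : 0 <= wt t w.
Proof. exact: (weight_ge0 (S_0 w) (S_S w) (qE w)). Qed.

Let wt_le2 t w : wt t w <= 2.
Proof.
apply: le_trans (weight_le (S_0 w) (S_S w) (qE w) Theta ell1 t) _.
by case: (live _ _ _); rewrite ?mulr1// mulr0.
Qed.

Let Zt_ge0 t w : 0 <= Zt t w.
Proof.
by rewrite /Zt mulr_ge0 ?sqr_ge0// mulr_ge0 ?ler0n// (damping_ge0 _ _ (a_ge0 w)).
Qed.

Let pot_step t w : wt t.+1 w * enorm (carry f (x ^~ w) (g ^~ w) (alpha ^~ w) t) ^+ 2 + Zt t w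
  <= wt t w * E w t ^+ 2 + cR K * ell * Rt t w.
Proof.
have := potential_step K1 DK (L_ge0 sm) LK rho0 irhoK beta0 betaK (S_0 w) (S_S w) (qE w)
  (a_ge0 w) (a_sqr w) (lE w) (st_ge0 w) (st_le w) (E_ge0 w) Theta0 ellE ell1 t.
apply: le_trans; rewrite lerD2r ler_wpM2l ?wt_ge0//.
have a1 := alpha_le1 beta0 (tr w) t.+1.
apply: lerXn2r; rewrite ?nnegrE ?enorm_ge0//.
  rewrite /a invrK mulr_ge0 ?subr_ge0// addr_ge0 ?E_ge0// mulr_ge0 ?st_ge0//.
  exact: L_ge0 sm.
by rewrite /a invrK; exact: (carry_le pb bg sm rho0 beta0 Xx0 (tr w)).
Qed.

Let Cpot : R := cR K * ell * (ell + 1).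
(** The accumulated damping plus the unspent part of the budget for relative increments. The budget
    covers every possible sum of them, so [M] is nonnegative and only integrals of nonnegative
    functions occur. *)
Let M N (w : Omega) : R := \sum_(t < N) Zt t w + (Cpot - cR K * ell * \sum_(t < N) Rt t w).

Let M_ge0 N w : 0 <= M N w.
Proof.
rewrite addr_ge0 ?sumr_ge0// subr_ge0 ler_wpM2l ?mulr_ge0 ?(ltW ell0)//.
exact: (sum_live_relinc (S_0 w) (S_S w) (qE w) Theta0 ellE ell1).
Qed.

Let past_x' i t : (i <= t)%N -> measurable_rows (T := past_type xi v t) (x i).
Proof. exact: (past_x pb so bg rho0 beta0 Xx0 tr). Qed.

Let past_Lt' i t : (i <= t)%N -> measurable_fun (T := past_type xi v t) setT (Lt i).
Proof. exact: (past_Lt pb so bg rho0 beta0 Xx0 tr). Qed.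

Let past_al i t : (i <= t)%N -> measurable_fun (T := past_type xi v t) setT (alpha i).
Proof. exact: (past_alpha pb so bg rho0 beta0 Xx0 tr). Qed.

Let past_q i t : (i < t)%N -> measurable_fun (T := past_type xi v t) setT (fun w => q w i).
Proof.
move=> it; apply: measurable_funX; apply: measurable_funM; first exact: past_Lt' (ltnW it).
by apply: measurable_enorm; apply: measurable_rowsB; apply: past_x' => //; exact: ltnW.
Qed.

Let past_S i t : (i <= t)%N -> measurable_fun (T := past_type xi v t) setT (fun w => S w i).
Proof.
move=> it; apply: measurable_funD => //; apply: measurable_sum => j; apply: past_q.
exact: leq_trans it.
Qed.

Let past_err i t : (i < t)%N -> measurable_rows (T := past_type xi v t) (fun w => err f (x ^~ w) (g ^~ w) i).
Proof.
move=> it; apply: measurable_rowsB.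
  exact: (past_g pb so bg rho0 beta0 Xx0 tr).
by apply: (measurable_grad_f pb); exact: past_x' (ltnW it).
Qed.

Let past_live i t : (i <= t)%N -> measurable_fun (T := past_type xi v t) setT (fun w => live (S w) Theta i).
Proof. by move=> it; apply: measurable_fun_ler => //; exact: past_S. Qed.

Let past_lv i t : (i <= t)%N -> measurable_fun (T := past_type xi v t) setT (lv i).
Proof.
move=> it; rewrite (_ : lv i = fun w => if live (S w) Theta i then 1 else 0).
  by apply: measurable_fun_ifT => //; exact: past_live.
by apply/funext => w; rewrite /lv; case: live.
Qed.

Let past_wt i t : (i <= t)%N -> measurable_fun (T := past_type xi v t) setT (wt i).
Proof.
move=> it; apply: measurable_fun_ifT => //; first exact: past_live.
apply: measurable_funB => //; apply: measurable_funM => //.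
by apply: measurableT_comp => //; exact: past_S.
Qed.

Let past_Rt i t : (i < t)%N -> measurable_fun (T := past_type xi v t) setT (Rt i).
Proof.
move=> it; apply: measurable_funM; first exact: past_lv (ltnW it).
apply: measurable_funM; first exact: past_q.
by apply: measurable_inv; exact: past_S.
Qed.

Let past_Zt i t : (i < t)%N -> measurable_fun (T := past_type xi v t) setT (Zt i).
Proof.
move=> it; apply: measurable_funM; last first.
  by apply: measurable_funX; apply: measurable_enorm; exact: past_err.
apply: measurable_funM; first exact: past_lv (ltnW it).
apply: measurable_funD; first by do 2 apply: measurable_inv; exact: past_al.
apply: measurable_funM => //.
rewrite (_ : (fun w => _) = fun w => if jump (S w) (q w) i then 1 else 0).
  apply: measurable_fun_ifT => //; apply: measurable_fun_ltr; last exact: past_q.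
  by apply: measurable_funM => //; exact: past_S (ltnW it).
by apply/funext => w; case: jump.
Qed.

Let past_M N : measurable_fun (T := past_type xi v N) setT (M N).
Proof.
apply: measurable_funD; first by apply: measurable_sum => i; exact: past_Zt.
apply: measurable_funB => //; apply: measurable_funM => //.
by apply: measurable_sum => i; exact: past_Rt.
Qed.

Let coarser t d3 (Y : measurableType d3) (k : Omega -> Y) :
  measurable_fun (T := past_type xi v t) setT k -> measurable_fun setT k.
Proof. exact: (measurable_coarser (past_measurable fr (t := t))). Qed.

Let A N (w : Omega) : R := wt N w * E w N ^+ 2.

Let mA N : measurable_fun setT (A N).
Proof.
apply: measurable_funM; first exact: (coarser (past_wt (leqnn N))).
apply: measurable_funX; apply: measurable_enorm => i.
exact: (coarser (past_err (ltnSn N) i)).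
Qed.

Let mM N : measurable_fun setT (M N).
Proof. exact: (coarser (@past_M N)). Qed.

Lemma expected_noise t :
  (\int[P]_w (enorm (sgrad fs xi x t w) ^+ 2)%:E <= (G ^+ 2 + sigma ^+ 2)%:E)%E.
Proof.
have mb : measurable_rows (T := past_type xi v t) (fun w => grad f (x t w)).
  by apply: (measurable_grad_f pb); exact: past_x'.
have := @conditional_second_moment R n d d' Omega Xi P mu X fs f h xstar G sigma rho beta x0 xi x g v alpha Lt
  pb so bg rho0 beta0 Xx0 fr tr t (cst 1) (cst 1) (fun w => grad f (x t w))
  (measurable_cst _) (measurable_cst _) mb (fun _ => ler01).
rewrite (_ : (\int[P]_w (cst 1 w * _)%:E)%E = (\int[P]_w (enorm (sgrad fs xi x t w) ^+ 2)%:E)%E); last first.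
  by apply: eq_integral => w _; rewrite /= mul1r scale1r addrC subrK.
move/le_trans; apply.
rewrite -[leRHS](@expectation_cst _ _ _ P) unlock; apply: le_lower_integral => w /=.
  by rewrite lee_fin mul1r addr_ge0 ?sqr_ge0// mulr_ge0 ?sqr_ge0.
rewrite lee_fin mul1r expr1n mul1r lerD2r; apply: lerXn2r; rewrite ?nnegrE ?enorm_ge0 ?(G_ge0 bg)//.
by apply: (grad_bound bg); exact: (x_feasible pb bg rho0 beta0 Xx0 (tr w)).
Qed.

Let Psi N := (\int[P]_w (A N w + M N w)%:E)%E.

Let PsiE N : Psi N = (\int[P]_w (A N w)%:E + \int[P]_w (M N w)%:E)%E.
Proof.
rewrite /Psi; under eq_integral do rewrite EFinD.
rewrite ge0_integralD//.
- by move=> w _; rewrite lee_fin mulr_ge0 ?sqr_ge0.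
- exact/measurable_EFinP.
- by move=> w _; rewrite lee_fin.
- exact/measurable_EFinP.
Qed.

Let Psi0 : (Psi 0 <= (2 * sigma ^+ 2 + Cpot)%:E)%E.
Proof.
have mb : measurable_rows (T := past_type xi v 0) (fun=> (0 : 'rV[R]_n)).
  by move=> i; exact: measurable_cst.
have h0 := @conditional_second_moment R n d d' Omega Xi P mu X fs f h xstar G sigma rho beta x0 xi x g v alpha Lt
  pb so bg rho0 beta0 Xx0 fr tr 0 (wt 0) (cst 1) (fun=> 0)
  (past_wt (leqnn 0)) (measurable_cst _) mb (wt_ge0 0).
rewrite PsiE EFinD; apply: leeD; last first.
  rewrite -[leRHS](@expectation_cst _ _ _ P) unlock; apply: le_lower_integral => w.
    by rewrite lee_fin M_ge0.
  by rewrite /M !big_ord0 mulr0 subr0 add0r.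
rewrite (_ : (\int[P]_w (A 0 w)%:E)%E = (\int[P]_w (wt 0 w *
   enorm (0 + cst 1 w *: (sgrad fs xi x 0 w - grad f (x 0%N w))) ^+ 2)%:E)%E); last first.
  by apply: eq_integral => w _; rewrite /A /E (err0 f (tr w)) /noise /= scale1r add0r.
apply: le_trans h0 _.
rewrite -[leRHS](@expectation_cst _ _ _ P) unlock; apply: le_lower_integral => w /=.
  rewrite lee_fin; apply: mulr_ge0; first exact: wt_ge0.
  by apply: addr_ge0; [exact: sqr_ge0|apply: mulr_ge0; exact: sqr_ge0].
rewrite lee_fin enorm0 expr0n expr1n mul1r add0r.
by apply: ler_wpM2r; [exact: sqr_ge0|exact: wt_le2].
Qed.

Let nz t : R := sigma ^+ 2 / (1 + beta * t.+1%:R).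

Let nz_ge0 t : 0 <= nz t.
Proof. by rewrite divr_ge0 ?sqr_ge0// addr_ge0// mulr_ge0. Qed.

(** The weight, [alpha] and the carried error of step [N.+1] all belong to its past, so the
    conditional second moment applies; the pathwise decrease of the potential does the rest. *)
Let PsiS N : (Psi N.+1 <= Psi N + (2 * nz N)%:E)%E.
Proof.
have mb : measurable_rows (T := past_type xi v N.+1) (fun w => carry f (x ^~ w) (g ^~ w) (alpha ^~ w) N).
  apply: measurable_rowsZ; first by apply: measurable_funB => //; exact: past_al.
  apply: measurable_rowsD; first exact: past_err.
  by apply: measurable_rowsB; apply: (measurable_grad_f pb); exact: past_x'.
have h0 := @conditional_second_moment R n d d' Omega Xi P mu X fs f h xstar G sigma rho beta x0 xi x g v alpha Lt
  pb so bg rho0 beta0 Xx0 fr tr N.+1 (wt N.+1) (alpha N.+1) _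
  (past_wt (leqnn _)) (past_al (leqnn _)) mb (wt_ge0 N.+1).
rewrite PsiE.
rewrite (_ : (\int[P]_w (A N.+1 w)%:E)%E = (\int[P]_w (wt N.+1 w *
   enorm (carry f (x ^~ w) (g ^~ w) (alpha ^~ w) N + alpha N.+1 w *: (sgrad fs xi x N.+1 w - grad f (x N.+1 w))) ^+ 2)%:E)%E); last first.
  by apply: eq_integral => w _; rewrite /A /E (errS f (tr w)).
apply: le_trans (leeD2r _ h0) _.
have m1 : measurable_fun setT (fun w => wt N.+1 w * (enorm (carry f (x ^~ w) (g ^~ w) (alpha ^~ w) N) ^+ 2
    + alpha N.+1 w ^+ 2 * sigma ^+ 2)).
  apply: measurable_funM; first exact: (coarser (past_wt (leqnn N.+1))).
  apply: measurable_funD.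
    by apply: measurable_funX; apply: measurable_enorm => i; exact: (coarser (mb i)).
  apply: measurable_funM => //; apply: measurable_funX; exact: (coarser (past_al (leqnn N.+1))).
rewrite -ge0_integralD//; first last.
- exact/measurable_EFinP.
- by move=> w _; rewrite lee_fin.
- exact/measurable_EFinP.
- move=> w _; rewrite lee_fin; apply: mulr_ge0; first exact: wt_ge0.
  by apply: addr_ge0; [exact: sqr_ge0|apply: mulr_ge0; exact: sqr_ge0].
have cE := @expectation_cst _ _ _ P (2 * nz N); rewrite unlock in cE.
rewrite /Psi -cE -ge0_integralD//; first last.
- by apply/measurable_EFinP; exact: measurable_cst.
- by move=> w _; rewrite lee_fin mulr_ge0.
- by apply/measurable_EFinP; exact: measurable_funD.
- move=> w _; rewrite lee_fin; apply: addr_ge0 => //; apply: mulr_ge0; first exact: wt_ge0.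
  exact: sqr_ge0.
apply: le_lower_integral => w.
  rewrite -EFinD lee_fin; apply: addr_ge0 => //; apply: mulr_ge0; first exact: wt_ge0.
  by apply: addr_ge0; [exact: sqr_ge0|apply: mulr_ge0; exact: sqr_ge0].
rewrite -!EFinD lee_fin /M !big_ord_recr /= /A.
have h1 := pot_step N w.
(* From [a^2 = S + beta t] only [S >= 1] is kept, which makes the noise term deterministic. *)
have h2 : wt N.+1 w * (alpha N.+1 w ^+ 2 * sigma ^+ 2) <= 2 * nz N.
  apply: ler_pM; [exact: wt_ge0|apply: mulr_ge0; exact: sqr_ge0|exact: wt_le2|].
  rewrite mulrC /nz; apply: ler_wpM2l; first exact: sqr_ge0.
  have al0 := alpha_gt0 beta0 (tr w) N.+1.
  rewrite -[alpha _ _]invrK exprVn lef_pV2 ?posrE ?exprn_gt0 ?invr_gt0//.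
    by rewrite -/(a w N.+1) a_sqr lerD2r; exact: qsum_ge1.
  by apply: ltr_wpDr => //; exact: mulr_ge0.
by rewrite mulrDr; lra.
Qed.

Lemma expected_live_damping N :
  (\int[P]_w (\sum_(t < N) Zt t w)%:E <=
   (2 * sigma ^+ 2 + Cpot + 2 * (K * ln (1 + beta * N%:R)))%:E)%E.
Proof.
have h1 : (\int[P]_w (\sum_(t < N) Zt t w)%:E <= Psi N)%E.
  apply: le_lower_integral => w; first by rewrite lee_fin sumr_ge0.
  rewrite lee_fin /A; apply: le_trans (_ : M N w <= _); last first.
    by rewrite lerDr mulr_ge0 ?sqr_ge0.
  rewrite lerDl subr_ge0 ler_wpM2l ?mulr_ge0 ?(ltW ell0)//.
  exact: (sum_live_relinc (S_0 w) (S_S w) (qE w) Theta0 ellE ell1).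
have h2 : forall N', (Psi N' <= (2 * sigma ^+ 2 + Cpot + 2 * \sum_(t < N') nz t)%:E)%E.
  elim=> [|N' ih]; first by rewrite big_ord0 mulr0 addr0.
  apply: le_trans (PsiS N') _; rewrite big_ord_recr /= mulrDr addrA EFinD.
  exact: leeD2r.
apply: le_trans h1 (le_trans (h2 N) _).
rewrite lee_fin lerD2l ler_wpM2l//.
have := @sum_noise_le R K nu sigma N nu0 nuK.
by rewrite /nz betaE.
Qed.

Definition cZ : R := 1 + 2 * K ^+ 2 + 2 * cR K + 2 * K.

Let m_sgrad t : measurable_fun setT (fun w => enorm (sgrad fs xi x t w) ^+ 2).
Proof.
apply: measurable_funX; apply: measurable_enorm => i; apply: (coarser (t := t.+1)).
apply: (measurable_grad_fs so); first exact: past_x' (leqnSn t).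
exact: past_xi.
Qed.

Let cgap_ge0 : 0 <= cgap K.
Proof.
have c0 := @cY_ge0 _ _ K1; have kc : 0 <= K * cY K by rewrite mulr_ge0.
have k2 : 0 <= K ^+ 2 by exact: sqr_ge0.
have b0 : 0 <= cB K by rewrite /cB; lra.
have q0 : 0 <= cQ K.
  have h1 : 0 <= K ^+ 2 * cB K ^+ 2 by rewrite mulr_ge0 ?sqr_ge0.
  have h2 : 0 <= K * cB K by rewrite mulr_ge0.
  by have := K0; rewrite /cQ; lra.
have h3 : 0 <= K * (cQ K + 1) by rewrite mulr_ge0// addr_ge0.
by rewrite /cgap; lra.
Qed.

(** Below the threshold the first summand bounds the sum. Beyond it each gap is at most [2 K^2] and
    [1 <= S N / Theta]: Markov's inequality in pathwise form, with [S N] replaced by its polynomial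
    bound. *)
Let pathwise_gap_sum N w : (0 < N)%N ->
  \sum_(t < N) rgap X f h (x ^~ w) t <=
   cgap K * ell ^+ 2 * Num.sqrt N%:R * (1 + Num.sqrt (Num.sqrt (beta * N%:R))) * (1 + \sum_(t < N) Zt t w)
   + 2 * K ^+ 2 * N%:R / Theta * (1 + N%:R * (2 * K ^+ 2 + 2 * \sum_(t < N) enorm (sgrad fs xi x t w) ^+ 2)).
Proof.
move=> N0; have G0 := G_ge0 bg.
have D0 : 0 <= D by exact: (diam_ge0 pb Xx0).
have GD : 2 * G * D <= 2 * K ^+ 2.
  by have : G * D <= K * K by [exact: ler_pM|]; rewrite expr2; lra.
have Q0 : 0 <= \sum_(t < N) enorm (sgrad fs xi x t w) ^+ 2.
  by apply: sumr_ge0 => i _; exact: sqr_ge0.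
have Z0 : 0 <= \sum_(t < N) Zt t w by exact: sumr_ge0.
have k2 : 0 <= K ^+ 2 by exact: sqr_ge0.
have c0 : 0 <= cgap K * ell ^+ 2 * Num.sqrt N%:R * (1 + Num.sqrt (Num.sqrt (beta * N%:R))).
  by rewrite mulr_ge0 ?addr_ge0 ?sqrtr_ge0// mulr_ge0 ?sqrtr_ge0// mulr_ge0 ?sqr_ge0.
have sN : S w N <= 1 + N%:R * (2 * K ^+ 2 + 2 * \sum_(t < N) enorm (sgrad fs xi x t w) ^+ 2).
  apply: le_trans (qsum_le pb bg rho0 beta0 Xx0 (tr w) N) _.
  rewrite lerD2l ler_wpM2l// lerD2r ler_wpM2l//.
  by apply: lerXn2r; rewrite ?nnegrE.
have o0 : 0 <= 2 * K ^+ 2 * N%:R by rewrite mulr_ge0// mulr_ge0.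
have o1 : 0 <= 2 * K ^+ 2 * N%:R / Theta by rewrite divr_ge0// ltW.
have S1 : 1 <= S w N by exact: qsum_ge1.
have [SN|SN] := leP (S w N) Theta.
  have := sum_gap_le K1 D0 DK G0 GK (L_ge0 sm) LK rho0 rhoK irhoK beta0 betaK (S_0 w) (S_S w) (qE w)
    (a_ge0 w) (a_sqr w) (lE w) (st_ge0 w) (E_ge0 w) Theta0 ellE ell1 N0 SN
    (scaled_step_err pb bg rho0 beta0 Xx0 (tr w)) (scaled_descent pb bg sm rho0 beta0 Xx0 (tr w))
    (Fval_le pb bg rho0 beta0 Xx0 (tr w)) (rgap_le pb bg sm rho0 beta0 Xx0 (tr w))
    (rgap_diam pb bg rho0 beta0 Xx0 (tr w)).
  (* As [S] is nondecreasing, [S N <= Theta] keeps all earlier steps live. *)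
  have -> : \sum_(t < N) damping (S w) (q w) (a w) ell t * E w t ^+ 2 = \sum_(t < N) Zt t w.
    apply: eq_bigr => t _; rewrite /Zt /lv /live.
    have -> : S w t <= Theta by apply: le_trans SN; exact: (S_le (S_S w) (qE w) (ltnW (ltn_ord t))).
    by rewrite mul1r.
  move/le_trans; apply; rewrite -[leLHS]addr0; apply: lerD.
    by rewrite le_eqVlt; apply/orP; left; apply/eqP; ring.
  by apply: mulr_ge0 => //; apply: le_trans sN; lra.
apply: le_trans (_ : 2 * K ^+ 2 * N%:R / Theta * S w N <= _); last first.
  rewrite -[leLHS]add0r; apply: lerD; first by apply: mulr_ge0 => //; lra.
  exact: ler_wpM2l.
apply: le_trans (_ : 2 * K ^+ 2 * N%:R <= _); last first.
  rewrite -[leLHS]mulr1 -[leRHS]mulrA; apply: ler_wpM2l => //.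
  by rewrite mulrC ler_pdivlMr// mul1r ltW.
apply: le_trans (_ : \sum_(t < N) (2 * K ^+ 2) <= _).
  by apply: ler_sum => t _; exact: le_trans (rgap_diam pb bg rho0 beta0 Xx0 (tr w) t) GD.
by rewrite sumr_const card_ord mulr_natr.
Qed.

(** The pathwise bound is affine in the damped errors and in the squared samples, both of known
    mean. The factor [k] stays inside the integral since the gap sum is not known to be measurable;
    it is pulled out of the majorant instead. *)
Lemma expected_gap_sum N (k : R) : (0 < N)%N -> 0 <= k -> ln (1 + beta * N%:R) <= ell ->
  (\int[P]_w (k * \sum_(t < N) rgap X f h (x ^~ w) t)%:E <=
   (k * (cgap K * cZ * ell ^+ 4 * Num.sqrt N%:R * (1 + Num.sqrt (Num.sqrt (beta * N%:R)))
    + 2 * K ^+ 2 * N%:R / Theta * (1 + N%:R * (2 * K ^+ 2 + 4 * K ^+ 2 * N%:R))))%:E)%E.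
Proof.
move=> N0 k0 lnell.
set Cg := cgap K * ell ^+ 2 * Num.sqrt N%:R * (1 + Num.sqrt (Num.sqrt (beta * N%:R))).
set c2 := 2 * K ^+ 2 * N%:R / Theta.
have k2 : 0 <= K ^+ 2 by exact: sqr_ge0.
have Cg0 : 0 <= Cg.
  by rewrite mulr_ge0 ?addr_ge0 ?sqrtr_ge0// mulr_ge0 ?sqrtr_ge0// mulr_ge0 ?sqr_ge0.
have c20 : 0 <= c2 by rewrite divr_ge0 ?(ltW Theta0)// mulr_ge0// mulr_ge0.
pose Q w : R := \sum_(t < N) enorm (sgrad fs xi x t w) ^+ 2.
pose Z w : R := \sum_(t < N) Zt t w.
have Q0 w : 0 <= Q w by apply: sumr_ge0 => i _; exact: sqr_ge0.
have Z0 w : 0 <= Z w by exact: sumr_ge0.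
have mQ : measurable_fun setT Q by apply: measurable_sum => i; exact: m_sgrad.
have mZ : measurable_fun setT Z.
  apply: measurable_sum => i; apply: (coarser (t := i.+1)); exact: past_Zt.
have EQ : (\int[P]_w (Q w)%:E <= (2 * K ^+ 2 * N%:R)%:E)%E.
  rewrite /Q; under eq_integral do rewrite -sumEFin.
  rewrite ge0_integral_sum//; last first.
  - by move=> i w _; rewrite lee_fin sqr_ge0.
  - by move=> i; apply/measurable_EFinP; exact: m_sgrad.
  have -> : 2 * K ^+ 2 * N%:R = \sum_(t < N) 2 * K ^+ 2 by rewrite sumr_const card_ord mulr_natr.
  rewrite -sumEFin; apply: lee_sum => i _; apply: le_trans (expected_noise i) _.
  rewrite lee_fin; have h1 : G ^+ 2 <= K ^+ 2 by apply: lerXn2r; rewrite ?nnegrE// (G_ge0 bg).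
  have h2 : sigma ^+ 2 <= K ^+ 2 by apply: lerXn2r; rewrite ?nnegrE// (sigma_ge0 so).
  by lra.
have EZ := expected_live_damping N.
pose c1 := Cg + c2 * (1 + N%:R * (2 * K ^+ 2)).
have c10 : 0 <= c1 by rewrite addr_ge0// mulr_ge0// addr_ge0// mulr_ge0// mulr_ge0.
have c30 : 0 <= 2 * c2 * N%:R by rewrite mulr_ge0// mulr_ge0.
have mZ' : measurable_fun setT (fun w => (Cg%:E * (Z w)%:E)%E).
  by apply/measurable_EFinP; apply: measurable_funM.
have mQ' : measurable_fun setT (fun w => ((2 * c2 * N%:R)%:E * (Q w)%:E)%E).
  by apply/measurable_EFinP; apply: measurable_funM.
have F0 w : (0 <= c1%:E + (Cg%:E * (Z w)%:E + (2 * c2 * N%:R)%:E * (Q w)%:E))%E.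
  by rewrite -!EFinM -!EFinD lee_fin addr_ge0// addr_ge0// mulr_ge0.
apply: le_trans (_ : (\int[P]_w (k%:E * (c1%:E + (Cg%:E * (Z w)%:E + (2 * c2 * N%:R)%:E * (Q w)%:E))) <= _)%E).
  apply: le_lower_integral => w.
    by rewrite lee_fin mulr_ge0// sumr_ge0// => t _; exact: (rgap_ge0 pb bg rho0 beta0 Xx0 (tr w)).
  have -> : (c1%:E + (Cg%:E * (Z w)%:E + (2 * c2 * N%:R)%:E * (Q w)%:E) = (c1 + (Cg * Z w + 2 * c2 * N%:R * Q w))%:E)%E.
    by rewrite !EFinD !EFinM.
  rewrite -EFinM lee_fin; apply: ler_wpM2l => //; apply: le_trans (pathwise_gap_sum w N0) _.
  by rewrite -/Cg -/c2 -/(Z w) -/(Q w) /c1 le_eqVlt; apply/orP; left; apply/eqP; ring.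
rewrite ge0_integralZl_EFin//; last by apply: emeasurable_funD => //; exact: emeasurable_funD.
rewrite [leRHS]EFinM; apply: lee_wpmul2l => //.
rewrite ge0_integralD//; first last.
- exact: emeasurable_funD.
- by move=> w _; rewrite -!EFinM -EFinD lee_fin addr_ge0// mulr_ge0.
rewrite ge0_integralD//; first last.
- by move=> w _; rewrite -EFinM lee_fin mulr_ge0.
- by move=> w _; rewrite -EFinM lee_fin mulr_ge0.
rewrite ge0_integralZl_EFin//; first last.
- exact/measurable_EFinP.
- by move=> w _; rewrite lee_fin.
rewrite ge0_integralZl_EFin//; first last.
- exact/measurable_EFinP.
- by move=> w _; rewrite lee_fin.
have cE := @expectation_cst _ _ _ P c1; rewrite unlock in cE; rewrite cE {cE}.
apply: le_trans (_ : (c1%:E + (Cg%:E * (2 * sigma ^+ 2 + Cpot + 2 * (K * ln (1 + beta * N%:R)))%:E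
   + (2 * c2 * N%:R)%:E * (2 * K ^+ 2 * N%:R)%:E) <= _)%E).
  by apply: leeD2l; apply: leeD; apply: lee_wpmul2l.
rewrite -!EFinM -!EFinD lee_fin.
have h2 : sigma ^+ 2 <= K ^+ 2 by apply: lerXn2r; rewrite ?nnegrE// (sigma_ge0 so).
have l2 : 1 <= ell ^+ 2 by rewrite exprn_ege1.
have l3 : ell <= ell ^+ 2 by rewrite expr2 ler_peMr// ltW.
have key : 1 + (2 * sigma ^+ 2 + Cpot + 2 * (K * ln (1 + beta * N%:R))) <= cZ * ell ^+ 2.
  have e1 : K * ln (1 + beta * N%:R) <= K * ell ^+ 2.
    by apply: ler_wpM2l => //; exact: le_trans lnell l3.
  have e2 : K ^+ 2 * 1 <= K ^+ 2 * ell ^+ 2 by rewrite ler_wpM2l.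
  have e3 : Cpot <= 2 * cR K * ell ^+ 2.
    have : cR K * (ell ^+ 2 + ell) <= cR K * (2 * ell ^+ 2) by apply: ler_wpM2l => //; lra.
    by rewrite /Cpot expr2; lra.
  by rewrite /cZ; lra.
have : Cg * (1 + (2 * sigma ^+ 2 + Cpot + 2 * (K * ln (1 + beta * N%:R)))) <= Cg * (cZ * ell ^+ 2).
  by rewrite ler_wpM2l.
have -> : cgap K * cZ * ell ^+ 4 * Num.sqrt N%:R * (1 + Num.sqrt (Num.sqrt (beta * N%:R))) = Cg * (cZ * ell ^+ 2).
  by rewrite /Cg; ring.
rewrite /c1; lra.
Qed.

End ExpectedPotential.

(** * Rates *)

Section Rates.
Context {R : realType}.

Lemma sqrt_le_id (K x : R) : 1 <= K -> x <= K -> Num.sqrt x <= K.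
Proof.
move=> K1 xK; have K0 : 0 <= K by lra.
have -> : K = Num.sqrt (K ^+ 2) by rewrite sqrtr_sqr ger0_norm.
by apply: ler_wsqrtr; apply: le_trans xK _; rewrite expr2 ler_peMl.
Qed.

Definition rate (sigma : R) (T : nat) : R :=
  (Num.sqrt T%:R)^-1 + Num.sqrt sigma * (Num.sqrt (Num.sqrt T%:R))^-1.

Definition crate (K : R) : R := (cgap K * cZ K * (32 * K) ^+ 4 + 1) * K.

Lemma cgap_cZ_ge0 (K : R) : 1 <= K -> 0 <= cgap K * cZ K.
Proof.
move=> K1; have K0 : 0 <= K by lra.
have c0 := @cY_ge0 _ _ K1; have kc : 0 <= K * cY K by rewrite mulr_ge0.
have k2 : 0 <= K ^+ 2 by exact: sqr_ge0.
have b0 : 0 <= cB K by rewrite /cB; lra.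
have q0 : 0 <= cQ K.
  have h1 : 0 <= K ^+ 2 * cB K ^+ 2 by rewrite mulr_ge0 ?sqr_ge0.
  have h2 : 0 <= K * cB K by rewrite mulr_ge0.
  by rewrite /cQ; lra.
have h3 : 0 <= K * (cQ K + 1) by rewrite mulr_ge0// addr_ge0.
have g0 : 0 <= cgap K by rewrite /cgap; lra.
have r0 : 0 <= cR K by rewrite /cR addr_ge0// mulr_ge0 ?exprn_ge0// mulr_ge0.
by rewrite mulr_ge0// /cZ; lra.
Qed.

Lemma crate_ge1 (K : R) : 1 <= K -> 1 <= crate K.
Proof.
move=> K1; rewrite /crate -[leLHS]mulr1; apply: ler_pM => //.
by rewrite lerDr mulr_ge0 ?cgap_cZ_ge0// exprn_ge0//; lra.
Qed.

(** Here [Theta = (4 K N)^4]: large enough to make the contribution beyond the threshold at most 1,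
    and polynomial, so that [ell] remains logarithmic in [T]. *)
Lemma gap_sum_rate (K nu sigma : R) (T : nat) : (0 < T)%N -> 1 <= K -> nu <= K ->
  0 <= nu -> 0 <= sigma -> sigma <= K ->
  let N := T.+1 in let ell := ln ((4 * K * N%:R) ^+ 4) in
  [/\ 1 <= ell, ln (1 + nu * sigma ^+ 2 * N%:R) <= ell &
   N%:R^-1 * (cgap K * cZ K * ell ^+ 4 * Num.sqrt N%:R * (1 + Num.sqrt (Num.sqrt (nu * sigma ^+ 2 * N%:R)))
    + 2 * K ^+ 2 * N%:R / (4 * K * N%:R) ^+ 4 * (1 + N%:R * (2 * K ^+ 2 + 4 * K ^+ 2 * N%:R)))
   <= crate K * (1 + ln T%:R) ^+ 4 * rate sigma T].
Proof.
move=> T0 K1 nuK nu0 s0 sK N ell; have K0 : 0 <= K by lra.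
have N1 : 1 <= N%:R :> R by rewrite ler1n.
have N0 : 0 < N%:R :> R by rewrite ltr0n.
have KN : 1 <= K * N%:R by rewrite -[leLHS]mulr1; exact: ler_pM.
set y := 4 * K * N%:R; have y4 : 4 <= y by rewrite /y -mulrA; lra.
have y0 : 0 < y by lra.
have ellE : ell = 4 * ln y by rewrite /ell -/y lnXn// mulr_natl.
have T1 : 1 <= T%:R :> R by rewrite ler1n.
have lnT0 : 0 <= ln (T%:R : R) by rewrite ln_ge0.
have lny : 3 / 4 <= ln y.
  have := @ln_sub_ge R 1 y ltr01 y0; rewrite ln1 subr0 mulrBl mulfV ?gt_eqF// mul1r.
  have : y^-1 <= 4^-1 by rewrite lef_pV2 ?posrE.
  by lra.
have ell1 : 1 <= ell by rewrite ellE; lra.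
have ell0 : 0 <= ell by lra.
have k3 : nu * sigma ^+ 2 <= K ^+ 3.
  rewrite (exprD K 1 2) expr1; apply: ler_pM => //; first exact: sqr_ge0.
  by apply: lerXn2r; rewrite ?nnegrE.
have b0 : 0 <= nu * sigma ^+ 2 by rewrite mulr_ge0 ?sqr_ge0.
have K31 : 1 <= K ^+ 3 by rewrite exprn_ege1.
have yE : y ^+ 4 = 256 * (K ^+ 4 * N%:R ^+ 4) by rewrite /y !exprMn -natrX; ring.
have hK4 : K ^+ 3 <= K ^+ 4 by rewrite ler_weXn2l.
have hN4 : N%:R <= N%:R ^+ 4 :> R by rewrite -{1}(expr1 N%:R) ler_weXn2l.
have KN4 : K ^+ 3 * N%:R <= K ^+ 4 * N%:R ^+ 4 by apply: ler_pM => //; lra.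
have KN1 : 1 <= K ^+ 4 * N%:R ^+ 4.
  by rewrite -[leLHS]mulr1; apply: ler_pM => //; rewrite exprn_ege1.
split=> //.
  rewrite /ell ler_ln ?posrE ?exprn_gt0//; last by rewrite ltr_wpDr// mulr_ge0.
  rewrite yE; apply: le_trans (_ : 1 + K ^+ 3 * N%:R <= _); last by lra.
  by rewrite lerD2l ler_wpM2r.
set lam := 1 + ln T%:R; have lam1 : 1 <= lam by rewrite lerDl.
(* With [N <= 2 T], [ell = 4 * ln (4 K N) <= 4 * (8 K + ln T)]. *)
have l32 : ell <= 32 * K * lam.
  rewrite ellE; have : ln y <= ln (8 * K) + ln T%:R.
    rewrite -lnM ?posrE ?ltr0n//; last by lra.
    rewrite ler_ln ?posrE//; last by rewrite mulr_gt0 ?ltr0n//; lra.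
    have : N%:R <= 2 * T%:R :> R by rewrite -natrM ler_nat /N mul2n -addnn -addn1 leq_add2l.
    rewrite /y => h; have : K * N%:R <= K * (2 * T%:R) by rewrite ler_wpM2l.
    by lra.
  have : ln (8 * K) <= 8 * K.
    have := @le_ln1Dx R (8 * K - 1); rewrite addrCA subrr addr0 => h.
    by apply: le_trans (h _) _; lra.
  have : ln T%:R <= 8 * K * ln T%:R :> R by rewrite ler_peMl//; lra.
  by rewrite /lam; lra.
(* The numerator is at most [14 K^4 N^3], the denominator is [256 K^4 N^4]. *)
have off : 2 * K ^+ 2 * N%:R / y ^+ 4 * (1 + N%:R * (2 * K ^+ 2 + 4 * K ^+ 2 * N%:R)) <= 1.
  rewrite mulrAC ler_pdivrMr ?exprn_gt0// mul1r yE.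
  have K21 : 1 <= K ^+ 2 by rewrite exprn_ege1.
  have N21 : 1 <= N%:R ^+ 2 :> R by rewrite exprn_ege1.
  have g1 : 1 <= K ^+ 2 * N%:R ^+ 2 by rewrite -[leLHS]mulr1; apply: ler_pM.
  have g2 : N%:R * (2 * K ^+ 2) <= 2 * (K ^+ 2 * N%:R ^+ 2).
    have : K ^+ 2 * N%:R <= K ^+ 2 * N%:R ^+ 2 by rewrite ler_wpM2l ?sqr_ge0// expr2 ler_peMl//; lra.
    by lra.
  have g3 : 1 + N%:R * (2 * K ^+ 2 + 4 * K ^+ 2 * N%:R) <= 7 * (K ^+ 2 * N%:R ^+ 2).
    by rewrite mulrDr; lra.
  apply: le_trans (_ : 2 * K ^+ 2 * N%:R * (7 * (K ^+ 2 * N%:R ^+ 2)) <= _).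
    by apply: ler_wpM2l g3; rewrite mulr_ge0 ?(ltW N0)// mulr_ge0 ?sqr_ge0.
  have -> : 2 * K ^+ 2 * N%:R * (7 * (K ^+ 2 * N%:R ^+ 2)) = 14 * (K ^+ 4 * N%:R ^+ 3) by ring.
  have : K ^+ 4 * N%:R ^+ 3 <= K ^+ 4 * N%:R ^+ 4.
    by rewrite ler_wpM2l ?exprn_ge0// ler_weXn2l.
  by lra.
set sN := Num.sqrt N%:R; set qN := Num.sqrt sN.
have sN0 : 0 < sN by rewrite sqrtr_gt0.
have sN1 : 1 <= sN by rewrite -[leLHS]sqrtr1 ler_wsqrtr.
have qN0 : 0 < qN by rewrite sqrtr_gt0.
have sN2 : sN ^+ 2 = N%:R by rewrite sqr_sqrtr// ltW.
have qN2 : qN ^+ 2 = sN by rewrite sqr_sqrtr// ltW.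
(* The fourth root splits as [nu^(1/4) * sigma^(1/2) * N^(1/4)]; this is the origin of the
   [sigma^(1/2) T^(-1/4)] term. *)
have mE : Num.sqrt (Num.sqrt (nu * sigma ^+ 2 * N%:R)) <= K * Num.sqrt sigma * qN.
  have -> : nu * sigma ^+ 2 * N%:R = (nu * N%:R) * sigma ^+ 2 by ring.
  rewrite sqrtrM ?mulr_ge0 ?(ltW N0)// sqrtr_sqr ger0_norm// sqrtrM ?sqrtr_ge0//.
  rewrite (sqrtrM _ nu0) sqrtrM ?sqrtr_ge0// -/sN -/qN mulrAC.
  rewrite ler_wpM2r ?(ltW qN0)// ler_wpM2r ?sqrtr_ge0//.
  by do 2 apply: sqrt_le_id => //.
have cc := cgap_cZ_ge0 K1.
have l4 : ell ^+ 4 <= (32 * K) ^+ 4 * lam ^+ 4.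
  by rewrite -exprMn; apply: lerXn2r; rewrite ?nnegrE// mulr_ge0//; lra.
have lam4 : 1 <= lam ^+ 4 by rewrite exprn_ege1.
pose m := Num.sqrt (Num.sqrt (nu * sigma ^+ 2 * N%:R)).
have m0 : 0 <= m by exact: sqrtr_ge0.
have ss0 : 0 <= Num.sqrt sigma by exact: sqrtr_ge0.
have mK : 1 + m <= K * (1 + Num.sqrt sigma * qN) by rewrite /m; lra.
have A1 : cgap K * cZ K * ell ^+ 4 * sN * (1 + m) + 1 <= crate K * lam ^+ 4 * (sN * (1 + Num.sqrt sigma * qN)).
  set U := sN * (1 + Num.sqrt sigma * qN).
  have U1 : 1 <= U.
    rewrite -[leLHS]mulr1; apply: ler_pM => //; rewrite lerDl mulr_ge0// ltW//.
  have h1 : cgap K * cZ K * ell ^+ 4 <= cgap K * cZ K * ((32 * K) ^+ 4 * lam ^+ 4) by rewrite ler_wpM2l.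
  have h2 : sN * (1 + m) <= K * U by rewrite /U mulrCA ler_wpM2l// ltW.
  have h3 : cgap K * cZ K * ell ^+ 4 * (sN * (1 + m)) <= cgap K * cZ K * ((32 * K) ^+ 4 * lam ^+ 4) * (K * U).
    apply: ler_pM h1 h2; first by rewrite mulr_ge0// exprn_ge0.
    by rewrite mulr_ge0 ?(ltW sN0)//; lra.
  have h4 : 1 <= K * (lam ^+ 4 * U).
    by rewrite -[leLHS]mulr1; apply: ler_pM => //; rewrite -[leLHS]mulr1; apply: ler_pM.
  by rewrite /crate; lra.
apply: le_trans (_ : N%:R^-1 * (crate K * lam ^+ 4 * (sN * (1 + Num.sqrt sigma * qN))) <= _).
  rewrite ler_wpM2l ?invr_ge0 ?(ltW N0)//; apply: le_trans A1; exact: lerD.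
have -> : N%:R^-1 * (crate K * lam ^+ 4 * (sN * (1 + Num.sqrt sigma * qN))) =
   crate K * lam ^+ 4 * (sN^-1 + Num.sqrt sigma * qN^-1).
  rewrite -sN2 -qN2; field; rewrite gt_eqF//.
have c1 := crate_ge1 K1.
apply: ler_wpM2l; first by rewrite mulr_ge0//; lra.
have TN : T%:R <= N%:R :> R by rewrite ler_nat.
have sT0 : 0 < Num.sqrt (T%:R : R) by rewrite sqrtr_gt0 ltr0n.
rewrite /rate; apply: lerD; first by rewrite lef_pV2 ?posrE// ler_wsqrtr.
apply: ler_wpM2l => //; rewrite lef_pV2 ?posrE ?sqrtr_gt0 ?ltr0n//.
by do 2 apply: ler_wsqrtr.
Qed.

(** * The horizon that reaches a given accuracy *)

Definition cbase (K c : R) : R := 32 * c ^+ 4 * (38 + K ^+ 2) ^+ 16.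

Lemma ln_le_sub1 (z : R) : 0 < z -> ln z <= z - 1.
Proof.
by move=> z0; have := @le_ln1Dx R (z - 1); rewrite addrCA subrr addr0; apply; lra.
Qed.

Lemma ln_iterations (K sigma eps : R) : 0 <= K -> 0 <= sigma -> sigma <= K -> 0 < eps ->
  ln (sigma ^+ 2 / eps ^+ 4 + (eps ^+ 2)^-1) <= K ^+ 2 + 4 * ln (1 + eps^-1).
Proof.
move=> K0 s0 sK e0; have ei0 : 0 < eps^-1 by rewrite invr_gt0.
have k2 := sqr_ge0 K; have e2 : 0 < eps ^+ 2 by rewrite exprn_gt0.
have e4 : 0 < eps ^+ 4 by rewrite exprn_gt0.
have V0 : 0 < sigma ^+ 2 / eps ^+ 4 + (eps ^+ 2)^-1.
  by rewrite ltr_wpDl ?invr_gt0// divr_ge0 ?sqr_ge0// ltW.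
set z := 1 + eps^-1; have z1 : 1 <= z by rewrite /z; lra.
have z0 : 0 < z by lra.
have z2 : eps^-1 <= z by rewrite /z; lra.
have VZ : sigma ^+ 2 / eps ^+ 4 + (eps ^+ 2)^-1 <= (1 + K ^+ 2) * z ^+ 4.
  have g1 : (eps ^+ 4)^-1 <= z ^+ 4.
    by rewrite -exprVn; apply: lerXn2r; rewrite ?nnegrE ?(ltW ei0) ?(ltW z0).
  have g2 : (eps ^+ 2)^-1 <= z ^+ 4.
    apply: le_trans (_ : z ^+ 2 <= _); last by rewrite ler_weXn2l.
    by rewrite -exprVn; apply: lerXn2r; rewrite ?nnegrE ?(ltW ei0) ?(ltW z0).
  have g3 : sigma ^+ 2 / eps ^+ 4 <= K ^+ 2 * z ^+ 4.
    apply: ler_pM => //; rewrite ?sqr_ge0// ?invr_ge0 ?(ltW e4)//.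
    by apply: lerXn2r; rewrite ?nnegrE.
  by rewrite mulrDl mul1r addrC; apply: lerD.
have p : 0 < 1 + K ^+ 2 by lra.
apply: le_trans (_ : ln ((1 + K ^+ 2) * z ^+ 4) <= _).
  by rewrite ler_ln ?posrE// mulr_gt0 ?exprn_gt0.
rewrite lnM ?posrE ?exprn_gt0// lnXn// mulr_natl lerD2r.
by have := ln_le_sub1 p; lra.
Qed.

(** Each of the two terms of the rate is brought below [eps / 2]; the fourth root of [T] in one of
    them turns [2 W] into [16 W^4]. *)
Lemma rate_le (W sigma eps : R) (T : nat) : (0 < T)%N -> 1 <= W -> 0 <= sigma -> 0 < eps ->
  16 * W ^+ 4 * (sigma ^+ 2 / eps ^+ 4 + (eps ^+ 2)^-1) <= T%:R ->
  W * rate sigma T <= eps.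
Proof.
move=> T0 W1 s0 e0 TV.
have e2 : 0 < eps ^+ 2 by rewrite exprn_gt0.
have e4 : 0 < eps ^+ 4 by rewrite exprn_gt0.
have W40 : 0 <= 16 * W ^+ 4 by rewrite mulr_ge0// exprn_ge0//; lra.
have sT0 : 0 < Num.sqrt (T%:R : R) by rewrite sqrtr_gt0 ltr0n.
have qT0 : 0 < Num.sqrt (Num.sqrt (T%:R : R)) by rewrite sqrtr_gt0.
have r1 : 2 * W / eps <= Num.sqrt T%:R.
  have z0 : 0 <= 2 * W / eps by rewrite divr_ge0 ?(ltW e0)//; lra.
  have -> : 2 * W / eps = Num.sqrt ((2 * W / eps) ^+ 2) by rewrite sqrtr_sqr ger0_norm.
  apply: ler_wsqrtr; apply: le_trans TV.
  have -> : (2 * W / eps) ^+ 2 = 4 * W ^+ 2 * (eps ^+ 2)^-1 by rewrite !exprMn exprVn -natrX.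
  apply: le_trans (_ : 16 * W ^+ 4 * (eps ^+ 2)^-1 <= _).
    apply: ler_wpM2r; first by rewrite invr_ge0 ltW.
    apply: ler_pM => //; [exact: sqr_ge0|lra|by rewrite ler_weXn2l].
  by rewrite ler_wpM2l// lerDr divr_ge0 ?sqr_ge0// ltW.
have r2 : 2 * W * Num.sqrt sigma / eps <= Num.sqrt (Num.sqrt T%:R).
  set z := 2 * W * Num.sqrt sigma / eps.
  have z0 : 0 <= z by rewrite divr_ge0 ?(ltW e0)// mulr_ge0 ?sqrtr_ge0//; lra.
  have -> : z = Num.sqrt (Num.sqrt (z ^+ 4)).
    by rewrite (exprM z 2 2) sqrtr_sqr ger0_norm ?sqr_ge0// sqrtr_sqr ger0_norm.
  do 2 apply: ler_wsqrtr; apply: le_trans TV.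
  have -> : z ^+ 4 = 16 * W ^+ 4 * (sigma ^+ 2 / eps ^+ 4).
    have ss : Num.sqrt sigma ^+ 4 = sigma ^+ 2 by rewrite (exprM _ 2 2) sqr_sqrtr.
    by rewrite /z !exprMn exprVn ss -natrX mulrA.
  by rewrite ler_wpM2l// lerDl invr_ge0 ltW.
have q1 : W * (Num.sqrt T%:R)^-1 <= eps / 2.
  by rewrite ler_pdivrMr//; move: r1; rewrite ler_pdivrMr// => r1; lra.
have q2 : W * (Num.sqrt sigma * (Num.sqrt (Num.sqrt T%:R))^-1) <= eps / 2.
  by rewrite mulrA ler_pdivrMr//; move: r2; rewrite ler_pdivrMr// => r2; lra.
by rewrite /rate mulrDr; lra.
Qed.

Lemma expr4_prod (c b z : R) : (c * (b * z) ^+ 4) ^+ 4 = c ^+ 4 * (b ^+ 16 * z ^+ 16).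
Proof. by ring. Qed.

(** The condition on [T] is implicit, since [ln T] appears in it. [T] is the integer part of
    [C * lam^16 * V]: the rate is inverted by a fourth power, which turns the factor [(1 + ln T)^4]
    into a sixteenth power, and [ln T] is of order [lam]. *)
Lemma horizon_exists (K c sigma eps : R) : 1 <= K -> 1 <= c -> 0 <= sigma -> sigma <= K ->
  0 < eps -> eps <= 2 * K ^+ 2 ->
  exists T : nat, [/\ (0 < T)%N,
    T%:R <= cbase K c ^+ 17 * (1 + ln (1 + eps^-1)) ^+ 16 * (sigma ^+ 2 / eps ^+ 4 + (eps ^+ 2)^-1) &
    c * (1 + ln T%:R) ^+ 4 * rate sigma T <= eps].
Proof.
move=> K1 c1 s0 sK e0 eK.
have K2 : 1 <= K ^+ 2 by rewrite exprn_ege1.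
have c4 : 1 <= c ^+ 4 by rewrite exprn_ege1.
have [a aE] : exists a, a = 38 + K ^+ 2 by exists (38 + K ^+ 2).
have a1 : 1 <= a by rewrite aE; lra.
have a16 : 1 <= a ^+ 16 by rewrite exprn_ege1.
have ca16 : 1 <= c ^+ 4 * a ^+ 16 by rewrite -[leLHS]mulr1; apply: ler_pM.
have [y yC0] : exists y, y = cbase K c by exists (cbase K c).
have yE : y = 32 * (c ^+ 4 * a ^+ 16) by rewrite yC0 /cbase -aE mulrA.
have y1 : 1 <= y by rewrite yE; lra.
have y0 : 0 < y by lra.
(* [C] has to exceed [32 c^4 b^16], where [b] itself contains [ln C]. As [ln C <= 17 y], one has
   [b <= a y], and [32 c^4 a^16 y^16] is exactly [y^17]. *)
have [C CE] : exists C, C = y ^+ 17 by exists (y ^+ 17).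
rewrite -yC0 -CE; have C0 : 0 < C by rewrite CE exprn_gt0.
set lam := 1 + ln (1 + eps^-1); have ei0 : 0 < eps^-1 by rewrite invr_gt0.
have lam1 : 1 <= lam by rewrite /lam lerDl ln_ge0//; lra.
set V := sigma ^+ 2 / eps ^+ 4 + (eps ^+ 2)^-1.
have V1 : sigma ^+ 2 / eps ^+ 4 <= V by rewrite lerDl invr_ge0 exprn_ge0// ltW.
have V2 : (eps ^+ 2)^-1 <= V by rewrite lerDr divr_ge0 ?sqr_ge0// exprn_ge0// ltW.
have e2 : 0 < eps ^+ 2 by rewrite exprn_gt0.
have e4 : 0 < eps ^+ 4 by rewrite exprn_gt0.
have V0 : 0 < V by apply: lt_le_trans V2; rewrite invr_gt0.
have l16 : 1 <= lam ^+ 16 by rewrite exprn_ege1.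
set M := C * lam ^+ 16 * V.
have yC : y <= C by rewrite CE exprS ler_peMr ?(ltW y0)// exprn_ege1.
(* The assumption [eps <= 2 K^2] enters here; then taking the integer part of [M] loses at most a
   factor 2. *)
have M1 : 1 <= M.
  have h1 : 1 <= C * (eps ^+ 2)^-1.
    rewrite -ler_pdivrMr ?invr_gt0// invrK mul1r.
    apply: le_trans (_ : (2 * K ^+ 2) ^+ 2 <= _).
      by apply: lerXn2r; rewrite ?nnegrE ?(ltW e0)//; lra.
    apply: le_trans yC; rewrite yE.
    apply: le_trans (_ : 32 * a ^+ 16 <= _); last first.
      have : 1 * a ^+ 16 <= c ^+ 4 * a ^+ 16 by apply: ler_wpM2r => //; lra.
      by lra.
    apply: le_trans (_ : 32 * a ^+ 2 <= _); last by rewrite ler_wpM2l// ler_weXn2l.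
    rewrite exprMn; have : (K ^+ 2) ^+ 2 <= a ^+ 2.
      by apply: lerXn2r; rewrite ?nnegrE ?aE; lra.
    by have := sqr_ge0 (K ^+ 2); lra.
  rewrite /M; apply: le_trans h1 _; rewrite -mulrA ler_wpM2l ?(ltW C0)//.
  by apply: le_trans V2 _; rewrite ler_peMl// ltW.
have M0 : 0 < M by lra.
set T := Num.truncn M.
have /andP[TM MT] : T%:R <= M < T.+1%:R by apply: truncn_itv; lra.
have T0 : (0 < T)%N by rewrite /T truncn_gt0.
have T1 : 1 <= T%:R :> R by rewrite ler1n.
have M2T : M <= 2 * T%:R by move: MT; rewrite -natr1; lra.
(* 21 collects the 1 in [1 + ln T], the 16 of [lam^16] and the 4 from the logarithm of [V]. *)
set b := 21 + K ^+ 2 + ln C.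
have lnC0 : 0 <= ln C by rewrite ln_ge0//; lra.
have lnT : 1 + ln T%:R <= b * lam.
  have h1 : ln T%:R <= ln M by rewrite ler_ln ?posrE ?ltr0n.
  have l0 : 0 < lam by lra.
  have h2 : ln M = ln C + 16 * ln lam + ln V.
    have p16 : 0 < lam ^+ 16 by rewrite exprn_gt0.
    rewrite /M lnM ?posrE//; last by rewrite mulr_gt0.
    by rewrite [ln (C * _)]lnM ?posrE// lnXn// mulr_natl.
  have h3 : ln lam <= lam by have := ln_le_sub1 l0; lra.
  have h4 : ln V <= K ^+ 2 + 4 * (lam - 1).
    have := @ln_iterations K sigma eps _ s0 sK e0; rewrite -/V.
    move=> /(_ (le_trans ler01 K1)); by rewrite /lam [1 + ln _ - 1]addrAC subrr add0r.
  have h5 : 21 + K ^+ 2 + ln C <= b * 1 by rewrite mulr1.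
  have h6 : (1 + ln C + K ^+ 2) * 1 <= (1 + ln C + K ^+ 2) * lam by apply: ler_wpM2l; lra.
  by rewrite /b; lra.
have b1 : 1 <= b by rewrite /b; lra.
have bay : b <= a * y.
  have : ln C <= 17 * y.
    by rewrite CE lnXn// mulr_natl; have := ln_le_sub1 y0; lra.
  have : (21 + K ^+ 2) * 1 <= (21 + K ^+ 2) * y by apply: ler_wpM2l; lra.
  by rewrite /b aE; lra.
have Cb : 32 * c ^+ 4 * b ^+ 16 <= C.
  have : b ^+ 16 <= a ^+ 16 * y ^+ 16.
    by rewrite -exprMn; apply: lerXn2r; rewrite ?nnegrE//; lra.
  have -> : C = 32 * c ^+ 4 * (a ^+ 16 * y ^+ 16).
    by rewrite CE exprS mulrA -(mulrA 32) -yE.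
  by apply: ler_wpM2l; lra.
have [W WE] : exists W, W = c * (b * lam) ^+ 4 by exists (c * (b * lam) ^+ 4).
have bl1 : 1 <= b * lam by rewrite -[leLHS]mulr1; apply: ler_pM.
have W1 : 1 <= W by rewrite WE -[leLHS]mulr1; apply: ler_pM => //; rewrite exprn_ege1.
have W4 : 32 * W ^+ 4 <= C * lam ^+ 16.
  have -> : 32 * W ^+ 4 = 32 * c ^+ 4 * b ^+ 16 * lam ^+ 16.
    by rewrite WE expr4_prod !mulrA.
  by apply: ler_wpM2r => //; lra.
have TV : 16 * W ^+ 4 * V <= T%:R.
  have : 32 * W ^+ 4 * V <= M by rewrite /M ler_wpM2r// ltW.
  by lra.
exists T; split => //.
apply: le_trans (_ : W * rate sigma T <= _); last exact: rate_le.
rewrite WE; apply: ler_wpM2r.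
  by rewrite /rate addr_ge0 ?mulr_ge0 ?sqrtr_ge0 ?invr_ge0 ?sqrtr_ge0.
apply: ler_wpM2l; first exact: le_trans ler01 c1.
apply: lerXn2r => //; rewrite ?nnegrE; last exact: le_trans ler01 bl1.
by rewrite addr_ge0// ln_ge0.
Qed.

End Rates.

Lemma bigmine_le_mean (R : realType) (N : nat) (r : nat -> R) : (0 < N)%N ->
  (\big[mine/+oo]_(t < N) (r t)%:E <= (N%:R^-1 * \sum_(t < N) r t)%:E)%E.
Proof.
move=> N0; pose i0 := Ordinal N0.
have [i _ imin] := @arg_minP _ _ 'I_N i0 predT (fun t => r t) isT.
apply: le_trans (_ : ((r i)%:E <= _)%E); first exact: bigmin_le_cond.
rewrite lee_fin mulrC ler_pdivlMr ?ltr0n//.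
have -> : r i * N%:R = \sum_(t < N) r i by rewrite sumr_const card_ord mulr_natr.
by apply: ler_sum => t _; exact: imin.
Qed.

Theorem theorem20 (R : realType) (K : R) :
  exists (C : R) (p : nat), 0 < C /\
  forall (n : nat) (d d' : measure_display)
    (Omega : measurableType d) (P : probability Omega R)
    (Xi : measurableType d') (mu : probability Xi R)
    (X : set 'rV[R]_n) (fs : 'rV[R]_n -> Xi -> R) (f : 'rV[R]_n -> R)
    (h : 'rV[R]_n -> \bar R) (xstar : 'rV[R]_n)
    (L G sigma rho nu beta : R)
    (x0 : 'rV[R]_n) (xi : nat -> Omega -> Xi)
    (x g v : nat -> Omega -> 'rV[R]_n) (alpha Lt : nat -> Omega -> R),
  composite_problem X f h xstar ->
  stochastic_oracle mu X fs f sigma ->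
  bounded_gradients X f h G ->
  smooth_on X f L ->
  0 < rho -> 0 < nu -> beta = nu * sigma ^+ 2 ->
  order_one K L (diam X) G rho (fine (objective f h xstar)) sigma nu ->
  X x0 ->
  fresh_samples P mu xi v ->
  (forall w : Omega,
     alfcg_mvr1 X h rho beta x0
       (fun t => grad (fs ^~ (xi t w)) (x t w))
       (x ^~ w) (g ^~ w) (v ^~ w) (alpha ^~ w) (Lt ^~ w)) ->
  (forall T : nat, (0 < T)%N ->
     (\int[P]_w ((T.+1%:R^-1)%:E * \sum_(t < T.+1) FW_gap X f h (x t w))
      <= (C * (1 + ln T%:R) ^+ p *
          (Num.sqrt nu * (1 + Num.sqrt sigma) * Num.sqrt sigma
             * T%:R `^ (- 4^-1)
           + T%:R `^ (- 2^-1)))%:E)%E)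
  /\
  (forall eps : R, 0 < eps ->
     exists T : nat,
       T%:R <= C * (1 + ln (1 + eps^-1)) ^+ p *
               (sigma ^+ 2 * (1 + Num.sqrt sigma) ^+ 4 / eps ^+ 4
                + (eps ^+ 2)^-1) /\
       (\int[P]_w \big[mine/+oo]_(t < T.+1) FW_gap X f h (x t w)
        <= eps%:E)%E).
Proof.
pose K1 := 1 + `|K|; have K11 : 1 <= K1 by rewrite lerDl.
have KK1 : K <= K1 by apply: le_trans (ler_norm K) _; rewrite lerDr.
have c1 := crate_ge1 K11; have K10 : 0 <= K1 by apply: le_trans K11.
have cb0 : 0 <= cbase K1 (crate K1) ^+ 17.
  rewrite exprn_ge0// /cbase mulr_ge0 ?exprn_ge0 ?addr_ge0 ?sqr_ge0// mulr_ge0// exprn_ge0//.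
  exact: le_trans c1.
have cc0 : 0 < crate K1 * K1.
  by apply: lt_le_trans ltr01 _; rewrite -[leLHS]mulr1; apply: ler_pM.
(* The two summands serve the two claims; the exponent 16 is that of the iteration count, while the
   averaged bound holds already with 4. *)
exists (crate K1 * K1 + cbase K1 (crate K1) ^+ 17), 16%N.
split; first exact: ltr_wpDr.
move=> n d d' Omega P Xi mu X fs f h xstar L G sigma rho nu beta x0 xi x g v alpha Lt
  pb so bg sm rho0 nu0 betaE o1 Xx0 fr tr.
have bK (a : R) : bounded_by K a -> a <= K1.
  by move=> aK; apply: le_trans (ler_norm a) (le_trans aK KK1).
have s0 := sigma_ge0 so; have G0 := G_ge0 bg.
have DK := bK _ (D_O1 o1); have GK := bK _ (G_O1 o1); have LK := bK _ (L_O1 o1).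
have rhoK := bK _ (rho_O1 o1); have irhoK := bK _ (rho_inv_O1 o1).
have nuK := bK _ (nu_O1 o1); have inuK := bK _ (nu_inv_O1 o1).
have sK : sigma <= K1 by have := bK _ (sbar_O1 o1); rewrite /sbar; lra.
have b0 : 0 <= beta by rewrite betaE mulr_ge0 ?sqr_ge0// ltW.
have betaK : beta <= K1 ^+ 3.
  rewrite betaE (exprD K1 1 2) expr1; apply: ler_pM; rewrite ?sqr_ge0 ?(ltW nu0)//.
  by apply: lerXn2r; rewrite ?nnegrE.
have gapE w t : FW_gap X f h (x t w) = (rgap X f h (x ^~ w) t)%:E.
  by rewrite (rgapE pb bg rho0 b0 Xx0 (tr w)).
have avg T : (0 < T)%N -> (\int[P]_w (T.+1%:R^-1 * \sum_(t < T.+1) rgap X f h (x ^~ w) t)%:E <=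
    (crate K1 * (1 + ln T%:R) ^+ 4 * rate sigma T)%:E)%E.
  move=> T0; have [l1 ln1 hrate] := gap_sum_rate T0 K11 nuK (ltW nu0) s0 sK.
  have Th0 : 0 < (4 * K1 * T.+1%:R) ^+ 4.
    by rewrite exprn_gt0// mulr_gt0 ?ltr0n// mulr_gt0//; exact: lt_le_trans K11.
  rewrite -betaE in ln1 hrate.
  apply: le_trans (expected_gap_sum pb so bg sm rho0 b0 Xx0 fr tr K11 DK GK LK rhoK irhoK betaK sK
    Th0 erefl l1 nu0 inuK betaE (ltn0Sn T) _ ln1) _; first by rewrite invr_ge0.
  by rewrite lee_fin.
split.
  move=> T T0; rewrite (_ : (\int[P]_w _)%E = (\int[P]_w (T.+1%:R^-1 * \sum_(t < T.+1) rgap X f h (x ^~ w) t)%:E)%E); last first.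
    apply: eq_integral => w _; rewrite EFinM -sumEFin; congr (_ * _)%E.
    by apply: eq_bigr => t _; rewrite gapE.
  apply: le_trans (avg T T0) _; rewrite lee_fin.
  have lT0 : 0 <= ln (T%:R : R) by rewrite ln_ge0// ler1n.
  have lam1 : 1 <= 1 + ln (T%:R : R) by rewrite lerDl.
  have -> : T%:R `^ (- 2^-1) = (Num.sqrt T%:R)^-1 :> R by rewrite powRN powR12_sqrt.
  have -> : T%:R `^ (- 4^-1) = (Num.sqrt (Num.sqrt T%:R))^-1 :> R.
    rewrite powRN (_ : 4^-1 = 2^-1 * 2^-1); last by field.
    by rewrite powRrM !powR12_sqrt ?sqrtr_ge0.
  set q := (Num.sqrt (Num.sqrt T%:R))^-1; set p := (Num.sqrt T%:R)^-1.
  have q0 : 0 <= q by rewrite invr_ge0 sqrtr_ge0.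
  have p0 : 0 <= p by rewrite invr_ge0 sqrtr_ge0.
  have ss0 := sqrtr_ge0 sigma.
  (* The factor [sqrt nu] is absent from [rate]; the bound on [1 / nu] allows it to be inserted. *)
  have nu1 : 1 <= K1 * Num.sqrt nu.
    have h1 : Num.sqrt nu^-1 <= K1 by exact: sqrt_le_id.
    have : Num.sqrt nu^-1 * Num.sqrt nu <= K1 * Num.sqrt nu by rewrite ler_wpM2r ?sqrtr_ge0.
    by rewrite -sqrtrM ?invr_ge0 ?(ltW nu0)// mulVf ?gt_eqF// sqrtr1.
  have r1 : rate sigma T <= K1 * (Num.sqrt nu * (1 + Num.sqrt sigma) * Num.sqrt sigma * q + p).
    rewrite /rate -/q -/p mulrDr addrC; apply: lerD; last by rewrite ler_peMl.
    have h1 : 1 * 1 <= K1 * Num.sqrt nu * (1 + Num.sqrt sigma) by apply: ler_pM => //; rewrite lerDl.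
    have := ler_wpM2r (mulr_ge0 ss0 q0) h1; rewrite !mul1r !mulrA; exact.
  have rhs0 : 0 <= Num.sqrt nu * (1 + Num.sqrt sigma) * Num.sqrt sigma * q + p.
    by rewrite addr_ge0// mulr_ge0// mulr_ge0// mulr_ge0 ?sqrtr_ge0// addr_ge0.
  have rt0 : 0 <= rate sigma T by rewrite addr_ge0// mulr_ge0.
  have lam0 : 0 <= 1 + ln (T%:R : R) by exact: le_trans lam1.
  have cK0 : 0 <= crate K1 by exact: le_trans c1.
  apply: le_trans (_ : crate K1 * (1 + ln T%:R) ^+ 16 *
     (K1 * (Num.sqrt nu * (1 + Num.sqrt sigma) * Num.sqrt sigma * q + p)) <= _).
    apply: ler_pM => //; first by rewrite mulr_ge0// exprn_ge0.
    by rewrite ler_wpM2l// ler_weXn2l.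
  rewrite mulrA; apply: ler_wpM2r => //; rewrite mulrAC.
  by apply: ler_wpM2r; rewrite ?exprn_ge0// lerDl.
move=> eps e0.
have ei0 : 0 <= eps^-1 by rewrite invr_ge0 ltW.
have lam0 : 0 <= 1 + ln (1 + eps^-1) by rewrite addr_ge0// ln_ge0// lerDl.
have C0 : 0 <= crate K1 * K1 + cbase K1 (crate K1) ^+ 17 by rewrite addr_ge0// ltW.
have V0 : 0 <= sigma ^+ 2 * (1 + Num.sqrt sigma) ^+ 4 / eps ^+ 4 + (eps ^+ 2)^-1.
  rewrite addr_ge0 ?invr_ge0 ?exprn_ge0 ?(ltW e0)// divr_ge0 ?exprn_ge0 ?(ltW e0)//.
  by rewrite mulr_ge0 ?sqr_ge0// exprn_ge0// addr_ge0 ?sqrtr_ge0.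
have mine0 w T : (0 <= \big[mine/+oo]_(t < T.+1) FW_gap X f h (x t w))%E.
  apply: le_bigmin => // t _; rewrite gapE lee_fin.
  exact: (rgap_ge0 pb bg rho0 b0 Xx0 (tr w)).
have minavg w T : (\big[mine/+oo]_(t < T.+1) FW_gap X f h (x t w) <=
    (T.+1%:R^-1 * \sum_(t < T.+1) rgap X f h (x ^~ w) t)%:E)%E.
  under eq_bigr do rewrite gapE; exact: (@bigmine_le_mean _ T.+1 (rgap X f h (x ^~ w))).
(* For large [eps] the horizon 0 suffices, because every gap is at most [2 G D]. *)
have [eK|eK] := ltP (2 * K1 ^+ 2) eps.
  exists 0%N; split; first by rewrite mulr_ge0// mulr_ge0// exprn_ge0.
  have cE := @expectation_cst _ _ _ P eps; rewrite unlock in cE; rewrite -[leRHS]cE.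
  apply: le_lower_integral => w; first exact: mine0.
  apply: le_trans (minavg w 0%N) _; rewrite lee_fin big_ord1 invr1 mul1r.
  apply: le_trans (rgap_diam pb bg rho0 b0 Xx0 (tr w) 0%N) _; apply: le_trans (ltW eK).
  have : G * diam X <= K1 * K1 by apply: ler_pM => //; exact: (diam_ge0 pb Xx0).
  by rewrite expr2; lra.
have [T [T0 TM TE]] := horizon_exists K11 c1 s0 sK e0 eK.
exists T; split.
  apply: le_trans TM _; apply: ler_pM.
  - by rewrite mulr_ge0// exprn_ge0.
  - by rewrite addr_ge0 ?invr_ge0 ?exprn_ge0 ?(ltW e0)// divr_ge0 ?exprn_ge0 ?(ltW e0).
  - by apply: ler_wpM2r; [rewrite exprn_ge0|rewrite lerDr ltW].
  rewrite lerD2r; apply: ler_wpM2r; first by rewrite invr_ge0 exprn_ge0 ?(ltW e0).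
  by rewrite ler_peMr ?sqr_ge0// exprn_ege1// lerDl sqrtr_ge0.
apply: le_trans (_ : (\int[P]_w (T.+1%:R^-1 * \sum_(t < T.+1) rgap X f h (x ^~ w) t)%:E <= _)%E).
  by apply: le_lower_integral => w; [exact: mine0|exact: minavg].
by apply: le_trans (avg T T0) _; rewrite lee_fin.
Qed.
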